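(* Let $n\ge 1$ be an integer, let $m\in\mathbb{N}$, and let $f,g\in\mathcal{P}$ be two polynomials in $z,\overline{z}$, $z\in\mathbb{C}^{n}$. Then the Toeplitz product $T_{f}T_{g}$ is bounded on $F^{2,m}$ if and only if both $f$ and $g$ are constants.
   Context: $\mathbb{N}$ is the set of nonnegative integers, $|z|=(\sum_{j=1}^n |z_j|^2)^{1/2}$ for $z\in\mathbb{C}^n$, and $dv$ is Lebesgue measure on $\mathbb{C}^n$. Put $dV_m(z)=\omega_{n,m}|z|^{2m}e^{-|z|^2}dv(z)$ with $\omega_{n,m}=\frac{(n-1)!}{\pi^n\Gamma(m+n)}$, and $L^2_m=L^2(\mathbb{C}^n,dV_m)$ with inner product $\langle f,g\rangle_m=\int_{\mathbb{C}^n} f\overline{g}\,dV_m$. The Fock-Sobolev space $F^{2,m}$ is the closed subspace of entire functions in $L^2_m$, with the norm $\|f\|_{2,m}=\langle f,f\rangle_m^{1/2}$; $P_m$ is the orthogonal projection from $L^2_m$ onto $F^{2,m}$. For a symbol $f$ that is a polynomial in $z,\overline z$, the Toeplitz operator is $T_f h=P_m(fh)$; it is defined at least on holomorphic polynomials $h$, which are dense in $F^{2,m}$ and which it maps to holomorphic polynomials. The product $T_fT_g$ is called bounded if it is bounded in $\|\cdot\|_{2,m}$ on holomorphic polynomials (i.e. extends to a bounded operator on $F^{2,m}$). The class of polynomials considered is $$\mathcal{P}=\left\{\prod_{s=1}^{n}\Big(\sum_{\beta_s\le k_s}\sum_{\gamma_s\le l_s}a_{\beta_s\gamma_s,s}\,z_s^{\beta_s}\overline{z}_s^{\gamma_s}\Big):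 k_s,l_s\in\mathbb{N},\ a_{\beta_s\gamma_s,s}\in\mathbb{C}\right\},$$ i.e. products over $s=1,\dots,n$ of polynomials in $z_s,\overline{z}_s$ (sums over nonnegative integers $\beta_s,\gamma_s$).
   Formalization: The formal theorem assumes in addition that neither f nor g is identically zero; without this the claim fails, e.g. for f = 0 and g = z_1, where T_f T_g = 0 is bounded but g is not constant. *)

(* Defs.v *)
From HB Require Import structures.
From mathcomp Require Import all_boot all_order all_algebra.
From mathcomp Require Import all_classical all_reals all_analysis.
From mathcomp Require Import complex.
From mathcomp Require mpoly.

Set Implicit Arguments.
Unset Strict Implicit.
Unset Printing Implicit Defensive.

Import Order.TTheory GRing.Theory Num.Theory.
Import numFieldNormedType.Exports.

Local Open Scope classical_set_scope.
Local Open Scope ring_scope.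

Lemma sigma_finite_product d1 d2 (T1 : measurableType d1)
    (T2 : measurableType d2) (R : realType)
    (m1 : {sigma_finite_measure set T1 -> \bar R})
    (m2 : {sigma_finite_measure set T2 -> \bar R}) :
  sigma_finite setT (m1 \x m2)%E.
Proof.
have /sigma_finiteP[F [TF ndF Foo]] := sigma_finiteT m1.
have /sigma_finiteP[G [TG ndG Goo]] := sigma_finiteT m2.
exists (fun k => F k `*` G k).
  rewrite predeqE => -[x y]; split => // _.
  have [i _ Fi] : (\bigcup_i F i) x by rewrite -TF.
  have [j _ Gj] : (\bigcup_i G i) y by rewrite -TG.
  exists (maxn i j) => //; split.
    by move: Fi; exact/subsetPset/ndF/leq_maxl.
  by move: Gj; exact/subsetPset/ndG/leq_maxr.
move=> k; have [mF Fk] := Foo k; have [mG Gk] := Goo k.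
split; first exact: measurableX.
by rewrite product_measure1E// lte_mul_pinfty// ge0_fin_numE.
Qed.

Section PowerMeasure.
Context d (T : measurableType d) (R : realType).
Variable mu : {sigma_finite_measure set T -> \bar R}.

Definition tuple_cons n (x : T * n.-tuple T) : n.+1.-tuple T :=
  [the n.+1.-tuple T of x.1 :: x.2].

Lemma measurable_tuple_cons n : measurable_fun setT (@tuple_cons n).
Proof. by apply: measurable_cons. Qed.

HB.instance Definition _ n :=
  isMeasurableFun.Build _ _ _ _ (@tuple_cons n) (@measurable_tuple_cons n).

Section Step.
Variables (n : nat) (nu : {sigma_finite_measure set (n.-tuple T) -> \bar R}).

Definition mu_cons : set (n.+1.-tuple T) -> \bar R :=
  pushforward (mu \x nu)%E (@tuple_cons n).

Let mu_cons0 : mu_cons set0 = 0%E.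
Proof. by rewrite /mu_cons /pushforward preimage_set0 measure0. Qed.

Let mu_cons_ge0 A : (0 <= mu_cons A)%E.
Proof. exact: measure_ge0. Qed.

Let mu_cons_sigma_additive : semi_sigma_additive mu_cons.
Proof. exact: measure_semi_sigma_additive. Qed.

HB.instance Definition _ := isMeasure.Build _ _ _ mu_cons
  mu_cons0 mu_cons_ge0 mu_cons_sigma_additive.

Let mu_cons_sigma_finite : sigma_finite setT mu_cons.
Proof.
have [F TF Foo] := sigma_finite_product mu nu.
pose u (t : n.+1.-tuple T) := (thead t, [tuple of behead t]).
have uK : cancel (@tuple_cons n) u.
  by move=> [x t]; rewrite /u /tuple_cons/=; congr pair; apply/val_inj.
have mu_ : measurable_fun setT u.
  apply/measurable_fun_pair; first exact: measurable_tnth.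
  exact: measurable_behead.
exists (fun k => u @^-1` F k); first by rewrite -preimage_bigcup -TF.
move=> k; have [mF Fk] := Foo k; split.
  by rewrite -[X in measurable X]setTI; exact: mu_.
rewrite /mu_cons /pushforward (_ : _ @^-1` _ = F k)//.
by apply/seteqP; split => x /=; rewrite uK.
Qed.

HB.instance Definition _ := Measure_isSigmaFinite.Build _ _ _ mu_cons
  mu_cons_sigma_finite.

End Step.

(* mu_pow n is the product measure mu \x ... \x mu (n factors). *)
Fixpoint mu_pow n : {sigma_finite_measure set (n.-tuple T) -> \bar R} :=
  if n is k.+1 then mu_cons (mu_pow k)
  else \d_([tuple] : 0.-tuple T).

End PowerMeasure.

(* Differentiability with respect to the field K: for K = R[i] the differential
   is R[i]-linear, so that f is entire holomorphic. *)
Definition entire (K : numFieldType) n (f : 'rV[K]_n -> K) : Prop :=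
  forall z : 'rV[K]_n, differentiable f z.

Section FockSobolev.
Variable R : realType.
Local Notation C := R[i].
Local Notation RR := (measurableTypeR R).

Definition plane_lebesgue : set (RR * RR) -> \bar R :=
  (@lebesgue_measure R \x @lebesgue_measure R)%E.

HB.instance Definition _ := Measure.on plane_lebesgue.
HB.instance Definition _ := Measure_isSigmaFinite.Build _ _ _ plane_lebesgue
  (sigma_finite_product (@lebesgue_measure R) (@lebesgue_measure R)).

Section Dimension.
Variable n : nat.
Local Notation Cn := 'rV[C]_n.

(* dv. A point of C^n is represented by the n-tuple of the pairs
   (Re z_j, Im z_j). *)
Definition dv : {sigma_finite_measure set (n.-tuple (RR * RR)) -> \bar R} :=
  mu_pow plane_lebesgue n.

Definition toCn (t : n.-tuple (RR * RR)) : Cn :=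
  \row_j ((tnth t j).1 +i* (tnth t j).2)%C.

Definition Cmeasurable (F : Cn -> C) : Prop :=
  measurable_fun setT (fun t => complex.Re (F (toCn t)) : RR) /\
  measurable_fun setT (fun t => complex.Im (F (toCn t)) : RR).

Definition Cint (F : Cn -> C) : C :=
  ((\int[dv]_t complex.Re (F (toCn t))) +i*
   (\int[dv]_t complex.Im (F (toCn t))))%C.

Definition cnorm (z : Cn) : R := Num.sqrt (\sum_j Normc.normc (z 0 j) ^+ 2).

Definition hol_poly (h : Cn -> C) : Prop :=
  exists p : mpoly.mpoly n C, forall z : Cn, h z = mpoly.meval (z 0) p.

Definition class_P (f : Cn -> C) : Prop :=
  exists (k l : 'I_n -> nat) (a : nat -> nat -> 'I_n -> C),
  forall z : Cn, f z =
    \prod_(s < n) \sum_(b < (k s).+1) \sum_(c < (l s).+1)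
      a b c s * z 0 s ^+ b * ((z 0 s)^*)%C ^+ c.

Section Weight.
Variable m : nat.

(* For n >= 1, (m + n).-1`! is Gamma(m + n). *)
Definition omega : R := (n.-1)`!%:R / (pi ^+ n * ((m + n).-1)`!%:R).

(* The density of dV_m with respect to dv. *)
Definition weight (z : Cn) : R :=
  omega * cnorm z ^+ (2 * m) * expR (- cnorm z ^+ 2).

Definition L2 (f : Cn -> C) : Prop :=
  Cmeasurable f /\
  (\int[dv]_t (Normc.normc (f (toCn t)) ^+ 2 * weight (toCn t))%:E < +oo)%E.

Definition inner (f g : Cn -> C) : C :=
  Cint (fun z => f z * ((g z)^*)%C * (weight z)%:C%C).

Definition norm2 (f : Cn -> C) : R := Num.sqrt (complex.Re (inner f f)).

Definition fock_sobolev : set (Cn -> C) := [set f | entire f /\ L2 f].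

Definition is_projection (u p : Cn -> C) : Prop :=
  fock_sobolev p /\
  forall e, fock_sobolev e -> inner (fun z => u z - p z) e = 0.

(* The projection of u in L^2_m; an entire function is determined by its class
   in L^2_m, so that at most one p satisfies is_projection u p. *)
Definition proj (u : Cn -> C) : Cn -> C :=
  xget (fun=> 0) [set p | is_projection u p].

Definition toeplitz (f h : Cn -> C) : Cn -> C := proj (fun z => f z * h z).

Definition toeplitz_product_bounded (f g : Cn -> C) : Prop :=
  exists M : R, forall h, hol_poly h ->
    norm2 (toeplitz f (toeplitz g h)) <= M * norm2 h.

End Weight.
End Dimension.
End FockSobolev.

(* Main.v *)
Require Import Defs.
From mathcomp Require Import all_boot all_order all_algebra.
From mathcomp Require Import all_classical all_reals all_analysis.
From mathcomp Require Import complex.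
From mathcomp Require Import measurable_realfun zify ring lra.
From mathcomp Require mpoly.

(** Why the theorem is true.

    In F^{2,m} the monomials z^b are orthogonal, and for holomorphic z^x the
    projection of z^x z^b conj(z)^c is an explicit multiple of z^(x + b - c),
    zero if an exponent would become negative ([proj_poly], [toeplitz_coef]).
    Hence T_f T_g is known through its matrix entries between monomials, and
    boundedness bounds the entry from z^x to z^y by a constant times the
    product of the norms of z^x and z^y ([entry_bound]).  Let x = (t, ..., t)
    with t going to infinity and y = x + v with v fixed.  A term z^b conj(z)^c
    of f and a term z^b' conj(z)^c' of g contribute to the coefficient of z^y in
    T_f T_g z^x if b - c + b' - c' = v, and then with the exact order
    t^(|c| + |c'|), while the square of the quotient of the norms of z^x and z^y
    has order t^(-|v|).

    Cancellation between terms is excluded by the product structure of f and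
    g.  In every variable take, separately for f and for g, the term which
    maximizes w (b - c) + c, where the absolute value of w exceeds all c
    ([dominant]).  Among the pairs of terms that contribute to the same entry
    the quantity w (b - c + b' - c') is constant, so that the chosen pair is
    the only one of the largest order t^(|c| + |c'|).  Comparing orders gives
    2 (|c| + |c'|) + (|b| + |b'| - |c| - |c'|) <= 0, that is b = c = 0 and
    b' = c' = 0 ([top_term_constant]).  This holds for both signs of w, and the
    two maximality conditions leave no term but the constant one in any
    variable.

    The analytic part is the formula for the projection: a multiple of
    z^(b - c) has to be the projection of z^b conj(z)^c against all entire
    functions e in L^2_m, where entire only means complex differentiable at
    every point.  Everything follows from the single identity
    [Cint_pairing_incr_conj], which says that the integral of
    d/dz_j (z^b conj(z)^c exp(-|z|^2)) conj(e) vanishes.  In one variable the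
    field is multiplied by a cut-off which vanishes on the boundary of a large
    square; the divergence theorem holds for fields that are merely
    differentiable, if the divergence is continuous ([divergence]), by the
    bisection argument of Goursat; then the square is enlarged by dominated
    convergence ([slice_dfield_null]).  Fubini's theorem in one coordinate
    ([integral_slice_null]) gives the identity in C^n.  The factor |z|^(2m) of
    the weight is the m-th power of the sum of the z_j conj(z_j), and expanding
    it one step at a time yields the rising factorials of [Cint_pairing].  The
    value of the Gaussian integral is irrelevant: all moments are multiples of
    it, and only its positivity is used.

    Conversely, the projection does not increase norms, so T_c T_d is bounded
    for constants c and d. *)

Set Implicit Arguments.
Unset Strict Implicit.
Unset Printing Implicit Defensive.

Import Order.TTheory GRing.Theory Num.Theory.
Import numFieldNormedType.Exports.

Local Open Scope classical_set_scope.
Local Open Scope ring_scope.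

(** * Linear operations on integrable real functions *)

Section RealIntegrable.
Context d (T : measurableType d) (R : realType).
Variable mu : {measure set T -> \bar R}.
Implicit Types (f g : T -> R).

Lemma integrable_scale f r : mu.-integrable setT (EFin \o f) ->
  mu.-integrable setT (EFin \o (fun t => r * f t)).
Proof. by move=> If; have := integrableZl measurableT r If; apply: eq_integrable. Qed.

Lemma integrable_add f g : mu.-integrable setT (EFin \o f) ->
  mu.-integrable setT (EFin \o g) ->
  mu.-integrable setT (EFin \o (fun t => f t + g t)).
Proof. by move=> If Ig; have := integrableD measurableT If Ig; apply: eq_integrable. Qed.

End RealIntegrable.

(** * Bisection and the divergence theorem *)

Section Bisection.
Variable R : realType.
Implicit Types (x y s L : R).

(** Goursat's argument in abstract form: an additive function of squares that
    is o(area) at every point vanishes.  Otherwise one of the four quarters of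
    a square keeps the ratio of the value to the area, and the nested squares
    obtained in this way shrink to a point where the local bound fails. *)
Lemma bisection (Phi : R -> R -> R -> R) (a b L : R) :
  0 < L ->
  (forall x y s, 0 < s ->
     Phi x y (s + s) = Phi x y s + Phi (x + s) y s + Phi x (y + s) s +
                       Phi (x + s) (y + s) s) ->
  (forall p q e, 0 < e -> exists2 d, 0 < d &
     forall x y s, 0 < s < d -> x <= p <= x + s -> y <= q <= y + s ->
       `|Phi x y s| <= e * s ^+ 2) ->
  Phi a b L = 0.
Proof.
move=> L0 additive local.
apply: contrapT => /eqP Phi0.
(* Half of the initial ratio, so that the initial square is strictly [bad]. *)
pose e := `|Phi a b L| / (2 * L ^+ 2).
have e0 : 0 < e by rewrite divr_gt0 ?normr_gt0// mulr_gt0// exprn_gt0.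
pose bad x y s := e * s ^+ 2 < `|Phi x y s|.
have bad0 : bad a b L.
  rewrite /bad /e; have -> : `|Phi a b L| / (2 * L ^+ 2) * L ^+ 2 = `|Phi a b L| / 2.
    by field; rewrite gt_eqF.
  by rewrite ltr_pdivrMr// mulr2n mulrDr mulr1 ltrDl normr_gt0.
have half x y s : 0 < s -> bad x y (s + s) ->
    exists uv : bool * bool, bad (x + uv.1%:R * s) (y + uv.2%:R * s) s.
  move=> s0; rewrite /bad additive// => B; apply: contrapT => /forallNP H.
  have Hn (u v : bool) : `|Phi (x + u%:R * s) (y + v%:R * s) s| <= e * s ^+ 2.
    by have /negP := H (u, v); rewrite -leNgt.
  have := Hn false false; have := Hn false true.
  have := Hn true false; have := Hn true true.
  rewrite !mul1r !mul0r !addr0 => h1 h2 h3 h4.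
  move: B; apply/negP; rewrite -leNgt.
  have -> : e * (s + s) ^+ 2 = e * s ^+ 2 + e * s ^+ 2 + e * s ^+ 2 + e * s ^+ 2 by ring.
  apply: (le_trans (ler_normD _ _)); apply: lerD => //.
  apply: (le_trans (ler_normD _ _)); apply: lerD => //.
  by apply: (le_trans (ler_normD _ _)); apply: lerD.
pose len k := L / 2 ^+ k.
have len0 k : 0 < len k by rewrite divr_gt0// exprn_gt0.
have lenS k : len k = len k.+1 + len k.+1.
  by rewrite /len exprS; field; rewrite expf_neq0.
pose step k (xy : R * R) :=
  let uv := xget (false, false)
    [set uv : bool * bool | bad (xy.1 + uv.1%:R * len k.+1)
                                (xy.2 + uv.2%:R * len k.+1) (len k.+1)] in
  (xy.1 + uv.1%:R * len k.+1, xy.2 + uv.2%:R * len k.+1).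
pose sq := fix sq k := if k is j.+1 then step j (sq j) else (a, b).
have sqbad k : bad (sq k).1 (sq k).2 (len k).
  elim: k => [|k IH]; first by rewrite /len expr0 divr1.
  rewrite (lenS k) in IH; have [uv uvP] := half _ _ _ (len0 k.+1) IH.
  by rewrite /= /step; case: xgetP => [? -> //|/(_ uv)]; rewrite /= => /(_ uvP).
have step_le (pr : R * R -> R) (prE : pr = fst \/ pr = snd) k :
    pr (sq k) <= pr (sq k.+1) /\ pr (sq k.+1) + len k.+1 <= pr (sq k) + len k.
  have H (c : bool) (z : R) : z <= z + c%:R * len k.+1 /\
      z + c%:R * len k.+1 + len k.+1 <= z + len k.
    by rewrite (lenS k); have := len0 k.+1; case: c; rewrite ?mul1r ?mul0r; lra.
  by case: prE => -> /=; exact: H.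
have nested (pr : R * R -> R) (prE : pr = fst \/ pr = snd) j k :
    pr (sq j) <= pr (sq k) + len k.
  have up i n : pr (sq i) <= pr (sq (i + n)%N).
    elim: n => [|n IH]; first by rewrite addn0.
    by rewrite addnS (le_trans IH)//; case: (step_le pr prE (i + n)%N).
  have dn i n : pr (sq (i + n)%N) + len (i + n)%N <= pr (sq i) + len i.
    elim: n => [|n IH]; first by rewrite addn0.
    by rewrite addnS (le_trans _ IH)//; case: (step_le pr prE (i + n)%N).
  case: (leqP j k) => [jk|/ltnW kj].
    by have := up j (k - j)%N; rewrite subnKC// => /le_trans->//; rewrite lerDl ltW.
  by have := dn k (j - k)%N; rewrite subnKC// => /(le_trans _)->//; rewrite lerDl ltW.
have limit (pr : R * R -> R) (prE : pr = fst \/ pr = snd) :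
    exists p, forall k, pr (sq k) <= p <= pr (sq k) + len k.
  exists (sup (range (pr \o sq))) => k; apply/andP; split.
    apply: ub_le_sup; last by exists k.
    by exists (pr (sq 0) + len 0) => _ [j _ <-]; exact: nested.
  apply: ge_sup; first by exists (pr (sq 0)), 0.
  by move=> _ [j _ <-]; exact: nested.
have [p pP] := limit fst (or_introl erefl).
have [q qP] := limit snd (or_intror erefl).
have [d d0 dP] := local p q e e0.
have [k kd] : exists k, len k < d.
  have := @cvg_geometric R L 2^-1; rewrite ger0_norm// invf_lt1// ltr1n => /(_ isT).
  move=> /cvgrPdist_lt /(_ _ d0) [k _ /(_ k (leqnn k))].
  rewrite sub0r normrN /geometric /= exprVn -/(len k) gtr0_norm// => ?.
  by exists k.
by have := sqbad k; rewrite /bad ltNge dP// len0.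
Qed.

End Bisection.

Section Divergence.
Variable R : realType.
Local Notation RR := (measurableTypeR R).
Local Notation leb := (@lebesgue_measure R).
Local Notation plane := (@plane_lebesgue R : {measure set (RR * RR) -> \bar R}).
Implicit Types (f g : R -> R) (x y s L : R).

(** Half-open segments and squares make subdivision an exact partition. *)
Definition segment_int f y s : R := \int[leb]_(t in `[y, (y + s)[) f t.

Lemma integrable_segment f y s : continuous f ->
  leb.-integrable `[y, (y + s)[ (EFin \o f).
Proof.
move=> cf; apply: (@integrableS _ _ _ leb `[y, (y + s)]%classic) => //.
- by apply: subset_itvl; rewrite bnd_simp.
- apply: continuous_compact_integrable; first exact: segment_compact.
  by move=> z; apply: continuous_subspaceT.
Qed.

Lemma segment_intB f g y s : continuous f -> continuous g ->
  segment_int (fun t => f t - g t) y s = segment_int f y s - segment_int g y s.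
Proof. by move=> cf cg; rewrite /segment_int RintegralB//; exact: integrable_segment. Qed.

Lemma segment_int_split f y s : 0 < s -> continuous f ->
  segment_int f y (s + s) = segment_int f y s + segment_int f (y + s) s.
Proof.
move=> s0 cf; rewrite /segment_int addrA.
have E : `[y, (y + s + s)[%classic = `[y, (y + s)[ `|` `[(y + s), (y + s + s)[ :> set R.
  by apply: itv_bndbnd_setU; rewrite bnd_simp lerDl ltW.
rewrite E Rintegral_setU//.
  by rewrite -E -addrA; exact: integrable_segment.
apply/disj_setPS => z [/=]; rewrite !in_itv/= => /andP[_ +] /andP[].
by move=> /lt_le_trans H /H; rewrite ltxx.
Qed.

Lemma segment_int_cst c y s : 0 < s -> segment_int (fun=> c) y s = c * s.
Proof.
move=> s0; rewrite /segment_int Rintegral_cst//= lebesgue_measure_itv/= lte_fin.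
by rewrite ltrDl s0 -EFinB/= [y + s]addrC addrK.
Qed.

Lemma segment_int_bound f y s c : 0 < s -> continuous f ->
  (forall t, y <= t <= y + s -> `|f t| <= c) -> `|segment_int f y s| <= c * s.
Proof.
move=> s0 cf fc; rewrite -(segment_int_cst c y s0).
have If := integrable_segment y s cf.
apply: (le_trans (le_normr_Rintegral _ If)) => //.
apply: le_Rintegral => //.
- exact: (integrable_norm If).
- by apply: integrable_segment => z; exact: cvg_cst.
- by move=> t /=; rewrite in_itv/= => /andP[h1 /ltW h2]; apply: fc; rewrite h1.
Qed.

Definition square x y s : set (RR * RR) := `[x, (x + s)[ `*` `[y, (y + s)[.

Lemma measurable_square x y s : measurable (square x y s).
Proof. by apply: measurableX; exact: measurable_itv. Qed.

Lemma measure_square x y s : 0 < s -> plane (square x y s) = (s ^+ 2)%:E.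
Proof.
move=> s0; pose I z : set R := `[z, (z + s)[%classic; transitivity (leb (I x) * leb (I y))%E.
  by rewrite -[LHS]/((@lebesgue_measure R \x @lebesgue_measure R)%E (square x y s)) product_measure1E.
have M (z : R) : leb `[z, (z + s)[%classic = s%:E.
  by rewrite lebesgue_measure_itv/= lte_fin ltrDl s0 -EFinB [z + s]addrC addrK.
by rewrite expr2 EFinM; congr (_ * _)%E; exact: M.
Qed.

Lemma square_split (G : RR * RR -> R) x y s : 0 < s ->
  (forall x y s, 0 < s -> plane.-integrable (square x y s) (EFin \o G)) ->
  \int[plane]_(t in square x y (s + s)) G t =
  \int[plane]_(t in square x y s) G t +
  \int[plane]_(t in square (x + s) y s) G t +
  \int[plane]_(t in square x (y + s) s) G t +
  \int[plane]_(t in square (x + s) (y + s) s) G t.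
Proof.
move=> s0 iG.
have E (z : R) : `[z, (z + (s + s))[%classic = `[z, (z + s)[ `|` `[(z + s), (z + s + s)[ :> set R.
  by rewrite addrA; apply: itv_bndbnd_setU; rewrite bnd_simp lerDl ltW.
have D (z : R) : `[z, (z + s)[ `&` `[(z + s), (z + s + s)[ = set0 :> set R.
  rewrite -subset0 => w [/=]; rewrite !in_itv/= => /andP[_ +] /andP[].
  by move=> /lt_le_trans H /H; rewrite ltxx.
have mI (u v : R) : measurable (`[u, v[%classic : set RR) by exact: measurable_itv.
have B : square x y (s + s) = (square x y s `|` square (x + s) y s) `|`
                           (square x (y + s) s `|` square (x + s) (y + s) s).
  rewrite /square !E; apply/seteqP; split => -[u v] /=; last by tauto.
  by move=> [[hu|hu] [hv|hv]]; tauto.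
have IG := iG x y (s + s) (addr_gt0 s0 s0).
have S1 : square x y s `|` square (x + s) y s `<=` square x y (s + s) by rewrite B; exact: subsetUl.
have S2 : square x (y + s) s `|` square (x + s) (y + s) s `<=` square x y (s + s).
  by rewrite B; exact: subsetUr.
have mb := measurable_square.
rewrite {1}B Rintegral_setU//; [|exact: measurableU|exact: measurableU|by rewrite -B|].
  rewrite Rintegral_setU//; last 2 first.
  - by apply: integrableS IG => //; exact: measurableU.
  - by apply/disj_setPS => -[u v] /= [[Hu _] [Hu' _]]; have := D x; rewrite -subset0 => /(_ u); apply.
  rewrite Rintegral_setU//; last 2 first.
  - by apply: integrableS IG => //; exact: measurableU.
  - by apply/disj_setPS => -[u v] /= [[Hu _] [Hu' _]]; have := D x; rewrite -subset0 => /(_ u); apply.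
  by rewrite !addrA.
apply/disj_setPS => -[u v] /= H; have := D y; rewrite -subset0 => /(_ v); apply.
by case: H => -[[_ h1]|[_ h1]] [[_ h2]|[_ h2]].
Qed.

(** Differentiability at [(p, q)] with partial derivatives [A] and [B]. *)
Definition has_gradient (F : R -> R -> R) p q A B :=
  forall e, 0 < e -> exists2 d, 0 < d & forall x y, `|x - p| < d -> `|y - q| < d ->
    `|F x y - F p q - (A * (x - p) + B * (y - q))| <= e * (`|x - p| + `|y - q|).

Lemma has_gradient_continuous F p q A B : has_gradient F p q A B ->
  {for q, continuous (F p)} /\ {for p, continuous (F ^~ q)}.
Proof.
move=> /(_ 1 ltr01)[d d0 dP].
have c0 (c e : R) : 0 < e -> exists2 d, 0 < d & forall t, `|t| < d -> `|c * t| + `|t| < e.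
  move=> e0; exists (e / (`|c| + 1)); first by rewrite divr_gt0// ltr_wpDl.
  move=> t; rewrite ltr_pdivlMr ?ltr_wpDl// normrM => ?.
  by rewrite -[X in _ + X]mul1r -mulrDl mulrC.
have tri (u v w r e : R) : `|u - v - w| <= r -> `|w| + r < e -> `|v - u| < e.
  move=> h; apply: le_lt_trans.
  have -> : v - u = - w - (u - v - w) by ring.
  by rewrite (le_trans (ler_normB _ _))// normrN lerD2l.
split; apply/cvgrPdist_lt => e e0; rewrite -nbhs_nearE.
- have [d' d'0 d'P] := c0 B e e0.
  apply/nbhs_ballP; exists (Num.min d d') => /=; first by rewrite lt_min d0.
  move=> y; rewrite /ball/= distrC lt_min => /andP[yd yd'].
  have := dP p y; rewrite subrr normr0 mulr0 !add0r => /(_ d0 yd).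
  by rewrite mul1r => /tri; apply; exact: d'P.
- have [d' d'0 d'P] := c0 A e e0.
  apply/nbhs_ballP; exists (Num.min d d') => /=; first by rewrite lt_min d0.
  move=> x; rewrite /ball/= distrC lt_min => /andP[xd xd'].
  have := dP x q; rewrite subrr normr0 mulr0 !addr0 => /(_ xd d0).
  by rewrite mul1r => /tri; apply; exact: d'P.
Qed.

(** The partial derivatives of [P] and [Q] need not be continuous, nor even
    integrable; only their combination [g] has to be continuous.  On a small
    square around a point the affine parts of [P] and [Q] contribute exactly
    the value of [g] at the point times the area to the flux, and the
    remainders are o(area), so that flux minus integral is a function of
    squares to which [bisection] applies. *)
Lemma divergence (P Q g : R -> R -> R) a b L :
  0 < L ->
  (forall p q, exists A B C D, [/\ has_gradient P p q A B,
     has_gradient Q p q C D & A + D = g p q]) ->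
  (forall p q e, 0 < e -> exists2 d, 0 < d & forall x y,
     `|x - p| < d -> `|y - q| < d -> `|g x y - g p q| <= e) ->
  (forall x y s, 0 < s ->
     plane.-integrable (square x y s) (EFin \o (fun t => g t.1 t.2))) ->
  segment_int (P (a + L)) b L - segment_int (P a) b L +
  (segment_int (Q ^~ (b + L)) a L - segment_int (Q ^~ b) a L) =
  \int[plane]_(t in square a b L) g t.1 t.2.
Proof.
move=> L0 grad cg ig.
have cP x : continuous (P x).
  by move=> y; have [A [B [C [D [/has_gradient_continuous[]]]]]] := grad x y.
have cQ y : continuous (Q ^~ y).
  by move=> x; have [A [B [C [D [_ /has_gradient_continuous[]]]]]] := grad x y.
pose Phi x y s := segment_int (P (x + s)) y s - segment_int (P x) y s +
  (segment_int (Q ^~ (y + s)) x s - segment_int (Q ^~ y) x s) -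
  \int[plane]_(t in square x y s) g t.1 t.2.
apply/eqP; rewrite -subr_eq0; apply/eqP.
apply: (bisection (Phi := Phi)) => //.
  move=> x y s s0; rewrite /Phi square_split//.
  by rewrite (segment_int_split y s0 (cP x)) (segment_int_split y s0 (cP _)) (segment_int_split x s0 (cQ y))
    (segment_int_split x s0 (cQ _)) !addrA; ring.
move=> p q e e0; have [A [B [C [D [hP hQ ADg]]]]] := grad p q.
have e9 : 0 < e / 9 by rewrite divr_gt0.
have [d1 d10 d1P] := hP _ e9; have [d2 d20 d2P] := hQ _ e9.
have [d3 d30 d3P] := cg p q _ e9.
exists (Num.min d1 (Num.min d2 d3)); first by rewrite !lt_min d10 d20.
move=> x y s /andP[s0]; rewrite !lt_min => /and3P[s1 s2 s3] /andP[xp px] /andP[yq qy].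
have near1 (z r t : R) : z <= r -> r <= z + s -> z <= t <= z + s -> `|t - r| <= s.
  by move=> h1 h2 /andP[h3 h4]; rewrite ler_norml; lra.
have nx := near1 x p _ xp px; have ny := near1 y q _ yq qy.
have xx : x <= x <= x + s by rewrite lexx lerDl ltW.
have xxs : x <= x + s <= x + s by rewrite lexx lerDl ltW.
have yy : y <= y <= y + s by rewrite lexx lerDl ltW.
have yys : y <= y + s <= y + s by rewrite lexx lerDl ltW.
have bP : `|segment_int (P (x + s)) y s - segment_int (P x) y s - A * s * s| <= 4 * (e / 9) * s * s.
  have cB : continuous (fun t => P (x + s) t - P x t).
    by move=> t; apply: cvgB; exact: cP.
  rewrite -segment_intB// -(segment_int_cst (A * s) y s0) -segment_intB//; last by move=> z; exact: cvg_cst.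
  apply: segment_int_bound => //; first by move=> t; apply: cvgB; [exact: cB|exact: cvg_cst].
  move=> t yt; have h1 := d1P _ _ (le_lt_trans (nx _ xxs) s1) (le_lt_trans (ny _ yt) s1).
  have h2 := d1P _ _ (le_lt_trans (nx _ xx) s1) (le_lt_trans (ny _ yt) s1).
  set u := P (x + s) t in h1 *; set v := P x t in h2 *.
  have -> : u - v - A * s = (u - P p q - (A * (x + s - p) + B * (t - q))) -
     (v - P p q - (A * (x - p) + B * (t - q))) by ring.
  apply: (le_trans (ler_normB _ _)).
  apply: (le_trans (lerD h1 h2)).
  rewrite -mulrDr (_ : 4 * (e / 9) * s = e / 9 * (4 * s)); last by ring.
  rewrite ler_pM2l//.
  by have := nx _ xx; have := nx _ xxs; have := ny _ yt; lra.
have bQ : `|segment_int (Q ^~ (y + s)) x s - segment_int (Q ^~ y) x s - D * s * s| <= 4 * (e / 9) * s * s.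
  have cB : continuous (fun t => Q t (y + s) - Q t y).
    by move=> t; apply: cvgB; exact: cQ.
  rewrite -segment_intB// -(segment_int_cst (D * s) x s0) -segment_intB//; last by move=> z; exact: cvg_cst.
  apply: segment_int_bound => //; first by move=> t; apply: cvgB; [exact: cB|exact: cvg_cst].
  move=> t xt; have h1 := d2P _ _ (le_lt_trans (nx _ xt) s2) (le_lt_trans (ny _ yys) s2).
  have h2 := d2P _ _ (le_lt_trans (nx _ xt) s2) (le_lt_trans (ny _ yy) s2).
  set u := Q t (y + s) in h1 *; set v := Q t y in h2 *.
  have -> : u - v - D * s = (u - Q p q - (C * (t - p) + D * (y + s - q))) -
     (v - Q p q - (C * (t - p) + D * (y - q))) by ring.
  apply: (le_trans (ler_normB _ _)).
  apply: (le_trans (lerD h1 h2)).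
  rewrite -mulrDr (_ : 4 * (e / 9) * s = e / 9 * (4 * s)); last by ring.
  rewrite ler_pM2l//.
  by have := nx _ xt; have := ny _ yy; have := ny _ yys; lra.
have bg : `|\int[plane]_(t in square x y s) g t.1 t.2 - g p q * s ^+ 2| <= e / 9 * s ^+ 2.
  have Ig := ig x y s s0; have mb := measurable_square x y s.
  have Ic c : plane.-integrable (square x y s) (EFin \o (fun=> c)).
    apply: measurable_bounded_integrable => //; last exact: bounded_cst.
    by rewrite [ltLHS]measure_square// ltry.
  have cE c : c * s ^+ 2 = \int[plane]_(t in square x y s) c.
    by rewrite Rintegral_cst// -[plane _]/(plane (square x y s)) measure_square.
  rewrite !cE -RintegralB//.
  have IB : plane.-integrable (square x y s)
      (EFin \o (fun t => g t.1 t.2 - g p q)).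
    have := integrableB mb Ig (Ic (g p q)); apply: eq_integrable => //.
  apply: (le_trans (le_normr_Rintegral _ IB)) => //.
  apply: le_Rintegral => //; first exact: (integrable_norm IB).
  move=> [u v]; rewrite /square /= !in_itv /= => -[/andP[xu /ltW ux] /andP[yv /ltW vy]].
  apply: d3P; [apply: le_lt_trans (nx _ _) s3|apply: le_lt_trans (ny _ _) s3].
    by rewrite xu.
  by rewrite yv.
have sq c : c * s * s = c * s ^+ 2 by rewrite expr2 mulrA.
rewrite !sq in bP bQ; rewrite /Phi.
set I1 := segment_int (P (x + s)) y s - segment_int (P x) y s in bP *.
set I2 := segment_int (Q ^~ (y + s)) x s - segment_int (Q ^~ y) x s in bQ *.
set I3 := Rintegral _ _ _ in bg *.
have -> : I1 + I2 - I3 = (I1 - A * s ^+ 2) + (I2 - D * s ^+ 2) - (I3 - g p q * s ^+ 2).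
  by rewrite -ADg; ring.
apply: (le_trans (ler_normB _ _)).
apply: (le_trans (lerD (ler_normD _ _) (lexx _))).
apply: (le_trans (lerD (lerD bP bQ) bg)).
by move: (s ^+ 2) => S; lra.
Qed.

End Divergence.

(** * Complex norms and Wirtinger derivatives *)

Section ComplexNumbers.
Variable R : realType.
Local Notation C := R[i].
Local Notation nc := (@Normc.normc R).
Implicit Types (z w : C).

Lemma normc_normr z : `|z| = (nc z)%:C%C. Proof. by rewrite normc_def; case: z. Qed.

Lemma normc_real (x : R) : nc x%:C%C = `|x|.
Proof. by rewrite /Normc.normc /= expr0n addr0 sqrtr_sqr. Qed.

Lemma normc_ge0 z : 0 <= nc z. Proof. by case: z => a b; exact: sqrtr_ge0. Qed.

Lemma normcX z k : nc (z ^+ k) = nc z ^+ k.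
Proof. by elim: k => [|k IH]; rewrite ?expr0 ?Normc.normc1// !exprS Normc.normcM IH. Qed.

Lemma normc_conj z : nc (z^*)%C = nc z.
Proof. by case: z => a b /=; rewrite sqrrN. Qed.

Lemma normcDl z w : nc (z + w) <= nc z + nc w. Proof. exact: le_normcD. Qed.

Lemma Re_le_normc z : `|complex.Re z| <= nc z.
Proof.
by case: z => a b /=; rewrite -sqrtr_sqr ler_wsqrtr// lerDl sqr_ge0.
Qed.

Lemma Im_le_normc z : `|complex.Im z| <= nc z.
Proof.
by case: z => a b /=; rewrite -sqrtr_sqr ler_wsqrtr// lerDr sqr_ge0.
Qed.

Lemma normc_le z : nc z <= `|complex.Re z| + `|complex.Im z|.
Proof.
case: z => a b /=; rewrite -[leRHS]ger0_norm ?addr_ge0// -sqrtr_sqr ler_wsqrtr//.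
by rewrite sqrrD !real_normK ?num_real// lerD2r lerDl mulrn_wge0// mulr_ge0.
Qed.

Lemma ReM z w : complex.Re (z * w) =
  complex.Re z * complex.Re w - complex.Im z * complex.Im w.
Proof. by case: z => a b; case: w. Qed.

Lemma ImM z w : complex.Im (z * w) =
  complex.Re z * complex.Im w + complex.Im z * complex.Re w.
Proof. by case: z => a b; case: w. Qed.

Lemma conjcM z w : (z * w)^*%C = z^*%C * w^*%C. Proof. exact: rmorphM. Qed.
Lemma conjcX z k : (z ^+ k)^*%C = z^*%C ^+ k. Proof. exact: rmorphXn. Qed.

Lemma conjc_prod (I : Type) (r : seq I) (P : pred I) (F : I -> C) :
  (\prod_(i <- r | P i) F i)^*%C = \prod_(i <- r | P i) (F i)^*%C.
Proof. exact: rmorph_prod. Qed.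

Lemma ReJ z : complex.Re (z^*)%C = complex.Re z. Proof. by case: z. Qed.
Lemma ImJ z : complex.Im (z^*)%C = - complex.Im z. Proof. by case: z. Qed.

Lemma sqr_normcE z : nc z ^+ 2 = complex.Re z ^+ 2 + complex.Im z ^+ 2.
Proof. by case: z => a b /=; rewrite sqr_sqrtr// addr_ge0 ?sqr_ge0. Qed.

Lemma sqr_normcJ (w : C) : (nc w ^+ 2)%:C%C = w * (w^*)%C.
Proof. by rewrite -sqr_normc normc_normr -rmorphXn. Qed.

End ComplexNumbers.

Lemma derivable_approx (K : numFieldType) (V : normedModType K) (f : V -> K^o)
    (z v : V) : derivable f z v ->
  forall e, 0 < e -> exists2 d, 0 < d & forall h : K, `|h| < d ->
    `|f (h *: v + z) - f z - h * 'D_v f z| <= e * `|h|.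
Proof.
move=> /derivable_nbhs /eqaddoP df e e0.
have := df e e0 => /nbhs_ballP[d /= d0 dP]; exists d => // h hd.
have := dP h; rewrite /ball /= sub0r normrN => /(_ hd).
by rewrite -![(_ + _ : _ -> _) _]/(_ + _) -![(- _ : _ -> _) _]/(- _) opprD addrA.
Qed.

Section Wirtinger.
Variable R : realType.
Local Notation C := R[i].
Local Notation nc := (@Normc.normc R).
Implicit Types (F G : R -> R -> C) (p q x y : R).

(** [l] and [m] are the Wirtinger derivatives of [F] with respect to [w] and
    to the conjugate of [w] at the point [w = p + iq]. *)
Definition wirtinger F p q (l m : C) :=
  forall e, 0 < e -> exists2 d, 0 < d & forall x y, `|x - p| < d -> `|y - q| < d ->
    nc (F x y - F p q - (l * ((x - p) +i* (y - q))%C + m * ((x - p) -i* (y - q))%C))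
      <= e * (`|x - p| + `|y - q|).

Definition wdiff F := forall p q, exists l m, wirtinger F p q l m.

Let inc_le (a b : R) : nc (a +i* b)%C <= `|a| + `|b|. Proof. exact: normc_le. Qed.
Let incN_le (a b : R) : nc (a -i* b)%C <= `|a| + `|b|.
Proof. by have := normc_le (a -i* b)%C; rewrite /= normrN. Qed.

Lemma wirtinger_cont F p q l m : wirtinger F p q l m ->
  forall e, 0 < e -> exists2 d, 0 < d & forall x y, `|x - p| < d -> `|y - q| < d ->
    nc (F x y - F p q) <= e.
Proof.
move=> /(_ 1 ltr01)[d d0 dP] e e0.
pose K := 1 + nc l + nc m.
have K0 : 0 < K by rewrite ltr_wpDr ?normc_ge0// ltr_wpDr ?normc_ge0.
exists (Num.min d (e / (2 * K))); first by rewrite lt_min d0 divr_gt0// mulr_gt0.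
move=> x y; rewrite !lt_min => /andP[xd xe] /andP[yd ye].
rewrite -[F x y - F p q](addrNK (l * ((x - p) +i* (y - q))%C + m * ((x - p) -i* (y - q))%C)).
apply: (le_trans (normcDl _ _)); apply: (le_trans (lerD (dP _ _ xd yd) (normcDl _ _))).
rewrite !Normc.normcM; set N := `|x - p| + `|y - q|.
have h1 : nc l * nc ((x - p) +i* (y - q))%C <= nc l * N.
  by rewrite ler_wpM2l ?normc_ge0.
have h2 : nc m * nc ((x - p) -i* (y - q))%C <= nc m * N.
  by rewrite ler_wpM2l ?normc_ge0.
apply: (le_trans (lerD (lexx _) (lerD h1 h2))).
rewrite -!mulrDl addrA -/K.
have : N <= e / K.
  have -> : e / K = e / (2 * K) + e / (2 * K) by field; rewrite gt_eqF.
  by rewrite lerD// ltW.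
by rewrite ler_pdivlMr// mulrC.
Qed.

Lemma wirtinger_cst c p q : wirtinger (fun _ _ => c) p q 0 0.
Proof.
move=> e e0; exists 1 => // x y _ _.
by rewrite subrr !mul0r addr0 subr0 Normc.normc0 mulr_ge0 ?addr_ge0// ltW.
Qed.

Lemma wirtinger_var p q : wirtinger (fun x y => (x +i* y)%C) p q 1 0.
Proof.
move=> e e0; exists 1 => // x y _ _.
rewrite mul0r mul1r addr0 (_ : _ - _ = 0).
  by rewrite Normc.normc0 mulr_ge0 ?addr_ge0// ltW.
by apply/eqP; rewrite eq_complex /= !subrr eqxx.
Qed.

Lemma wirtingerD F G p q l m l' m' : wirtinger F p q l m -> wirtinger G p q l' m' ->
  wirtinger (fun x y => F x y + G x y) p q (l + l') (m + m').
Proof.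
move=> hF hG e e0; have e2 : 0 < e / 2 by rewrite divr_gt0.
have [d d0 dP] := hF _ e2; have [d' d'0 d'P] := hG _ e2.
exists (Num.min d d'); first by rewrite lt_min d0.
move=> x y; rewrite !lt_min => /andP[xd xd'] /andP[yd yd'].
set h := (_ +i* _)%C; set h' := (_ -i* _)%C.
have -> : F x y + G x y - (F p q + G p q) - ((l + l') * h + (m + m') * h') =
  (F x y - F p q - (l * h + m * h')) + (G x y - G p q - (l' * h + m' * h')) by ring.
apply: (le_trans (normcDl _ _)); apply: (le_trans (lerD (dP _ _ xd yd) (d'P _ _ xd' yd'))).
by rewrite -mulrDl -splitr.
Qed.

Lemma wirtingerM F G p q l m l' m' : wirtinger F p q l m -> wirtinger G p q l' m' ->
  wirtinger (fun x y => F x y * G x y) p q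
    (l * G p q + F p q * l') (m * G p q + F p q * m').
Proof.
move=> hF hG e e0.
pose K := nc (G p q) + 1 + nc (F p q) + (nc l + nc m).
have K0 : 0 < K by have := normc_ge0 (G p q); have := normc_ge0 (F p q); have := normc_ge0 l; have := normc_ge0 m; rewrite /K; lra.
pose e' := Num.min 1 (e / K).
have e'0 : 0 < e' by rewrite lt_min ltr01 divr_gt0.
have [d1 d10 d1P] := hF _ e'0; have [d2 d20 d2P] := hG _ e'0.
have [d3 d30 d3P] := wirtinger_cont hG e'0.
exists (Num.min d1 (Num.min d2 d3)); first by rewrite !lt_min d10 d20.
move=> x y; rewrite !lt_min => /and3P[x1 x2 x3] /and3P[y1 y2 y3].
have := d3P _ _ x3 y3; have := d2P _ _ x2 y2; have := d1P _ _ x1 y1.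
have := incN_le (x - p) (y - q); have := inc_le (x - p) (y - q).
set h := (_ +i* _)%C; set h' := (_ -i* _)%C; set N := `|x - p| + `|y - q| => hN h'N.
set rF := F x y - _ - _; set rG := G x y - _ - _; set dG := G x y - _ => r1 r2 r3.
have N0 : 0 <= N by rewrite addr_ge0.
have -> : F x y * G x y - F p q * G p q -
    ((l * G p q + F p q * l') * h + (m * G p q + F p q * m') * h') =
    rF * G x y + F p q * rG + (l * h + m * h') * dG.
  by rewrite /rF /rG /dG; ring.
have nG : nc (G x y) <= nc (G p q) + 1.
  rewrite -[G x y](addrNK (G p q)) addrC (le_trans (normcDl _ _))// lerD2l.
  by rewrite (le_trans r3)// ge_min lexx.
have nL : nc (l * h + m * h') <= (nc l + nc m) * N.
  rewrite (le_trans (normcDl _ _))// !Normc.normcM mulrDl.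
  by apply: lerD; apply: ler_wpM2l => //; exact: normc_ge0.
have B1 : nc (rF * G x y) <= e' * N * (nc (G p q) + 1).
  by rewrite Normc.normcM ler_pM ?normc_ge0//.
have B2 : nc (F p q * rG) <= nc (F p q) * (e' * N).
  by rewrite Normc.normcM ler_pM ?normc_ge0//.
have B3 : nc ((l * h + m * h') * dG) <= (nc l + nc m) * N * e'.
  by rewrite Normc.normcM; apply: ler_pM; [exact: normc_ge0|exact: normc_ge0|exact: nL|exact: r3].
apply: (le_trans (normcDl _ _)); apply: (le_trans (lerD (normcDl _ _) (lexx _))).
apply: (le_trans (lerD (lerD B1 B2) B3)).
have -> : e' * N * (nc (G p q) + 1) + nc (F p q) * (e' * N) + (nc l + nc m) * N * e'
   = e' * K * N by rewrite /K; ring.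
by rewrite ler_wpM2r// -ler_pdivlMr// ge_min lexx orbT.
Qed.

Lemma wirtinger_conj F p q l m : wirtinger F p q l m ->
  wirtinger (fun x y => (F x y)^*%C) p q (m^*)%C (l^*)%C.
Proof.
move=> hF e e0; have [d d0 dP] := hF e e0; exists d => // x y xd yd.
rewrite (le_trans _ (dP _ _ xd yd))// -[leRHS]normc_conj le_eqVlt; apply/orP; left.
apply/eqP; congr Normc.normc; rewrite !rmorphB rmorphD !rmorphM /= opprK.
by rewrite [X in _ = _ - X]addrC.
Qed.

Lemma wirtinger_eq F p q l m l' m' : wirtinger F p q l m -> l = l' -> m = m' ->
  wirtinger F p q l' m'.
Proof. by move=> ? <- <-. Qed.

Lemma wirtingerX F p q l m k : wirtinger F p q l m ->
  wirtinger (fun x y => F x y ^+ k) p q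
    (k%:R * F p q ^+ k.-1 * l) (k%:R * F p q ^+ k.-1 * m).
Proof.
move=> hF; elim: k => [|k IH].
  by rewrite !mul0r; exact: wirtinger_cst.
under eq_fun do under eq_fun do rewrite exprS.
apply: wirtinger_eq (wirtingerM hF IH) _ _; case: k {IH} => [|k] /=;
  rewrite ?expr0 ?exprS -?natr1; ring.
Qed.

Let derive_approx (r : R -> R) (p r' : R) : is_derive p 1 r r' ->
  forall e, 0 < e -> exists2 d, 0 < d & forall x, `|x - p| < d ->
    `|r x - r p - r' * (x - p)| <= e * `|x - p|.
Proof.
move=> [dr <-] e e0; have [d d0 dP] := derivable_approx dr e0.
by exists d => // x /dP; rewrite [_ *: 1]mulr1 subrK mulrC.
Qed.

Lemma wirtinger_re (r : R -> R) p q r' : is_derive p 1 r r' ->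
  wirtinger (fun x _ => (r x)%:C%C) p q (r' / 2)%:C%C (r' / 2)%:C%C.
Proof.
move=> hr e e0; have [d d0 dP] := derive_approx hr e0; exists d => // x y /dP xd _.
rewrite (_ : _ - _ - _ = (r x - r p - r' * (x - p))%:C%C); last first.
  by apply/eqP; rewrite eq_complex /=; apply/andP; split; apply/eqP; field.
by rewrite normc_real (le_trans xd)// ler_pM2l// lerDl.
Qed.

Lemma wirtinger_im (r : R -> R) p q r' : is_derive q 1 r r' ->
  wirtinger (fun _ y => (r y)%:C%C) p q (0 -i* (r' / 2))%C (0 +i* (r' / 2))%C.
Proof.
move=> hr e e0; have [d d0 dP] := derive_approx hr e0; exists d => // x y _ /dP yd.
rewrite (_ : _ - _ - _ = (r y - r q - r' * (y - q))%:C%C); last first.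
  by apply/eqP; rewrite eq_complex /=; apply/andP; split; apply/eqP; field.
by rewrite normc_real (le_trans yd)// ler_pM2l// lerDr.
Qed.

(** The divergence of the field (Re F, Im F) is twice the real part of the
    derivative of F with respect to w. *)
Lemma wirtinger_has_gradient F p q l m : wirtinger F p q l m ->
  has_gradient (fun x y => complex.Re (F x y)) p q
    (complex.Re (l + m)) (complex.Im (m - l)) /\
  has_gradient (fun x y => complex.Im (F x y)) p q
    (complex.Im (l + m)) (complex.Re (l - m)).
Proof.
move=> hF; split => e e0; have [d d0 dP] := hF e e0; exists d => // x y xd yd;
  apply: le_trans (dP _ _ xd yd).
- apply: le_trans (Re_le_normc _); rewrite le_eqVlt; apply/orP; left; apply/eqP; congr Num.norm.
  by case: (F x y) => ? ?; case: (F p q) => ? ?; case: l {hF dP} => ? ?; case: m => ? ? /=; ring.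
- apply: le_trans (Im_le_normc _); rewrite le_eqVlt; apply/orP; left; apply/eqP; congr Num.norm.
  by case: (F x y) => ? ?; case: (F p q) => ? ?; case: l {hF dP} => ? ?; case: m => ? ? /=; ring.
Qed.

End Wirtinger.

(** * The vanishing integral in one complex variable *)

Section PlanarStokes.
Variable R : realType.
Local Notation C := R[i].
Local Notation nc := (@Normc.normc R).
Local Notation RR := (measurableTypeR R).
Local Notation plane := (@plane_lebesgue R : {measure set (RR * RR) -> \bar R}).

Lemma wdiff_cst (c : C) : wdiff (fun _ _ => c).
Proof. by move=> p q; exists 0, 0; exact: wirtinger_cst. Qed.

Lemma wdiffM (F G : R -> R -> C) : wdiff F -> wdiff G -> wdiff (fun x y => F x y * G x y).
Proof.
by move=> hF hG p q; have [l [m h1]] := hF p q; have [l' [m' h2]] := hG p q;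
  do 2 eexists; exact: (wirtingerM h1 h2).
Qed.

Lemma wdiffD (F G : R -> R -> C) : wdiff F -> wdiff G -> wdiff (fun x y => F x y + G x y).
Proof.
by move=> hF hG p q; have [l [m h1]] := hF p q; have [l' [m' h2]] := hG p q;
  do 2 eexists; exact: (wirtingerD h1 h2).
Qed.

Definition holomorphic (h : C -> C) := forall w, exists l, forall e, 0 < e ->
  exists2 d, 0 < d & forall w', nc (w' - w) < d ->
    nc (h w' - h w - l * (w' - w)) <= e * nc (w' - w).

Lemma holomorphic_wirtinger h : holomorphic h -> forall p q, exists l,
  wirtinger (fun x y => h (x +i* y)%C) p q l 0.
Proof.
move=> hh p q; have [l lP] := hh (p +i* q)%C; exists l => e e0.
have [d d0 dP] := lP e e0.
exists (d / 2); first by rewrite divr_gt0.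
move=> x y xd yd; rewrite mul0r addr0.
have wE : (x +i* y)%C - (p +i* q)%C = ((x - p) +i* (y - q))%C by simpc.
have wN : nc ((x - p) +i* (y - q))%C <= `|x - p| + `|y - q| by exact: normc_le.
have := dP (x +i* y)%C; rewrite wE => /(_ _)/le_trans; apply.
  by rewrite (le_lt_trans wN)// [d]splitr ltrD.
by rewrite ler_pM2l.
Qed.

Variables (h : C -> C) (b c : nat).
Hypothesis holh : holomorphic h.

Let E (x : R) : R := expR (- x ^+ 2).
Let W (x y : R) : C := (x +i* y)%C.
Let Wc (x y : R) : C := (x -i* y)%C.
Let H (x y : R) : C := (h (x +i* y)%C)^*%C.

(** The function w^b conj(w)^c exp(-|w|^2) conj(h(w)) of w = x + iy. *)
Definition slice_field (x y : R) : C :=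
  (E x)%:C%C * (E y)%:C%C * (W x y ^+ b * Wc x y ^+ c) * H x y.

(** The derivative of [slice_field] with respect to w; the factor conj(h) is
    antiholomorphic and behaves like a constant. *)
Definition slice_dfield (x y : R) : C :=
  (E x)%:C%C * (E y)%:C%C *
  (b%:R * W x y ^+ b.-1 * Wc x y ^+ c - W x y ^+ b * Wc x y ^+ c.+1) * H x y.

Local Notation U := slice_field.
Local Notation G := slice_dfield.

(* With [k = N ^- 2] this factor vanishes at [N] and [- N]. *)
Let cut (k x : R) : R := 1 - k * x ^+ 2.

Let is_derive_E (p : R) : is_derive p 1 E (- 2 * p * E p).
Proof.
rewrite /E; apply: is_derive_eq.
rewrite /GRing.scale /=; ring.
Qed.

Let is_derive_cut (k p : R) : is_derive p 1 (cut k) (- 2 * k * p).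
Proof. by rewrite /cut; apply: is_derive_eq; rewrite /GRing.scale /=; ring. Qed.

Let is_derive_dcut (k p : R) : is_derive p 1 (fun x => - 2 * k * x) (- 2 * k).
Proof. by apply: is_derive_eq; rewrite /GRing.scale /=; ring. Qed.

Let is_derive_cutE (k p : R) : is_derive p 1 (fun x => cut k x * E x)
  (- 2 * k * p * E p + cut k p * (- 2 * p * E p)).
Proof.
have h1 := is_derive_cut k p; have h2 := is_derive_E p.
apply: is_derive_eq; rewrite /GRing.scale /=; ring.
Qed.

Let wH p q : exists m, wirtinger H p q 0 m.
Proof.
have [l hl] := holomorphic_wirtinger holh p q.
exists (l^*)%C; have := wirtinger_conj hl.
by move/wirtinger_eq; apply => //; rewrite rmorph0.
Qed.

Let wWc p q : wirtinger Wc p q 0 1.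
Proof.
have := wirtinger_conj (wirtinger_var p q).
by move/wirtinger_eq; apply; rewrite ?rmorph0 ?rmorph1.
Qed.

Let wdH : wdiff H. Proof. by move=> p q; have [m ?] := wH p q; exists 0, m. Qed.
Let wdX k : wdiff (fun x y => W x y ^+ k).
Proof. by move=> p q; do 2 eexists; apply: wirtingerX; exact: wirtinger_var. Qed.
Let wdXc k : wdiff (fun x y => Wc x y ^+ k).
Proof. by move=> p q; do 2 eexists; apply: wirtingerX; exact: wWc. Qed.
Let wdre (r r' : R -> R) : (forall p : R, is_derive p 1 r (r' p)) -> wdiff (fun x _ => (r x)%:C%C).
Proof. by move=> hr p q; do 2 eexists; exact: (wirtinger_re _ (hr p)). Qed.
Let wdim (r r' : R -> R) : (forall p : R, is_derive p 1 r (r' p)) -> wdiff (fun _ y => (r y)%:C%C).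
Proof. by move=> hr p q; do 2 eexists; exact: (wirtinger_im _ (hr q)). Qed.

Let wdU : wdiff U.
Proof.
apply: wdiffM => //; apply: wdiffM; last exact: wdiffM.
by apply: wdiffM; [exact: (wdre is_derive_E)|exact: (wdim is_derive_E)].
Qed.

Let wdG : wdiff G.
Proof.
apply: wdiffM => //; apply: wdiffM.
  by apply: wdiffM; [exact: (wdre is_derive_E)|exact: (wdim is_derive_E)].
apply: wdiffD; first by apply: wdiffM => //; apply: wdiffM => //; exact: wdiff_cst.
have -> : (fun x y => - (W x y ^+ b * Wc x y ^+ c.+1)) =
          (fun x y => (-1) * (W x y ^+ b * Wc x y ^+ c.+1)).
  by apply/funext => x; apply/funext => y; rewrite mulN1r.
by apply: wdiffM; [exact: wdiff_cst|exact: wdiffM].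
Qed.

Let F k x y : C := (cut k x * E x)%:C%C * (cut k y * E y)%:C%C *
  (W x y ^+ b * Wc x y ^+ c) * H x y.

(* Twice the derivative of [F k] with respect to w, in terms of the fields that
   are integrable over the plane: the first summand comes from the derivatives
   of the cut-offs, the second one from those of the uncut field. *)
Let D k x y : C :=
  ((- 2 * k * x)%:C%C * (cut k y)%:C%C + (0 -i* 1)%C * ((cut k x)%:C%C * (- 2 * k * y)%:C%C)) * U x y
  + 2 * ((cut k x)%:C%C * (cut k y)%:C%C) * G x y.

Let wF k p q : exists l m, wirtinger (F k) p q l m /\ 2 * l = D k p q.
Proof.
have [m hm] := wH p q.
do 2 eexists; split.
  apply: wirtingerM hm; apply: wirtingerM.
    apply: wirtingerM; first exact: (wirtinger_re q (is_derive_cutE k p)).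
    exact: (wirtinger_im p (is_derive_cutE k q)).
  apply: wirtingerM; apply: wirtingerX; [exact: wirtinger_var|exact: wWc].
rewrite /D /slice_field /slice_dfield [Wc p q ^+ c.+1]exprS.
set A := W p q ^+ b; set A' := W p q ^+ b.-1; set B := Wc p q ^+ c.
have imE (r : R) : (0 -i* r)%C = - 'i%C * r%:C%C by apply/eqP; rewrite eq_complex /=; simpc.
have -> : Wc p q = p%:C%C - 'i%C * q%:C%C.
  by apply/eqP; rewrite eq_complex /=; simpc.
rewrite !imE /cut !(rmorphM, rmorphD, rmorphB, rmorphN, rmorphXn, rmorph1, rmorph0, fmorphV, rmorph_nat) /=.
by field.
Qed.

Let wdD k : wdiff (D k).
Proof.
have hc := wdre (is_derive_cut k); have hc' := wdim (is_derive_cut k).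
have hd := wdre (is_derive_dcut k); have hd' := wdim (is_derive_dcut k).
apply: wdiffD; apply: wdiffM => //.
  apply: wdiffD; first exact: wdiffM.
  by apply: wdiffM; [exact: wdiff_cst|exact: wdiffM].
by apply: wdiffM; [exact: wdiff_cst|exact: wdiffM].
Qed.

Hypothesis iU : plane.-integrable setT (EFin \o (fun t => complex.Re (U t.1 t.2))).
Hypothesis iU' : plane.-integrable setT (EFin \o (fun t => complex.Im (U t.1 t.2))).
Hypothesis iG : plane.-integrable setT (EFin \o (fun t => complex.Re (G t.1 t.2))).

Let DE k x y : complex.Re (D k x y) =
  (- 2 * k * x) * cut k y * complex.Re (U x y) + (cut k x * (- 2 * k * y)) * complex.Im (U x y)
  + 2 * (cut k x * cut k y) * complex.Re (G x y).
Proof. by rewrite /D; case: (U x y) => u v; case: (G x y) => u' v' /=; ring. Qed.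

Let cutN (n : nat) (x : R) : `|x| <= n.+1%:R ->
  `|cut (n.+1%:R ^- 2) x| <= 1 /\ `|- 2 * n.+1%:R ^- 2 * x| <= 2.
Proof.
move=> xn; have N0 : 0 < n.+1%:R :> R by rewrite ltr0n.
have N1 : 1 <= n.+1%:R :> R by rewrite ler1n.
set k := n.+1%:R ^- 2; have k0 : 0 < k by rewrite invr_gt0 exprn_gt0.
have kN : k * n.+1%:R ^+ 2 = 1 by rewrite mulVf// expf_neq0// gt_eqF.
have kx : 0 <= k * x ^+ 2 <= 1.
  rewrite mulr_ge0 ?sqr_ge0 ?(ltW k0)//= -[leRHS]kN ler_pM2l//.
  by rewrite -[x ^+ 2]real_normK ?num_real// lerXn2r// nnegrE ltW.
split; first by rewrite /cut ler_norml; lra.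
rewrite !normrM normrN [`|2|]ger0_norm// (gtr0_norm k0) -mulrA -[leRHS]mulr1 ler_pM2l//.
apply: (@le_trans _ _ (k * n.+1%:R)); first by rewrite ler_pM2l.
by rewrite -[leRHS]kN ler_pM2l// expr2 ler_peMl// ltW.
Qed.

Let measurable_ReD k : measurable_fun setT (fun t : RR * RR => complex.Re (D k t.1 t.2)).
Proof.
under eq_fun do rewrite DE.
have m1 : measurable_fun setT (fst : RR * RR -> RR) by exact: measurable_fst.
have m2 : measurable_fun setT (snd : RR * RR -> RR) by exact: measurable_snd.
have mU : measurable_fun setT (fun t : RR * RR => complex.Re (U t.1 t.2)).
  by apply/measurable_EFinP; exact: measurable_int iU.
have mU' : measurable_fun setT (fun t : RR * RR => complex.Im (U t.1 t.2)).
  by apply/measurable_EFinP; exact: measurable_int iU'.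
have mG : measurable_fun setT (fun t : RR * RR => complex.Re (G t.1 t.2)).
  by apply/measurable_EFinP; exact: measurable_int iG.
have mc (f : RR * RR -> RR) : measurable_fun setT f -> measurable_fun setT (fun t => cut k (f t)).
  move=> mf; apply: measurable_funB; first exact: measurable_cst.
  by apply: measurable_funM; [exact: measurable_cst|exact: measurable_funX].
have md (f : RR * RR -> RR) : measurable_fun setT f -> measurable_fun setT (fun t => - 2 * k * f t).
  by move=> mf; apply: measurable_funM; [exact: measurable_cst|].
apply: measurable_funD; [apply: measurable_funD|]; apply: measurable_funM => //;
  apply: measurable_funM => //; try exact: measurable_cst; try exact: mc; try exact: md.
by apply: measurable_funM; exact: mc.
Qed.

Let ReD_le k x y c1 c2 : `|cut k x| <= c1 -> `|cut k y| <= c1 ->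
  `|- 2 * k * x| <= c2 -> `|- 2 * k * y| <= c2 ->
  `|complex.Re (D k x y)| <= (c1 * c2) * `|complex.Re (U x y)| +
    (c1 * c2) * `|complex.Im (U x y)| + 2 * (c1 * c1) * `|complex.Re (G x y)|.
Proof.
move=> h1 h2 h3 h4; rewrite DE.
apply: (le_trans (ler_normD _ _)); apply: lerD.
  apply: (le_trans (ler_normD _ _)); apply: lerD; rewrite [leLHS]normrM ler_wpM2r//.
    by rewrite normrM mulrC ler_pM.
  by rewrite normrM ler_pM.
rewrite [leLHS]normrM ler_wpM2r// [leLHS]normrM [X in X * _]gtr0_norm//.
by rewrite ler_pM2l// normrM ler_pM.
Qed.

Let integrable_bound c1 c2 : plane.-integrable setT (EFin \o (fun t =>
   c1 * `|complex.Re (U t.1 t.2)| +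
    c1 * `|complex.Im (U t.1 t.2)| + c2 * `|complex.Re (G t.1 t.2)|)).
Proof.
by apply: integrable_add; [apply: integrable_add|]; apply: integrable_scale;
  exact: integrable_norm.
Qed.

Let integrable_square k x y s : 0 < k -> 0 < s ->
  plane.-integrable (square x y s) (EFin \o (fun t => complex.Re (D k t.1 t.2))).
Proof.
move=> k0 s0; pose B := `|x| + `|y| + s.
have mb : measurable (square x y s : set (RR * RR)) by exact: measurable_square.
have I0 := integrable_bound ((1 + k * B ^+ 2) * (2 * k * B)) (2 * ((1 + k * B ^+ 2) * (1 + k * B ^+ 2))).
have I1 := integrableS measurableT mb (@subsetT _ _) I0.
apply: le_integrable I1 => //.
  by apply/measurable_EFinP; apply: measurable_funTS; exact: measurable_ReD.
move=> [u v]; rewrite /square /= !in_itv /= => -[/andP[xu ux] /andP[yv vy]].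
have bd (w z : R) : z <= w -> w < z + s -> `|z| <= `|x| + `|y| -> `|w| <= B.
  move=> h1 h2 h3; rewrite /B ler_norml; have := ler_norm z; have := ler_norm (- z).
  by rewrite normrN; lra.
have uB : `|u| <= B by apply: bd xu ux _; rewrite lerDl.
have vB : `|v| <= B by apply: bd yv vy _; rewrite lerDr.
have B0 : 0 <= B by rewrite !addr_ge0// ltW.
have c1P w : `|w| <= B -> `|cut k w| <= 1 + k * B ^+ 2.
  move=> wB; rewrite /cut (le_trans (ler_normB _ _))// normr1 lerD2l.
  by rewrite normrM (gtr0_norm k0) ler_pM2l// normrX lerXn2r// nnegrE.
have c2P w : `|w| <= B -> `|- 2 * k * w| <= 2 * k * B.
  by move=> wB; rewrite 2!normrM normrN [`|2|]gtr0_norm// (gtr0_norm k0) ler_pM2l// mulr_gt0.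
rewrite lee_fin; apply: le_trans (ler_norm _).
by apply: ReD_le; [exact: c1P|exact: c1P|exact: c2P|exact: c2P].
Qed.

Let square_zero n : \int[plane]_(t in square (- n.+1%:R) (- n.+1%:R) (n.+1%:R + n.+1%:R))
   complex.Re (D (n.+1%:R ^- 2) t.1 t.2) = 0.
Proof.
set N := n.+1%:R; have N0 : 0 < N by rewrite ltr0n.
have k0 : 0 < N ^- 2 by rewrite invr_gt0 exprn_gt0.
have segment_int0 (f : R -> R) y s : (forall t, f t = 0) -> segment_int f y s = 0.
  by move=> f0; rewrite /segment_int; under eq_Rintegral do rewrite f0; rewrite Rintegral_cst// mul0r.
rewrite -(@divergence _ (fun x y => complex.Re (F (N ^- 2) x y))
  (fun x y => complex.Im (F (N ^- 2) x y)) (fun x y => complex.Re (D (N ^- 2) x y))).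
- have cutN0 : cut (N ^- 2) N = 0 by rewrite /cut mulVf ?subrr// expf_neq0// gt_eqF.
  have cutNN : cut (N ^- 2) (- N) = 0 by rewrite /cut sqrrN.
  by rewrite !addKr !segment_int0 ?subrr ?addr0// => t;
    rewrite /F ?cutN0 ?cutNN ?mul0r ?mulr0 ?mul0r.
- by rewrite addr_gt0.
- move=> p q; have [l [m [hF <-]]] := wF (N ^- 2) p q.
  have [h1 h2] := wirtinger_has_gradient hF.
  do 4 eexists; split; [exact: h1|exact: h2|].
  by case: l {hF h1 h2} => ? ?; case: m => ? ? /=; ring.
- move=> p q e e0; have [l [m hD]] := wdD (N ^- 2) p q.
  have [d d0 dP] := wirtinger_cont hD e0; exists d => // x y xd yd.
  apply: le_trans (dP _ _ xd yd).
  rewrite -[_ - _](_ : complex.Re (D (N ^- 2) x y - D (N ^- 2) p q) = _).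
    exact: Re_le_normc.
  by case: (D _ x y) => ? ?; case: (D _ p q).
- by move=> x y s s0; exact: integrable_square.
Qed.

(** On the square of half-side n + 1 the cut field has flux zero.  Its
    divergence is dominated, independently of n, by a multiple of the three
    functions assumed to be integrable, since each cut-off is at most 1 and its
    derivative at most 2 on the square. *)
Lemma slice_dfield_null : \int[plane]_t complex.Re (G t.1 t.2) = 0.
Proof.
pose f n t : R := if t \in square (- n.+1%:R) (- n.+1%:R) (n.+1%:R + n.+1%:R) then
  complex.Re (D (n.+1%:R ^- 2) t.1 t.2) else 0.
pose g (t : RR * RR) := 2 * `|complex.Re (U t.1 t.2)| +
    2 * `|complex.Im (U t.1 t.2)| + 2 * `|complex.Re (G t.1 t.2)|.
have mG2 : measurable_fun setT (fun t : RR * RR => 2 * complex.Re (G t.1 t.2)).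
  apply: measurable_funM; first exact: measurable_cst.
  by apply/measurable_EFinP; exact: measurable_int iG.
have f0 n : (\int[plane]_t (f n t)%:E = 0)%E.
  have mb : measurable (square (- n.+1%:R : R) (- n.+1%:R) (n.+1%:R + n.+1%:R) : set (RR * RR)).
    exact: measurable_square.
  have k0 : 0 < n.+1%:R ^- 2 :> R by rewrite invr_gt0 exprn_gt0// ltr0n.
  have N0 : 0 < n.+1%:R + n.+1%:R :> R by rewrite addr_gt0 ?ltr0n.
  have Ib := integrable_square (- n.+1%:R) (- n.+1%:R) k0 N0.
  transitivity (\int[plane]_(t in square (- n.+1%:R) (- n.+1%:R) (n.+1%:R + n.+1%:R))
    (complex.Re (D (n.+1%:R ^- 2) t.1 t.2))%:E)%E.
    rewrite [RHS]integral_mkcond; apply: eq_integral => t _.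
    by rewrite /f patchE; case: ifP.
  rewrite -[LHS]fineK; last exact: (integrable_fin_num _ Ib).
  by congr EFin; exact: square_zero.
have [|||||_ _ lim] := @dominated_convergence _ _ _ plane setT measurableT
  (fun n t => (f n t)%:E) (fun t => (2 * complex.Re (G t.1 t.2))%:E) (fun t => (g t)%:E).
- move=> n; apply/measurable_EFinP.
  have -> : f n = (fun t => complex.Re (D (n.+1%:R ^- 2) t.1 t.2)) \_
      (square (- n.+1%:R) (- n.+1%:R) (n.+1%:R + n.+1%:R)).
    by apply/funext => t; rewrite patchE.
  apply/(measurable_restrict _ _ _) => //; first exact: measurable_square.
  by apply: measurable_funS (measurable_ReD _) => //.
- exact/measurable_EFinP.
- apply: aeW => -[x y] _ /=; apply: cvg_EFin; first exact: nearW.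
  have k_cvg0 : (fun n : nat => n.+1%:R ^- 2) @ \oo --> (0 : R).
    rewrite (_ : (fun n => _) = (fun n => @harmonic R n * @harmonic R n)).
      by rewrite -[X in _ --> X](mulr0 0); apply: cvgM; exact: cvg_harmonic.
    by apply/funext => n; rewrite /harmonic /= -expr2 exprVn.
  have lim1 : (fun n : nat => complex.Re (D (n.+1%:R ^- 2) x y)) @ \oo -->
      2 * complex.Re (G x y).
    under eq_fun do rewrite DE.
    have -> : 2 * complex.Re (G x y) =
      (- 2 * 0 * x) * cut 0 y * complex.Re (U x y) +
      (cut 0 x * (- 2 * 0 * y)) * complex.Im (U x y) +
      2 * (cut 0 x * cut 0 y) * complex.Re (G x y) by rewrite /cut; ring.
    have cut_cvg (z : R) : (fun n : nat => cut (n.+1%:R ^- 2) z) @ \oo --> cut 0 z.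
      apply: cvgB; first exact: cvg_cst.
      by apply: cvgM; [exact: k_cvg0|exact: cvg_cst].
    have dcut_cvg (z : R) : (fun n : nat => - 2 * n.+1%:R ^- 2 * z) @ \oo --> (- 2 * 0 * z : R).
      apply: cvgM; last exact: cvg_cst.
      by apply: cvgM; [exact: cvg_cst|exact: k_cvg0].
    apply: cvgD; [apply: cvgD|]; (apply: cvgM; [|exact: cvg_cst]).
    - exact: cvgM.
    - exact: cvgM.
    - by apply: cvgM; [exact: cvg_cst|exact: cvgM].
  apply: cvg_trans lim1; apply: near_eq_cvg.
  exists (Num.bound (`|x| + `|y|)) => // n /= Bn.
  have B : `|x| + `|y| < n.+1%:R.
    rewrite (lt_le_trans (archi_boundP _)) ?addr_ge0//.
    by rewrite ler_nat (leq_trans Bn).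
  rewrite /f /= ifT// inE /square /= !in_itv /= addrA addNr add0r.
  have := ler_norm x; have := ler_norm (- x); have := ler_norm y; have := ler_norm (- y).
  have := normr_ge0 x; have := normr_ge0 y; rewrite !normrN => *.
  by split; lra.
- exact: integrable_bound.
- apply: aeW => -[x y] n _; rewrite lee_fin /f /g /=.
  case: ifPn => [|_]; last by rewrite normr0 !addr_ge0// mulr_ge0.
  rewrite inE /square /= !in_itv /= => -[/andP[x1 x2] /andP[y1 y2]].
  have [cx dx] : `|cut (n.+1%:R ^- 2) x| <= 1 /\ `|- 2 * n.+1%:R ^- 2 * x| <= 2.
    by apply: cutN; rewrite ler_norml; lra.
  have [cy dy] : `|cut (n.+1%:R ^- 2) y| <= 1 /\ `|- 2 * n.+1%:R ^- 2 * y| <= 2.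
    by apply: cutN; rewrite ler_norml; lra.
  by have := ReD_le cx cy dx dy; rewrite !mul1r mulr1.
move: lim; under eq_fun do rewrite f0.
move=> /(cvg_unique (@ereal_hausdorff R)) /(_ (cvg_cst _)) lim0.
rewrite /Rintegral.
have -> : (\int[plane]_t (complex.Re (G t.1 t.2))%:E =
    2^-1%:E * \int[plane]_t (2 * complex.Re (G t.1 t.2))%:E)%E.
  under [in RHS]eq_integral do rewrite EFinM.
  by rewrite integralZl// muleA -EFinM mulVf// mul1e.
by rewrite lim0 mule0.
Qed.

End PlanarStokes.

(** * Fubini's theorem on finite powers of a measure *)

Section ProductFunction.
Context d1 d2 (T1 : measurableType d1) (T2 : measurableType d2) (R : realType).
Variables (m1 : {sigma_finite_measure set T1 -> \bar R})
  (m2 : {sigma_finite_measure set T2 -> \bar R}).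

Lemma integrable_prod_fun (f : T1 -> R) (g : T2 -> R) :
  m1.-integrable setT (EFin \o f) -> m2.-integrable setT (EFin \o g) ->
  (m1 \x m2)%E.-integrable setT (EFin \o (fun t => f t.1 * g t.2)).
Proof.
move=> If Ig.
have mf : measurable_fun setT f by apply/measurable_EFinP; exact: measurable_int If.
have mg : measurable_fun setT g by apply/measurable_EFinP; exact: measurable_int Ig.
apply/integrable12ltyP.
  apply/measurable_EFinP; apply: measurable_funM.
    by apply: (measurableT_comp mf); exact: measurable_fst.
  by apply: (measurableT_comp mg); exact: measurable_snd.
under eq_integral => x _.
  under eq_integral do rewrite /= normrM EFinM.
  rewrite ge0_integralZl//; [over|..].
  - by apply/measurable_EFinP; exact: measurableT_comp.
rewrite ge0_integralZr//; last 2 first.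
- by apply/measurable_EFinP; exact: measurableT_comp.
- exact: integral_ge0.
move/integrableP : If => [_ If]; move/integrableP : Ig => [_ Ig].
by apply: lte_mul_pinfty => //; [exact: integral_ge0|rewrite ge0_fin_numE//; exact: integral_ge0].
Qed.

End ProductFunction.

Section PowerFubini.
Context d (T : measurableType d) (R : realType).
Variable mu : {sigma_finite_measure set T -> \bar R}.
Local Notation mp := (mu_pow mu).

Let tcons n : T * n.-tuple T -> n.+1.-tuple T := @tuple_cons _ T n.

Lemma ge0_integral_cons n (f : n.+1.-tuple T -> \bar R) : measurable_fun setT f ->
  (forall t, (0 <= f t)%E) ->
  (\int[mp n.+1]_t f t = \int[(mu \x mp n)%E]_p f (tcons p))%E.
Proof.
move=> mf f0; transitivity (\int[pushforward (mu \x mp n)%E (@tuple_cons _ T n)]_t f t)%E.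
  by apply: eq_measure_integral.
by rewrite ge0_integral_pushforward.
Qed.

Lemma integrable_cons n (f : n.+1.-tuple T -> \bar R) :
  (mp n.+1).-integrable setT f ->
  (mu \x mp n)%E.-integrable setT (fun p => f (tcons p)).
Proof.
move=> /integrableP[mf fy]; apply/integrableP; split.
  by apply: (measurableT_comp mf); exact: measurable_tuple_cons.
move: fy; rewrite ge0_integral_cons//.
exact: measurableT_comp.
Qed.

Lemma cons_integrable n (f : n.+1.-tuple T -> \bar R) : measurable_fun setT f ->
  (mu \x mp n)%E.-integrable setT (fun p => f (tcons p)) ->
  (mp n.+1).-integrable setT f.
Proof.
move=> mf /integrableP[_ fy]; apply/integrableP; split => //.
by rewrite ge0_integral_cons//; exact: measurableT_comp.
Qed.

Lemma integral_cons n (f : n.+1.-tuple T -> \bar R) :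
  (mp n.+1).-integrable setT f ->
  (\int[mp n.+1]_t f t = \int[(mu \x mp n)%E]_p f (tcons p))%E.
Proof.
move=> If; transitivity (\int[pushforward (mu \x mp n)%E (@tuple_cons _ T n)]_t f t)%E.
  by apply: eq_measure_integral.
rewrite integral_pushforward//; first exact: measurable_int If.
exact: integrable_cons.
Qed.

Definition set_coord n (t : n.-tuple T) (j : 'I_n) (x : T) : n.-tuple T :=
  [tuple if i == j then x else tnth t i | i < n].

Lemma set_coord_cons0 n x (t : n.-tuple T) y : set_coord (tcons (x, t)) ord0 y = tcons (y, t).
Proof.
apply: eq_from_tnth => i; rewrite tnth_mktuple.
by case: (unliftP ord0 i) => [k|] ->; rewrite ?tnthS.
Qed.

Lemma set_coord_cons_lift n x (t : n.-tuple T) (j : 'I_n) y :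
  set_coord (tcons (x, t)) (lift ord0 j) y = tcons (x, set_coord t j y).
Proof.
apply: eq_from_tnth => i; rewrite tnth_mktuple.
case: (unliftP ord0 i) => [k|] ->; last by rewrite eq_liftF.
by rewrite (inj_eq lift_inj) !tnthS tnth_mktuple.
Qed.

(** Fubini's theorem in an arbitrary coordinate [j].  The function of interest
    is [K 0]; the other members of the sequence are functions whose
    integrability along the slice may be used to prove that the integral of
    [K 0] along it is zero, because each of them is integrable on almost every
    slice. *)
Lemma integral_slice_null n (j : 'I_n) (K : nat -> n.-tuple T -> R) :
  (forall i, (mp n).-integrable setT (EFin \o K i)) ->
  (forall t, (forall i, mu.-integrable setT (fun x => (K i (set_coord t j x))%:E)) ->
     (\int[mu]_x (K 0%N (set_coord t j x))%:E = 0)%E) ->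
  (\int[mp n]_t (K 0%N t)%:E = 0)%E.
Proof.
elim: n j K => [|n IH] j K IK slice; first by have := ltn_ord j.
have IKc i := integrable_cons (IK i).
rewrite (integral_cons (IK 0%N)).
move: slice; have [k jE|jE] := unliftP ord0 j; rewrite jE => slice.
- rewrite -(integral12_prod_meas1 (IKc 0%N)).
  rewrite -[RHS](@integral0 _ _ _ mu setT); apply: ae_eq_integral => //.
    exact: (measurable_fubini_F (IKc 0%N)).
  have : {ae mu, forall x i, (mp n).-integrable setT (fun t => (K i (tcons (x, t)))%:E)}.
    by apply: ae_foralln => i; exact: (ae_integrable1 (IKc i)).
  apply: filterS => x Kx _; apply: (IH k (fun i t => K i (tcons (x, t)))) => // t Kt.
  have := slice (tcons (x, t)); under eq_integral do rewrite set_coord_cons_lift.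
  by apply => i; under eq_fun do rewrite set_coord_cons_lift.
- rewrite -(integral21_prod_meas1 (IKc 0%N)).
  rewrite -[RHS](@integral0 _ _ _ (mp n) setT); apply: ae_eq_integral => //.
    exact: (measurable_fubini_G (IKc 0%N)).
  have : {ae (mp n), forall t i, mu.-integrable setT (fun x => (K i (tcons (x, t)))%:E)}.
    by apply: ae_foralln => i; exact: (ae_integrable2 (IKc i)).
  apply: filterS => t Kt _; have := slice (tcons (point, t)).
  under eq_integral do rewrite set_coord_cons0.
  by apply => i; under eq_fun do rewrite set_coord_cons0.
Qed.

Lemma integrable_prod_tuple n (phi : 'I_n -> T -> R) :
  (forall i, mu.-integrable setT (EFin \o phi i)) ->
  (mp n).-integrable setT (EFin \o (fun t => \prod_i phi i (tnth t i))).
Proof.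
elim: n phi => [|n IH] phi Iphi.
  under eq_fun do rewrite /= big_ord0.
  apply/integrableP; split; first exact: measurable_cst.
  by rewrite integral_cst//= diracT mule1 ltry.
have mphi i : measurable_fun setT (phi i).
  by apply/measurable_EFinP; exact: measurable_int (Iphi i).
apply: cons_integrable.
  apply/measurable_EFinP; apply: measurable_prod => i _.
  by apply: (measurableT_comp (mphi i)); exact: measurable_tnth.
have := integrable_prod_fun (Iphi ord0) (IH (fun i => phi (lift ord0 i)) (fun i => Iphi _)).
apply: eq_integrable => // -[x t] _ /=; congr EFin.
by rewrite big_ord_recl; congr (_ * _); apply: eq_bigr => i _; rewrite tnthS.
Qed.

(** Used to show that nonnegative continuous functions with zero
    integral vanish. *)
Lemma mu_pow_prod_gt0 n (A : 'I_n -> set T) : (forall i, measurable (A i)) ->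
  (forall i, (0 < mu (A i))%E) ->
  measurable [set t : n.-tuple T | forall i, A i (tnth t i)] /\
  (0 < mp n [set t | forall i, A i (tnth t i)])%E.
Proof.
move=> mA A0.
have mbox k (B : 'I_k -> set T) : (forall i, measurable (B i)) ->
    measurable [set t : k.-tuple T | forall i, B i (tnth t i)].
  move=> mB; rewrite (_ : [set _ | _] = \big[setI/setT]_(i < k) ((@tnth k T) ^~ i @^-1` B i)).
    apply: bigsetI_measurable => i _; rewrite -[X in measurable X]setTI.
    exact: measurable_tnth.
  apply/seteqP; split => t; rewrite -bigcap_seq /=; first by move=> h i _; exact: h.
  by move=> h i; apply: (h i); rewrite /= mem_index_enum.
split; first exact: mbox.
elim: n A mA A0 => [|n IH] A mA A0.
  by rewrite /= diracE mem_set// => -[].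
rewrite [ltRHS](_ : _ = (mu \x mp n)%E
   (A ord0 `*` [set t | forall i, A (lift ord0 i) (tnth t i)])); last first.
  rewrite -[LHS]/(pushforward (mu \x mp n)%E (@tuple_cons _ T n) _) /pushforward.
  congr ((mu \x mp n)%E _); apply/seteqP; split => -[x t] /=.
    move=> h; split; first exact: (h ord0).
    by move=> i; have := h (lift ord0 i); rewrite tnthS.
  by move=> [h0 h] i; case: (unliftP ord0 i) => [k|] ->; rewrite ?tnthS.
set B := [set t : n.-tuple T | _].
have mB : measurable B by apply: (mbox _ (fun i => A (lift ord0 i))) => i; exact: mA.
have -> : (mu \x mp n)%E (A ord0 `*` B) = (mu (A ord0) * mp n B)%E.
  exact: product_measure1E.
apply: mule_gt0; first exact: A0.
by apply: (IH (fun i => A (lift ord0 i))) => i; [exact: mA|exact: A0].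
Qed.

End PowerFubini.

(** * Integration of complex functions on C^n *)

Section ComplexIntegral.
Variables (R : realType) (n : nat).
Local Notation C := R[i].
Local Notation nc := (@Normc.normc R).
Local Notation RR := (measurableTypeR R).
Local Notation Cn := 'rV[C]_n.
Local Notation dv := (@dv R n).
Local Notation toCn := (@toCn R n).
Implicit Types (F G : Cn -> C).

Lemma CmeasurableD F G : Cmeasurable F -> Cmeasurable G -> Cmeasurable (fun z => F z + G z).
Proof.
move=> [F1 F2] [G1 G2]; split; under eq_fun do rewrite raddfD; exact: measurable_funD.
Qed.

Lemma CmeasurableM F G : Cmeasurable F -> Cmeasurable G -> Cmeasurable (fun z => F z * G z).
Proof.
move=> [F1 F2] [G1 G2].
split; [under eq_fun do rewrite ReM|under eq_fun do rewrite ImM].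
  by apply: measurable_funB; exact: measurable_funM.
by apply: measurable_funD; exact: measurable_funM.
Qed.

Lemma Cmeasurable_conj F : Cmeasurable F -> Cmeasurable (fun z => (F z)^*%C).
Proof.
move=> [F1 F2].
split; [under eq_fun do rewrite ReJ|under eq_fun do rewrite ImJ] => //.
exact: measurable_funN.
Qed.

Lemma Cmeasurable_cst (c : C) : Cmeasurable (fun _ : Cn => c).
Proof. by split; exact: measurable_cst. Qed.

Lemma Cmeasurable_coord (s : 'I_n) : Cmeasurable (fun z : Cn => z 0 s).
Proof.
have m := @measurable_tnth _ (RR * RR)%type n s.
split; under eq_fun do rewrite mxE /=.
  exact: (measurableT_comp measurable_fst m).
exact: (measurableT_comp measurable_snd m).
Qed.

Lemma CmeasurableX F k : Cmeasurable F -> Cmeasurable (fun z => F z ^+ k).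
Proof.
move=> mF; elim: k => [|k IH]; first exact: Cmeasurable_cst.
by under eq_fun do rewrite exprS; exact: CmeasurableM.
Qed.

Lemma Cmeasurable_prod (I : Type) (r : seq I) (P : pred I) (F : I -> Cn -> C) :
  (forall i, Cmeasurable (F i)) -> Cmeasurable (fun z => \prod_(i <- r | P i) F i z).
Proof.
move=> mF; elim: r => [|i r IH].
  by under eq_fun do rewrite big_nil; exact: Cmeasurable_cst.
under eq_fun do rewrite big_cons; case: (P i) => //; exact: CmeasurableM.
Qed.

Lemma Cmeasurable_real (f : Cn -> R) :
  measurable_fun setT (fun t => f (toCn t) : RR) -> Cmeasurable (fun z => (f z)%:C%C).
Proof. by move=> mf; split => //=; exact: measurable_cst. Qed.

Lemma measurable_normc F : Cmeasurable F ->
  measurable_fun setT (fun t => nc (F (toCn t)) : RR).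
Proof.
move=> [F1 F2].
have E t : nc (F (toCn t)) =
   Num.sqrt (complex.Re (F (toCn t)) ^+ 2 + complex.Im (F (toCn t)) ^+ 2) by case: (F _).
under eq_fun do rewrite E.
apply: (measurableT_comp (continuous_measurable_fun (@sqrt_continuous R))).
by apply: measurable_funD; exact: measurable_funX.
Qed.

Definition Cintegrable F := Cmeasurable F /\
  dv.-integrable setT (EFin \o (fun t => nc (F (toCn t)))).

Lemma Cintegrable_le F (g : Cn -> R) : Cmeasurable F ->
  (forall z, nc (F z) <= g z) ->
  dv.-integrable setT (EFin \o (fun t => g (toCn t))) -> Cintegrable F.
Proof.
move=> mF Fg Ig; split => //; apply: le_integrable Ig => //.
  by apply/measurable_EFinP; exact: measurable_normc.
move=> t _ /=; rewrite lee_fin ger0_norm ?normc_ge0//.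
exact: le_trans (Fg _) (ler_norm _).
Qed.

Lemma Cintegrable_Re F : Cintegrable F ->
  dv.-integrable setT (EFin \o (fun t => complex.Re (F (toCn t)))).
Proof.
move=> [[mF _] IF]; apply: le_integrable IF => //; first exact/measurable_EFinP.
by move=> t _ /=; rewrite lee_fin [leRHS]ger0_norm ?normc_ge0// Re_le_normc.
Qed.

Lemma Cintegrable_Im F : Cintegrable F ->
  dv.-integrable setT (EFin \o (fun t => complex.Im (F (toCn t)))).
Proof.
move=> [[_ mF] IF]; apply: le_integrable IF => //; first exact/measurable_EFinP.
by move=> t _ /=; rewrite lee_fin [leRHS]ger0_norm ?normc_ge0// Im_le_normc.
Qed.

Lemma CintegrableD F G : Cintegrable F -> Cintegrable G -> Cintegrable (fun z => F z + G z).
Proof.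
move=> [mF IF] [mG IG]; apply: (@Cintegrable_le _ (fun z => nc (F z) + nc (G z))).
- exact: CmeasurableD.
- by move=> z; exact: normcDl.
- by have := integrableD measurableT IF IG; apply: eq_integrable.
Qed.

Lemma CintegrableZ c F : Cintegrable F -> Cintegrable (fun z => c * F z).
Proof.
move=> [mF IF]; apply: (@Cintegrable_le _ (fun z => nc c * nc (F z))).
- by apply: CmeasurableM => //; exact: Cmeasurable_cst.
- by move=> z; rewrite Normc.normcM.
- by have := integrableZl measurableT (nc c) IF; apply: eq_integrable.
Qed.

Lemma Cintegrable0 : Cintegrable (fun=> 0).
Proof.
split; first exact: Cmeasurable_cst.
have := @integrable0 _ _ _ dv setT; apply: eq_integrable => // t _.
by rewrite /comp Normc.normc0.
Qed.

Lemma Cintegrable_sum (I : Type) (r : seq I) (P : pred I) (F : I -> Cn -> C) :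
  (forall i, Cintegrable (F i)) -> Cintegrable (fun z => \sum_(i <- r | P i) F i z).
Proof.
move=> IF; elim: r => [|i r IH].
  by under eq_fun do rewrite big_nil; exact: Cintegrable0.
under eq_fun do rewrite big_cons; case: (P i) => //; exact: CintegrableD.
Qed.

Lemma eq_Cint F G : (forall z, F z = G z) -> Cint F = Cint G.
Proof. by move=> FG; rewrite (funext FG). Qed.

Lemma CintD F G : Cintegrable F -> Cintegrable G ->
  Cint (fun z => F z + G z) = Cint F + Cint G.
Proof.
move=> IF IG; rewrite /Cint; apply/eqP; rewrite eq_complex /=; apply/andP; split; apply/eqP.
  rewrite -RintegralD//; [|exact: Cintegrable_Re..].
  by apply: eq_Rintegral => t _; rewrite raddfD.
rewrite -RintegralD//; [|exact: Cintegrable_Im..].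
by apply: eq_Rintegral => t _; rewrite raddfD.
Qed.

Lemma CintZ c F : Cintegrable F -> Cint (fun z => c * F z) = c * Cint F.
Proof.
move=> IF; have IR := Cintegrable_Re IF; have II := Cintegrable_Im IF.
case: c => a b; rewrite /Cint; apply/eqP; rewrite eq_complex /=; apply/andP; split; apply/eqP.
  rewrite -(RintegralZl _ _ IR)// -(RintegralZl _ _ II)// -RintegralB//; [|exact: integrable_scale..].
  by apply: eq_Rintegral => t _; case: (F _).
rewrite -(RintegralZl _ _ IR)// -(RintegralZl _ _ II)// -RintegralD//; [|exact: integrable_scale..].
by apply: eq_Rintegral => t _; case: (F _).
Qed.

Lemma Cint_sum (I : Type) (r : seq I) (P : pred I) (F : I -> Cn -> C) :
  (forall i, Cintegrable (F i)) ->
  Cint (fun z => \sum_(i <- r | P i) F i z) = \sum_(i <- r | P i) Cint (F i).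
Proof.
move=> IF; elim: r => [|i r IH].
  rewrite big_nil; under eq_fun do rewrite big_nil.
  rewrite /Cint; apply/eqP; rewrite eq_complex /=.
  by rewrite !Rintegral_cst// !mul0r eqxx.
rewrite big_cons; under eq_fun do rewrite big_cons.
case: (P i) => //; rewrite CintD ?IH//; exact: Cintegrable_sum.
Qed.

Lemma Re_Cint_le F : Cintegrable F ->
  `|complex.Re (Cint F)| <= \int[dv]_t nc (F (toCn t)).
Proof.
move=> IF; apply: (le_trans (le_normr_Rintegral _ (Cintegrable_Re IF))) => //.
apply: le_Rintegral => //; [exact: (integrable_norm (Cintegrable_Re IF))|by case: IF|].
by move=> t _; exact: Re_le_normc.
Qed.

Lemma Im_Cint_le F : Cintegrable F ->
  `|complex.Im (Cint F)| <= \int[dv]_t nc (F (toCn t)).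
Proof.
move=> IF; apply: (le_trans (le_normr_Rintegral _ (Cintegrable_Im IF))) => //.
apply: le_Rintegral => //; [exact: (integrable_norm (Cintegrable_Im IF))|by case: IF|].
by move=> t _; exact: Im_le_normc.
Qed.

Lemma Cint_conj F : Cintegrable F -> Cint (fun z => (F z)^*%C) = (Cint F)^*%C.
Proof.
move=> IF; rewrite /Cint; apply/eqP; rewrite eq_complex /=; apply/andP; split; apply/eqP.
  by apply: eq_Rintegral => t _; case: (F _).
rewrite -mulN1r -RintegralZl//; last exact: Cintegrable_Im.
by apply: eq_Rintegral => t _; rewrite mulN1r; case: (F _).
Qed.

End ComplexIntegral.

(** * Monomials and the Gaussian weight *)

Section GaussianMoments.
Variables (R : realType) (n : nat).
Local Notation C := R[i].
Local Notation nc := (@Normc.normc R).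
Local Notation RR := (measurableTypeR R).
Local Notation plane := (@plane_lebesgue R : {measure set (RR * RR) -> \bar R}).
Local Notation Cn := 'rV[C]_n.
Local Notation dv := (@dv R n).
Local Notation toCn := (@toCn R n).
Implicit Types (b c : 'I_n -> nat) (z : Cn) (e : Cn -> C).

Definition mono b c z : C := \prod_s (z 0 s ^+ b s * ((z 0 s)^*)%C ^+ c s).

Definition gauss z : R := expR (- cnorm z ^+ 2).

Lemma cnorm_sqr z : cnorm z ^+ 2 = \sum_s nc (z 0 s) ^+ 2.
Proof. by rewrite sqr_sqrtr// sumr_ge0// => s _; rewrite sqr_ge0. Qed.

Lemma gaussE z : gauss z = \prod_s expR (- nc (z 0 s) ^+ 2).
Proof. by rewrite /gauss cnorm_sqr -sumrN expR_sum. Qed.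

Lemma normc_mono b c z : nc (mono b c z) = \prod_s nc (z 0 s) ^+ (b s + c s).
Proof.
rewrite /mono; elim/big_rec2: _ => [|s x y _ <-]; first exact: Normc.normc1.
by rewrite !Normc.normcM !normcX normc_conj exprD.
Qed.

Lemma Cmeasurable_mono b c : Cmeasurable (mono b c).
Proof.
apply: Cmeasurable_prod => s; apply: CmeasurableM; apply: CmeasurableX.
  exact: Cmeasurable_coord.
by apply: Cmeasurable_conj; exact: Cmeasurable_coord.
Qed.

Lemma measurable_cnorm_sqr : measurable_fun setT (fun t => cnorm (toCn t) ^+ 2 : RR).
Proof.
under eq_fun do rewrite cnorm_sqr.
apply: measurable_sum => s; apply: measurable_funX.
exact: (measurable_normc (@Cmeasurable_coord R n s)).
Qed.

Lemma measurable_gauss : measurable_fun setT (fun t => gauss (toCn t) : RR).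
Proof.
apply: (measurableT_comp (@measurable_expR R)).
by apply: measurable_funN; exact: measurable_cnorm_sqr.
Qed.

Lemma measurable_cnorm_even m : measurable_fun setT (fun t => cnorm (toCn t) ^+ (2 * m) : RR).
Proof. by under eq_fun do rewrite exprM; apply: measurable_funX; exact: measurable_cnorm_sqr. Qed.

Lemma integrable_half_gauss : (@lebesgue_measure R).-integrable setT
  (EFin \o (fun x : R => expR (- (x ^+ 2 / 2)))).
Proof.
have := integrableZl measurableT (normal_peak 1)^-1 (integrable_normal_pdf 0 (1 : R)).
apply: eq_integrable => // x _ /=.
rewrite normal_pdfE ?oner_eq0// -EFinM mulKf ?gt_eqF ?normal_peak_gt0 ?oner_eq0//.
by rewrite /normal_fun subr0 expr1n mulNr.
Qed.

(** Half of the exponent absorbs the power: r^(2k+2) is at most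
    2^(k+1) (k+1)! exp(r^2/2). *)
Lemma integrable_plane_power k : plane.-integrable setT
  (EFin \o (fun p : RR * RR => nc (p.1 +i* p.2)%C ^+ k * expR (- nc (p.1 +i* p.2)%C ^+ 2))).
Proof.
pose K : R := 1 + 2 ^+ k.+1 * (k.+1)`!%:R.
have I0 := integrable_prod_fun integrable_half_gauss integrable_half_gauss.
have I1 := integrableZl measurableT K I0.
have {I0}I1 : plane.-integrable setT (EFin \o (fun p : RR * RR =>
    K * (expR (- (p.1 ^+ 2 / 2)) * expR (- (p.2 ^+ 2 / 2))))) by exact: I1.
apply: le_integrable I1 => //.
  have mn : measurable_fun setT (fun p : RR * RR => nc (p.1 +i* p.2)%C : RR).
    apply: (measurableT_comp (continuous_measurable_fun (@sqrt_continuous R))).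
    by apply: measurable_funD; apply: measurable_funX; [exact: measurable_fst|exact: measurable_snd].
  apply/measurable_EFinP; apply: measurable_funM; first exact: measurable_funX.
  apply: (measurableT_comp (@measurable_expR R)); apply: measurable_funN; exact: measurable_funX.
move=> [x y] _ /=; rewrite -[Num.sqrt _]/(nc (x +i* y)%C) lee_fin; set r := nc _.
have r0 : 0 <= r by exact: normc_ge0.
have r2 : r ^+ 2 = x ^+ 2 + y ^+ 2 by rewrite sqr_normcE.
rewrite ger0_norm ?mulr_ge0 ?exprn_ge0 ?expR_ge0//.
apply: le_trans (ler_norm _); rewrite -expRD -opprD -mulrDl -r2.
have -> : expR (- r ^+ 2) = expR (- (r ^+ 2 / 2)) * expR (- (r ^+ 2 / 2)).
  by rewrite -expRD -opprD -splitr.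
rewrite mulrA ler_wpM2r ?expR_ge0// expRN ler_pdivrMr ?expR_gt0//.
have s0 : 0 <= r ^+ 2 / 2 by rewrite divr_ge0// sqr_ge0.
(* Only even powers of r are polynomials in r ^+ 2 / 2. *)
have rk : r ^+ k <= 1 + (r ^+ 2) ^+ k.+1.
  have [r1|/ltW r1] := leP r 1.
    by rewrite (le_trans (exprn_ile1 k r0 r1))// lerDl exprn_ge0// sqr_ge0.
  by rewrite -exprM -[leLHS]add0r lerD// ler_weXn2l// mulnS mul2n -addnn addnA leq_addl.
have ek := expR_ge1Dxn k s0.
have fk : 0 < (k.+1)`!%:R :> R by rewrite ltr0n fact_gt0.
have e1 : 1 <= expR (r ^+ 2 / 2) by rewrite (le_trans _ ek)// lerDl divr_ge0 ?exprn_ge0// ltW.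
apply: (le_trans rk); rewrite /K mulrDl mul1r lerD//.
have ek' : (r ^+ 2 / 2) ^+ k.+1 / (k.+1)`!%:R <= expR (r ^+ 2 / 2).
  by rewrite (le_trans _ ek)// lerDr.
rewrite ler_pdivrMr// expr_div_n ler_pdivrMr ?exprn_gt0// in ek'.
by rewrite (le_trans ek')// le_eqVlt; apply/orP; left; apply/eqP; ring.
Qed.

Lemma integrable_normc_mono b c : dv.-integrable setT
  (EFin \o (fun t => nc (mono b c (toCn t)) * gauss (toCn t))).
Proof.
have := @integrable_prod_tuple _ _ _ (@plane_lebesgue R) n
  (fun s p => nc (p.1 +i* p.2)%C ^+ (b s + c s) * expR (- nc (p.1 +i* p.2)%C ^+ 2))
  (fun s => integrable_plane_power _).
apply: eq_integrable => // t _; congr EFin.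
rewrite normc_mono gaussE -big_split /=; apply: eq_bigr => s _.
by rewrite !mxE.
Qed.

Definition incr_at b (j s : 'I_n) : nat := (b s + (s == j))%N.
Definition decr_at b (j s : 'I_n) : nat := (b s - (s == j))%N.

Lemma mono_incr_at b c j z :
  mono (incr_at b j) (incr_at c j) z = (nc (z 0 j) ^+ 2)%:C%C * mono b c z.
Proof.
rewrite /mono (bigD1 j)//= [in RHS](bigD1 j)//= mulrA; congr (_ * _).
  rewrite /incr_at eqxx !exprD !expr1 sqr_normcJ; ring.
by apply: eq_bigr => s /negbTE sj; rewrite /incr_at sj !addn0.
Qed.

Lemma cnorm_mono b c z : (cnorm z ^+ 2)%:C%C * mono b c z =
  \sum_j mono (incr_at b j) (incr_at c j) z.
Proof.
rewrite cnorm_sqr rmorph_sum mulr_suml; apply: eq_bigr => j _.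
by rewrite mono_incr_at.
Qed.

(** The integrand of the inner product of z^b conj(z)^c with [e], without the
    constant [omega]. *)
Definition pairing m b c e z : C :=
  (cnorm z ^+ (2 * m) * gauss z)%:C%C * mono b c z * (e z)^*%C.

(** One factor |z|^2 of the weight is spread over the coordinates, which
    reduces all weights to the pure Gaussian one. *)
Lemma pairingS m b c e z :
  pairing m.+1 b c e z = \sum_j pairing m (incr_at b j) (incr_at c j) e z.
Proof.
rewrite /pairing -mulr_suml -mulr_sumr -cnorm_mono mulrA -rmorphM mulnS exprD.
by congr (_%:C%C * _ * _); ring.
Qed.

Lemma Cintegrable_pairing_rec m b c e : (forall b c, Cintegrable (pairing 0 b c e)) ->
  Cintegrable (pairing m b c e).
Proof.
move=> I0; elim: m b c => [//|m IH] b c.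
by rewrite (funext (pairingS m b c e)); exact: Cintegrable_sum.
Qed.

End GaussianMoments.

(** * Entire functions and the integral identity in C^n *)

Lemma entire_partial (K : numFieldType) n (f : 'rV[K]_n -> K) : entire f ->
  forall z j, exists l, forall r, 0 < r -> exists2 d, 0 < d &
    forall h : K, `|h| < d -> `|f (h *: delta_mx 0 j + z) - f z - h * l| <= r * `|h|.
Proof.
move=> ent z j; have dz := diff_derivable (v := delta_mx 0 j) (ent z).
by exists ('D_(delta_mx 0 j) f z) => r r0; exact: (derivable_approx dz r0).
Qed.

Section Entire.
Variables (K : numFieldType) (n : nat).
Implicit Types (f g : 'rV[K]_n -> K).

Lemma entireD f g : entire f -> entire g -> entire (fun z => f z + g z).
Proof. by move=> hf hg z; exact: differentiableD. Qed.

Lemma entireM f g : entire f -> entire g -> entire (fun z => f z * g z).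
Proof. by move=> hf hg z; exact: differentiableM. Qed.

Lemma entire_const (k : K) : entire (fun _ : 'rV[K]_n => k).
Proof. by move=> z; exact: differentiable_cst. Qed.

Lemma entire_coord s : entire (fun z : 'rV[K]_n => z 0 s).
Proof. by move=> z; exact: differentiable_coord. Qed.

Lemma entireX f k : entire f -> entire (fun z => f z ^+ k).
Proof.
move=> hf; elim: k => [|k IH]; first exact: entire_const.
by under eq_fun do rewrite exprS; exact: entireM.
Qed.

Lemma entire_prod (I : Type) (r : seq I) (P : pred I) (F : I -> 'rV[K]_n -> K) :
  (forall i, entire (F i)) -> entire (fun z => \prod_(i <- r | P i) F i z).
Proof.
move=> hF; elim: r => [|i r IH].
  by under eq_fun do rewrite big_nil; exact: entire_const.
under eq_fun do rewrite big_cons; case: (P i) => //; exact: entireM.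
Qed.

Lemma entire_sum (I : Type) (r : seq I) (P : pred I) (F : I -> 'rV[K]_n -> K) :
  (forall i, entire (F i)) -> entire (fun z => \sum_(i <- r | P i) F i z).
Proof.
move=> hF; elim: r => [|i r IH].
  by under eq_fun do rewrite big_nil; exact: entire_const.
under eq_fun do rewrite big_cons; case: (P i) => //; exact: entireD.
Qed.

Lemma entire_continuous f : entire f -> forall (z0 : 'rV[K]_n) r, 0 < r ->
  exists2 d, 0 < d & forall z : 'rV[K]_n, (forall s, `|z 0 s - z0 0 s| < d) -> `|f z - f z0| < r.
Proof.
move=> hf z0 r r0; have /differentiable_continuous /cvgrPdist_lt /(_ _ r0) := hf z0.
rewrite -nbhs_nearE => /nbhs_ballP[d /= d0 dP]; exists d => // z zd.
rewrite distrC; apply: dP; rewrite /ball /=; split => // i j.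
by rewrite /ball /= (ord1 i) distrC.
Qed.

End Entire.

Section KeyRelation.
Variables (R : realType) (n : nat).
Local Notation C := R[i].
Local Notation nc := (@Normc.normc R).
Local Notation RR := (measurableTypeR R).
Local Notation plane := (@plane_lebesgue R : {measure set (RR * RR) -> \bar R}).
Local Notation Cn := 'rV[C]_n.
Local Notation dv := (@dv R n).
Local Notation toCn := (@toCn R n).
Implicit Types (b c : 'I_n -> nat) (z : Cn) (e : Cn -> C).

Definition set_entry z (j : 'I_n) (w : C) : Cn := \row_s (if s == j then w else z 0 s).

Lemma toCn_set_coord (t : n.-tuple (RR * RR)) j x y :
  toCn (set_coord t j (x, y)) = set_entry (toCn t) j (x +i* y)%C.
Proof.
by apply/rowP => s; rewrite !mxE tnth_mktuple; case: ifP.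
Qed.

(** Only the existence of the complex derivative along one axis is used: no
    continuity of the derivative is available. *)
Lemma entire_slice e z j k : entire e -> holomorphic (fun w => k * e (set_entry z j w)).
Proof.
move=> ent w; set z0 := set_entry z j w.
have [l lP] := entire_partial ent z0 j; exists (k * l) => r r0.
have k0 : 0 < nc k + 1 by rewrite ltr_wpDl ?normc_ge0.
have r'0 : 0 < (r / (nc k + 1))%:C%C by rewrite ltcR divr_gt0.
have [d d0 dP] := lP _ r'0.
have dE : d = (complex.Re d)%:C%C by rewrite RRe_real// gtr0_real.
have d0' : 0 < complex.Re d by rewrite -ltcR -dE.
exists (complex.Re d) => // w' ww'.
have := dP (w' - w); rewrite normc_normr dE ltcR => /(_ ww').
have -> : (w' - w) *: delta_mx 0 j + z0 = set_entry z j w'.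
  apply/rowP => s; rewrite !mxE eqxx /=.
  by case: eqP => _; rewrite ?mulr1 ?subrK// mulr0 add0r.
rewrite !normc_normr -rmorphM lecR => H.
rewrite -/z0 (_ : _ - _ = k * (e (set_entry z j w') - e z0 - (w' - w) * l)); last by ring.
rewrite Normc.normcM; apply: le_trans (ler_wpM2l (normc_ge0 _) H) _.
rewrite mulrA ler_wpM2r ?normc_ge0// mulrCA ler_piMr//; first exact: ltW.
by rewrite ler_pdivrMr// mul1r lerDl.
Qed.

Section FixedFunction.
Variable e : Cn -> C.
Hypothesis ent : entire e.
Hypothesis me : Cmeasurable e.
Hypothesis Ie : dv.-integrable setT
  (EFin \o (fun t => nc (e (toCn t)) ^+ 2 * gauss (toCn t))).

(** The inequality 2ab <= a^2 + b^2 reduces the claim to the integrability of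
    the squares of the monomial and of [e]. *)
Lemma Cintegrable_gauss_pairing b c : Cintegrable (pairing 0 b c e).
Proof.
have I0 := integrable_normc_mono R (fun s => (b s + b s)%N) (fun s => (c s + c s)%N).
apply: (@Cintegrable_le R n _ (fun z =>
  nc (mono (fun s => (b s + b s)%N) (fun s => (c s + c s)%N) z) * gauss z + nc (e z) ^+ 2 * gauss z)).
- apply: CmeasurableM; last exact: Cmeasurable_conj.
  apply: CmeasurableM; last exact: Cmeasurable_mono.
  apply: Cmeasurable_real; apply: measurable_funM; last exact: measurable_gauss.
  exact: measurable_cnorm_even.
- move=> z; rewrite /pairing muln0 expr0 mul1r !Normc.normcM normc_conj normc_real.
  rewrite ger0_norm ?expR_ge0// -mulrDl mulrAC -mulrA mulrC ler_wpM2r ?expR_ge0//.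
  have -> : nc (mono (fun s => (b s + b s)%N) (fun s => (c s + c s)%N) z) = nc (mono b c z) ^+ 2.
    rewrite !normc_mono -prodrXl; apply: eq_bigr => s _.
    by rewrite -exprM muln2 -addnn; congr (_ ^+ _); ring.
  have := sqr_ge0 (nc (mono b c z) - nc (e z)); rewrite sqrrB => h.
  have := mulr_ge0 (normc_ge0 (mono b c z)) (normc_ge0 (e z)); lra.
- by have := integrableD measurableT I0 Ie; apply: eq_integrable.
Qed.

Lemma Cintegrable_pairing m b c : Cintegrable (pairing m b c e).
Proof. by apply: Cintegrable_pairing_rec => b' c'; exact: Cintegrable_gauss_pairing. Qed.

Let dpairing b c j z := (b j)%:R * pairing 0 (decr_at b j) c e z - pairing 0 b (incr_at c j) e z.

Let Idpairing b c j : Cintegrable (dpairing b c j).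
Proof.
apply: CintegrableD; first by apply: CintegrableZ; exact: Cintegrable_gauss_pairing.
under eq_fun do rewrite -mulN1r; apply: CintegrableZ; exact: Cintegrable_gauss_pairing.
Qed.

Let others b c j z : C := \prod_(s | s != j) (z 0 s ^+ b s * ((z 0 s)^*)%C ^+ c s).
Let ogauss j z : R := \prod_(s | s != j) expR (- nc (z 0 s) ^+ 2).

(* Along a slice all factors that depend on the other coordinates are absorbed
   into the holomorphic function [f] of the remaining coordinate. *)
Let pairing_set_entry b c b' c' j z x y (f : C -> C) k :
  (forall s, s != j -> b' s = b s) -> (forall s, s != j -> c' s = c s) ->
  f = (fun w => (k^* * (ogauss j z)%:C%C * (others b c j z)^*%C * e (set_entry z j w))%C) ->
  k * pairing 0 b' c' e (set_entry z j (x +i* y)%C) =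
  (expR (- x ^+ 2))%:C%C * (expR (- y ^+ 2))%:C%C *
  ((x +i* y)%C ^+ b' j * (x -i* y)%C ^+ c' j) * (f (x +i* y)%C)^*%C.
Proof.
move=> bb cc ->; rewrite /pairing muln0 expr0 mul1r gaussE /mono.
rewrite (bigD1 j)//= [X in _ * X * _](bigD1 j)//= !mxE eqxx.
have -> : \prod_(i | i != j) expR (- nc (set_entry z j (x +i* y)%C 0 i) ^+ 2) = ogauss j z.
  by apply: eq_bigr => s /negbTE sj; rewrite mxE sj.
have -> : \prod_(i | i != j) (set_entry z j (x +i* y)%C 0 i ^+ b' i *
    ((set_entry z j (x +i* y)%C 0 i)^*)%C ^+ c' i) = others b c j z.
  by apply: eq_bigr => s sj; rewrite mxE (negbTE sj) bb// cc.
by rewrite sqr_normcE /= opprD expRD !conjcM !conjcK conjc_real !rmorphM /=; ring.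
Qed.

(* The factor [k] gives the imaginary part as well, with [k = - 'i]. *)
Let Re_dpairing_null b c j k :
  (\int[dv]_t (complex.Re (k * dpairing b c j (toCn t)))%:E = 0)%E.
Proof.
pose K i t : R := match i with
  | 0%N => complex.Re (k * dpairing b c j (toCn t))
  | 1%N => complex.Re (k * pairing 0 b c e (toCn t))
  | _ => complex.Im (k * pairing 0 b c e (toCn t)) end.
apply: (@integral_slice_null _ _ _ (@plane_lebesgue R) n j K).
  case=> [|[|i]] /=.
  - by apply: (Cintegrable_Re (F := fun z => k * _)); apply: CintegrableZ; exact: Idpairing.
  - by apply: (Cintegrable_Re (F := fun z => k * _)); apply: CintegrableZ; exact: Cintegrable_gauss_pairing.
  - by apply: (Cintegrable_Im (F := fun z => k * _)); apply: CintegrableZ; exact: Cintegrable_gauss_pairing.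
move=> t It; set z := toCn t.
pose h w := (k^* * (ogauss j z)%:C%C * (others b c j z)^*%C * e (set_entry z j w))%C.
have holh : holomorphic h.
  exact: (entire_slice z j (k^* * (ogauss j z)%:C%C * (others b c j z)^*%C)%C ent).
have KU p : k * pairing 0 b c e (toCn (set_coord t j p)) = slice_field h (b j) (c j) p.1 p.2.
  case: p => x y; rewrite toCn_set_coord (@pairing_set_entry b c b c j z x y h k)//.
have KG p : k * dpairing b c j (toCn (set_coord t j p)) = slice_dfield h (b j) (c j) p.1 p.2.
  case: p => x y; rewrite toCn_set_coord /dpairing mulrBr mulrCA.
  rewrite (@pairing_set_entry b c (decr_at b j) c j z x y h k)//; last first.
    by move=> s /negbTE sj; rewrite /decr_at sj subn0.
  rewrite (@pairing_set_entry b c b (incr_at c j) j z x y h k)//; last first.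
    by move=> s /negbTE sj; rewrite /incr_at sj addn0.
  rewrite /slice_dfield /decr_at /incr_at eqxx subn1 addn1 exprS /=; ring.
have I1 : plane.-integrable setT (EFin \o (fun p => complex.Re (slice_field h (b j) (c j) p.1 p.2))).
  by have := It 1%N; apply: eq_integrable => // p _; rewrite /K KU.
have I2 : plane.-integrable setT (EFin \o (fun p => complex.Im (slice_field h (b j) (c j) p.1 p.2))).
  by have := It 2%N; apply: eq_integrable => // p _; rewrite /K KU.
have I0 : plane.-integrable setT (EFin \o (fun p => complex.Re (slice_dfield h (b j) (c j) p.1 p.2))).
  by have := It 0%N; apply: eq_integrable => // p _; rewrite /K KG.
have := slice_dfield_null holh I1 I2 I0; rewrite /Rintegral => N.
transitivity (\int[plane]_p (complex.Re (slice_dfield h (b j) (c j) p.1 p.2))%:E)%E.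
  by apply: eq_integral => p _; rewrite /K KG.
by rewrite -[LHS]fineK ?N//; exact: integrable_fin_num I0.
Qed.

(** Integration by parts: conj(z_j) exp(-|z|^2) is, up to sign, the derivative
    of exp(-|z|^2) with respect to z_j, and conj(e) is constant for this
    derivation.  The predecessor of [b j] is truncated at 0, where the
    coefficient [b j] vanishes. *)
Lemma Cint_pairing_incr_conj b c j :
  Cint (pairing 0 b (incr_at c j) e) = (b j)%:R * Cint (pairing 0 (decr_at b j) c e).
Proof.
have D0 : Cint (dpairing b c j) = 0.
  apply/eqP; rewrite eq_complex /=; apply/andP; split; apply/eqP; rewrite /Rintegral.
    transitivity (fine (\int[dv]_t (complex.Re (1 * dpairing b c j (toCn t)))%:E)%E).
      by congr fine; apply: eq_integral => t _; rewrite mul1r.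
    by rewrite Re_dpairing_null.
  transitivity (fine (\int[dv]_t (complex.Re (- 'i%C * dpairing b c j (toCn t)))%:E)%E).
    by congr fine; apply: eq_integral => t _; case: (dpairing _ _ _ _) => u v /=; congr EFin; ring.
  by rewrite Re_dpairing_null.
move: D0; rewrite /dpairing => D0; apply/esym/eqP; rewrite -subr_eq0 -D0.
rewrite -CintZ//; last exact: Cintegrable_gauss_pairing.
rewrite -mulN1r -CintZ; last exact: Cintegrable_gauss_pairing.
rewrite -CintD; [|by apply: CintegrableZ; exact: Cintegrable_gauss_pairing..].
by apply/eqP; apply: eq_Cint => z; rewrite mulN1r.
Qed.

End FixedFunction.
End KeyRelation.

(** * Explicit pairings of monomials with entire functions *)

Section PairingFormula.
Variables (R : realType) (n : nat).
Local Notation C := R[i].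
Local Notation nc := (@Normc.normc R).
Local Notation Cn := 'rV[C]_n.
Local Notation dv := (@dv R n).
Local Notation toCn := (@toCn R n).
Implicit Types (b c : 'I_n -> nat) (z : Cn) (e : Cn -> C).

(** This is b!/(b - c)!, or 0 unless c <= b in every coordinate; the case
    distinction is hidden in the vanishing of falling factorials. *)
Definition fallfact b c : nat := (\prod_s (b s) ^_ (c s))%N.
Definition rising m k : nat := (\prod_(i < m) (k + n + i))%N.

Lemma fallfact_incr b c j : fallfact (incr_at b j) (incr_at c j) = ((b j).+1 * fallfact b c)%N.
Proof.
rewrite /fallfact (bigD1 j)//= [in RHS](bigD1 j)//= mulnA /incr_at eqxx !addn1 ffactSS.
by congr (_ * _)%N; apply: eq_bigr => s /negbTE sj; rewrite sj !addn0.
Qed.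

Lemma fallfact_incr_conj b c j : fallfact b (incr_at c j) = (b j * fallfact (decr_at b j) c)%N.
Proof.
rewrite /fallfact (bigD1 j)//= [in RHS](bigD1 j)//= mulnA /incr_at /decr_at eqxx addn1 ffactnS subn1.
by congr (_ * _)%N; apply: eq_bigr => s /negbTE sj; rewrite sj addn0 subn0.
Qed.

Lemma risingS m k : rising m.+1 k = ((k + n) * rising m k.+1)%N.
Proof.
rewrite /rising big_ord_recl addn0; congr (_ * _)%N; apply: eq_bigr => i _.
by rewrite lift0 addnS !addSn.
Qed.

Lemma rising_gt0 m k : (0 < n)%N -> (0 < rising m k)%N.
Proof. by move=> n0; apply: prodn_gt0 => i; rewrite addn_gt0 addn_gt0 n0 orbT. Qed.

Variable e : Cn -> C.
Hypothesis ent : entire e.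
Hypothesis me : Cmeasurable e.
Hypothesis Ie : dv.-integrable setT
  (EFin \o (fun t => nc (e (toCn t)) ^+ 2 * gauss (toCn t))).

Let exp0 : 'I_n -> nat := fun=> 0%N.

Lemma Cint_gauss_pairing b c :
  Cint (pairing 0 b c e) = (fallfact b c)%:R * Cint (pairing 0 (fun s => b s - c s)%N exp0 e).
Proof.
move: {2}(\sum_s c s)%N (erefl (\sum_s c s)%N) => k; elim: k b c => [|k IH] b c ck.
  have c0 : c = exp0.
    apply/funext => s; apply/eqP; have /eqP := ck.
    by rewrite sum_nat_eq0 => /forallP /(_ s).
  have -> : (fun s => b s - c s)%N = b by apply/funext => s; rewrite c0 subn0.
  have -> : fallfact b c = 1%N by rewrite /fallfact big1// => s _; rewrite c0.
  by rewrite mul1r c0.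
have [j cj] : exists j, (0 < c j)%N.
  apply: contrapT => /forallNP H; move/eqP: ck; rewrite big1// => s _.
  by have := H s; rewrite lt0n => /negP; rewrite negbK => /eqP.
have cE : c = incr_at (decr_at c j) j.
  by apply/funext => s; rewrite /incr_at /decr_at; case: eqP => [->|_]; rewrite ?subnK// subn0 addn0.
have ck' : (\sum_s decr_at c j s = k)%N.
  apply/eqP; rewrite -eqSS -ck (bigD1 j)//= [X in _ == X](bigD1 j)//= /decr_at eqxx.
  rewrite -addSn subn1 prednK// eqn_add2l; apply/eqP; apply: eq_bigr => s /negbTE ->.
  by rewrite subn0.
rewrite [in LHS]cE Cint_pairing_incr_conj// IH// mulrA -natrM -fallfact_incr_conj -cE.
have -> // : (fun s => decr_at b j s - decr_at c j s)%N = (fun s => b s - c s)%N.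
apply/funext => s; rewrite /decr_at.
by case: eqP => [->|_]; rewrite ?subn0// -subnDA add1n subn1 prednK.
Qed.

(** Raising m by one multiplies the pairing by the sum of the b_j + 1, because
    [fallfact] gains the factor b_j + 1 when both exponents of z_j are raised.
    The difference [b - c] does not change, so that conj(z)^c only contributes
    a scalar. *)
Lemma Cint_pairing m b c :
  Cint (pairing m b c e) = (fallfact b c * rising m (\sum_s b s))%:R *
    Cint (pairing 0 (fun s => b s - c s)%N exp0 e).
Proof.
elim: m b c => [|m IH] b c; first by rewrite Cint_gauss_pairing /rising big_ord0 muln1.
rewrite (funext (pairingS m b c e)) Cint_sum; last by move=> j; exact: Cintegrable_pairing.
have E j : Cint (pairing m (incr_at b j) (incr_at c j) e) =
    ((b j).+1 * (fallfact b c * rising m (\sum_s b s).+1))%:R *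
    Cint (pairing 0 (fun s => b s - c s)%N exp0 e).
  have sE : (\sum_s incr_at b j s = (\sum_s b s).+1)%N.
    have -> : (\sum_s incr_at b j s = \sum_s b s + \sum_s (s == j))%N by rewrite -big_split.
    have -> : (\sum_s (s == j))%N = 1%N.
      by rewrite (bigD1 j)//= eqxx big1// => s /negbTE ->.
    by rewrite addn1.
  have dE : (fun s => incr_at b j s - incr_at c j s)%N = (fun s => b s - c s)%N.
    by apply/funext => s; rewrite /incr_at subnDr.
  by rewrite IH fallfact_incr sE dE mulnA.
rewrite (eq_bigr _ (fun j _ => E j)) -mulr_suml -natr_sum -big_distrl /= risingS.
have sE : (\sum_j (b j).+1 = \sum_s b s + n)%N.
  by under eq_bigr do rewrite -addn1; rewrite big_split /= sum_nat_const card_ord muln1.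
by rewrite sE mulnCA.
Qed.

End PairingFormula.

Section Orthogonality.
Variables (R : realType) (n : nat).
Local Notation C := R[i].
Local Notation nc := (@Normc.normc R).
Local Notation Cn := 'rV[C]_n.
Local Notation dv := (@dv R n).
Local Notation toCn := (@toCn R n).
Implicit Types (b c : 'I_n -> nat) (z : Cn) (e : Cn -> C).
Local Notation exp0 := ((fun=> 0%N) : 'I_n -> nat).

Lemma mono0 z : mono exp0 exp0 z = 1 :> C.
Proof. by rewrite /mono big1// => s _; rewrite !expr0 mulr1. Qed.

Definition gauss_mass : R := \int[dv]_t gauss (toCn t).

Lemma integrable_gauss : dv.-integrable setT (EFin \o (fun t => gauss (toCn t))).
Proof.
have := integrable_normc_mono R exp0 exp0; apply: eq_integrable => // t _.
by rewrite /comp mono0 Normc.normc1 mul1r.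
Qed.

Lemma gauss_sqr_one : dv.-integrable setT
  (EFin \o (fun t => nc ((fun=> 1) (toCn t)) ^+ 2 * gauss (toCn t))).
Proof.
have := integrable_gauss; apply: eq_integrable => // t _.
by rewrite /comp Normc.normc1 expr1n mul1r.
Qed.

Let ent1 : entire (fun _ : Cn => 1 : C) := @entire_const _ n 1.
Let me1 : Cmeasurable (fun _ : Cn => 1 : C) := @Cmeasurable_cst _ _ 1.

Lemma Cint_pairing_one : Cint (pairing 0 exp0 exp0 (fun _ : Cn => 1)) = gauss_mass%:C%C.
Proof.
rewrite /Cint; apply/eqP; rewrite eq_complex /=; apply/andP; split; apply/eqP.
  apply: eq_Rintegral => t _; rewrite /pairing mono0 muln0 expr0 mul1r mulr1.
  by rewrite conjc1 mulr1.
rewrite -[RHS](mul0r (fine (dv setT))) -Rintegral_cst//; apply: eq_Rintegral => t _.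
by rewrite /pairing mono0 muln0 expr0 mul1r mulr1 conjc1 mulr1.
Qed.

(** If c <= b and c differs from b, removing the conjugate exponents leaves a
    holomorphic monomial z^(b - c) with b - c nonzero; exchanging the roles of
    z and its conjugate, the same formula shows that its integral is zero. *)
Lemma Cint_mono_ortho b c : Cint (pairing 0 b c (fun _ : Cn => 1)) =
  if [forall s, b s == c s] then (\prod_s (b s)`!)%:R * gauss_mass%:C%C else 0.
Proof.
rewrite Cint_gauss_pairing//; last exact: gauss_sqr_one.
case: ifPn => [/forallP bc|].
  have -> : (fun s => b s - c s)%N = exp0.
    by apply/funext => s; rewrite (eqP (bc s)) subnn.
  have -> : fallfact b c = (\prod_s (b s)`!)%N.
    by apply: eq_bigr => s _; rewrite -(eqP (bc s)) ffactnn.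
  by rewrite Cint_pairing_one.
rewrite negb_forall => /existsP[s bs].
have [bc|cb] := ltnP (b s) (c s).
  by rewrite /fallfact (bigD1 s)//= ffact_small// mul0n mul0r.
have -> : Cint (pairing 0 (fun s => b s - c s)%N exp0 (fun _ : Cn => 1)) = 0; last by rewrite mulr0.
have -> : Cint (pairing 0 (fun s => b s - c s)%N exp0 (fun _ : Cn => 1)) =
    (Cint (pairing 0 exp0 (fun s => b s - c s)%N (fun _ : Cn => 1)))^*%C.
  rewrite -Cint_conj; last exact: (Cintegrable_gauss_pairing me1 gauss_sqr_one).
  apply: eq_Cint => z; rewrite /pairing !conjcM !conjc1 !mulr1 conjc_real.
  congr (_ * _); rewrite /mono conjc_prod; apply: eq_bigr => i _.
  by rewrite conjcM !conjcX conjcK !expr0 mul1r mulr1.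
rewrite Cint_gauss_pairing//; last exact: gauss_sqr_one.
rewrite /fallfact (bigD1 s)//= ffact_small ?mul0n ?mul0r ?conjc0//.
by rewrite subn_gt0 ltn_neqAle eq_sym bs.
Qed.

End Orthogonality.

(** * The Hilbert space structure *)

Section Weighted.
Variables (R : realType) (n m : nat).
Local Notation C := R[i].
Local Notation nc := (@Normc.normc R).
Local Notation RR := (measurableTypeR R).
Local Notation Cn := 'rV[C]_n.
Local Notation dv := (@dv R n).
Local Notation toCn := (@toCn R n).
Local Notation w := (@weight R n m).
Implicit Types (b c : 'I_n -> nat) (z : Cn) (e f g u : Cn -> C).

Lemma omega_gt0 : 0 < omega R n m.
Proof. by rewrite divr_gt0 ?mulr_gt0 ?exprn_gt0 ?pi_gt0 ?ltr0n ?fact_gt0. Qed.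

Lemma weightE z : w z = omega R n m * (cnorm z ^+ (2 * m) * gauss z).
Proof. by rewrite /weight -mulrA. Qed.

Lemma weight_ge0 z : 0 <= w z.
Proof.
rewrite weightE; apply: mulr_ge0; first exact/ltW/omega_gt0.
by apply: mulr_ge0; [rewrite exprn_ge0 ?sqrtr_ge0|exact: expR_ge0].
Qed.

Lemma measurable_weight : measurable_fun setT (fun t => w (toCn t) : RR).
Proof.
under eq_fun do rewrite weightE.
apply: measurable_funM; first exact: measurable_cst.
by apply: measurable_funM; [exact: measurable_cnorm_even|exact: measurable_gauss].
Qed.

Lemma L2P f : L2 m f <-> Cmeasurable f /\
  dv.-integrable setT (EFin \o (fun t => nc (f (toCn t)) ^+ 2 * w (toCn t))).
Proof.
split=> -[mf If]; split => //.
  apply/integrableP; split.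
    apply/measurable_EFinP; apply: measurable_funM; last exact: measurable_weight.
    by apply: measurable_funX; exact: measurable_normc.
  rewrite (le_lt_trans _ If)// le_eqVlt; apply/orP; left; apply/eqP.
  apply: eq_integral => t _ /=; rewrite ger0_norm// mulr_ge0 ?sqr_ge0//; exact: weight_ge0.
move/integrableP : If => [_]; apply: le_lt_trans.
rewrite le_eqVlt; apply/orP; left; apply/eqP.
apply: eq_integral => t _ /=; rewrite ger0_norm// mulr_ge0 ?sqr_ge0//; exact: weight_ge0.
Qed.

Lemma L2_le f (h : Cn -> R) : Cmeasurable f -> (forall z, nc (f z) ^+ 2 * w z <= h z) ->
  dv.-integrable setT (EFin \o (fun t => h (toCn t))) -> L2 m f.
Proof.
move=> mf fh Ih; apply/L2P; split => //; apply: le_integrable Ih => //.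
  apply/measurable_EFinP; apply: measurable_funM; last exact: measurable_weight.
  by apply: measurable_funX; exact: measurable_normc.
move=> t _; rewrite lee_fin ger0_norm; first exact: le_trans (fh _) (ler_norm _).
by apply: mulr_ge0; [exact: sqr_ge0|exact: weight_ge0].
Qed.

Lemma L2D f g : L2 m f -> L2 m g -> L2 m (fun z => f z + g z).
Proof.
move=> /L2P[mf If] /L2P[mg Ig].
apply: (@L2_le _ (fun z => 2 * (nc (f z) ^+ 2 * w z + nc (g z) ^+ 2 * w z))).
- exact: CmeasurableD.
- move=> z; rewrite -mulrDl mulrA ler_wpM2r ?weight_ge0//.
  apply: (@le_trans _ _ ((nc (f z) + nc (g z)) ^+ 2)).
    by apply: lerXn2r; rewrite ?nnegrE ?addr_ge0 ?normc_ge0// normcDl.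
  have := sqr_ge0 (nc (f z) - nc (g z)); rewrite sqrrB sqrrD; lra.
- have := integrableZl measurableT 2 (integrableD measurableT If Ig).
  by apply: eq_integrable.
Qed.

Lemma L2Z k f : L2 m f -> L2 m (fun z => k * f z).
Proof.
move=> /L2P[mf If]; apply: (@L2_le _ (fun z => nc k ^+ 2 * (nc (f z) ^+ 2 * w z))).
- by apply: CmeasurableM => //; exact: Cmeasurable_cst.
- by move=> z; rewrite Normc.normcM exprMn mulrA.
- by have := integrableZl measurableT (nc k ^+ 2) If; apply: eq_integrable.
Qed.

Lemma L2B f g : L2 m f -> L2 m g -> L2 m (fun z => f z - g z).
Proof.
move=> hf hg; under eq_fun do rewrite -mulN1r.
by apply: L2D => //; exact: L2Z.
Qed.

Lemma L2_zero : L2 m (fun _ : Cn => 0).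
Proof.
apply: (@L2_le _ (fun=> 0)); first exact: Cmeasurable_cst.
  by move=> z; rewrite Normc.normc0 expr0n mul0r.
exact: integrable0.
Qed.

Lemma L2_sum (I : Type) (r : seq I) (P : pred I) (F : I -> Cn -> C) :
  (forall i, L2 m (F i)) -> L2 m (fun z => \sum_(i <- r | P i) F i z).
Proof.
move=> IF; elim: r => [|i r IH].
  by under eq_fun do rewrite big_nil; exact: L2_zero.
under eq_fun do rewrite big_cons; case: (P i) => //; exact: L2D.
Qed.

Lemma L2_mono b c : L2 m (mono b c : Cn -> C).
Proof.
have I0 := @Cintegrable_pairing R n (fun=> 1) (Cmeasurable_cst n 1) (@gauss_sqr_one R n) m
  (fun s => b s + b s)%N (fun s => c s + c s)%N.
have [_ I1] := CintegrableZ (omega R n m)%:C%C I0.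
apply: (@L2_le _ (fun z => nc ((omega R n m)%:C%C * pairing m
  (fun s => b s + b s)%N (fun s => c s + c s)%N (fun=> 1) z)) _ _ I1); first exact: Cmeasurable_mono.
move=> z; rewrite /pairing conjc1 mulr1 mulrA -rmorphM -weightE Normc.normcM normc_real.
rewrite ger0_norm ?weight_ge0// [leRHS]mulrC ler_wpM2r ?weight_ge0//.
rewrite !normc_mono -prodrXl le_eqVlt; apply/orP; left; apply/eqP; apply: eq_bigr => s _.
by rewrite -exprM muln2 -addnn; congr (_ ^+ _); rewrite addnACA.
Qed.

(** The Cauchy-Schwarz inequality before optimization in the parameter [k]. *)
Lemma L2_prod_le f g : L2 m f -> L2 m g -> forall k : R, 0 < k ->
  [/\ dv.-integrable setT (EFin \o (fun t => nc (f (toCn t)) * nc (g (toCn t)) * w (toCn t))) &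
   2 * k * \int[dv]_t (nc (f (toCn t)) * nc (g (toCn t)) * w (toCn t)) <=
   k ^+ 2 * \int[dv]_t (nc (f (toCn t)) ^+ 2 * w (toCn t)) +
   \int[dv]_t (nc (g (toCn t)) ^+ 2 * w (toCn t))].
Proof.
move=> /L2P[mf If] /L2P[mg Ig].
have le k z : 2 * k * (nc (f z) * nc (g z) * w z) <=
    k ^+ 2 * (nc (f z) ^+ 2 * w z) + nc (g z) ^+ 2 * w z.
  move: (w z) (weight_ge0 z) (nc (f z)) (nc (g z)) => W W0 x y.
  rewrite -subr_ge0 (_ : _ - _ = (k * x - y) ^+ 2 * W); last by ring.
  by rewrite mulr_ge0 ?sqr_ge0.
have S k : dv.-integrable setT (EFin \o (fun t =>
    k ^+ 2 * (nc (f (toCn t)) ^+ 2 * w (toCn t)) + nc (g (toCn t)) ^+ 2 * w (toCn t))).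
  by apply: integrable_add => //; exact: integrable_scale.
have I0 : dv.-integrable setT (EFin \o (fun t => nc (f (toCn t)) * nc (g (toCn t)) * w (toCn t))).
  apply: le_integrable (S 1) => //.
    apply/measurable_EFinP; apply: measurable_funM; last exact: measurable_weight.
    by apply: measurable_funM; exact: measurable_normc.
  move=> t _; rewrite lee_fin; apply: le_trans (ler_norm _).
  have p0 : 0 <= nc (f (toCn t)) * nc (g (toCn t)) * w (toCn t).
    by apply: mulr_ge0; [apply: mulr_ge0; exact: normc_ge0|exact: weight_ge0].
  rewrite ger0_norm//; apply: le_trans (le 1 (toCn t)).
  by rewrite mulr1 ler_peMl// ler1n.
move=> k k0; split => //.
rewrite -(RintegralZl _ _ I0)// -(RintegralZl _ _ If)// -RintegralD//; last exact: integrable_scale.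
by apply: le_Rintegral => //; exact: integrable_scale.
Qed.

Lemma Cintegrable_inner f g : L2 m f -> L2 m g ->
  Cintegrable (fun z => f z * (g z)^*%C * (w z)%:C%C).
Proof.
move=> hf hg; have [I0 _] := L2_prod_le hf hg ltr01.
apply: (@Cintegrable_le R n _ (fun z => nc (f z) * nc (g z) * w z) _ _ I0).
  apply: CmeasurableM; last by apply: Cmeasurable_real; exact: measurable_weight.
  by apply: CmeasurableM; [case: hf|apply: Cmeasurable_conj; case: hg].
by move=> z; rewrite !Normc.normcM normc_conj normc_real (ger0_norm (weight_ge0 z)).
Qed.

Lemma innerD f g e : L2 m f -> L2 m g -> L2 m e ->
  inner m (fun z => f z + g z) e = inner m f e + inner m g e.
Proof.
move=> hf hg he; rewrite /inner -CintD; [|exact: Cintegrable_inner..].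
by apply: eq_Cint => z; rewrite !mulrDl.
Qed.

Lemma innerZ k f e : L2 m f -> L2 m e -> inner m (fun z => k * f z) e = k * inner m f e.
Proof.
move=> hf he; rewrite /inner -CintZ; last exact: Cintegrable_inner.
by apply: eq_Cint => z; rewrite !mulrA.
Qed.

Lemma innerB f g e : L2 m f -> L2 m g -> L2 m e ->
  inner m (fun z => f z - g z) e = inner m f e - inner m g e.
Proof.
move=> hf hg he; under [in LHS]eq_fun do rewrite -mulN1r.
by rewrite innerD ?innerZ ?mulN1r//; exact: L2Z.
Qed.

Lemma inner_sum (I : Type) (r : seq I) (P : pred I) (F : I -> Cn -> C) e :
  (forall i, L2 m (F i)) -> L2 m e ->
  inner m (fun z => \sum_(i <- r | P i) F i z) e = \sum_(i <- r | P i) inner m (F i) e.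
Proof.
move=> hF he; rewrite /inner -Cint_sum; last by move=> i; exact: Cintegrable_inner.
by apply: eq_Cint => z; rewrite !mulr_suml.
Qed.

Lemma Re_inner_self f : complex.Re (inner m f f) =
  \int[dv]_t (nc (f (toCn t)) ^+ 2 * w (toCn t)).
Proof.
apply: eq_Rintegral => t _; rewrite sqr_normcE.
by case: (f _) => a b /=; ring.
Qed.

Lemma norm2_sqr f : norm2 m f ^+ 2 = \int[dv]_t (nc (f (toCn t)) ^+ 2 * w (toCn t)).
Proof.
rewrite sqr_sqrtr Re_inner_self//; apply: Rintegral_ge0 => t _.
by rewrite mulr_ge0 ?sqr_ge0 ?weight_ge0.
Qed.

Lemma cauchy_schwarz f g : L2 m f -> L2 m g ->
  \int[dv]_t (nc (f (toCn t)) * nc (g (toCn t)) * w (toCn t)) <= norm2 m f * norm2 m g.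
Proof.
move=> hf hg; set X := Rintegral _ _ _.
have H k : 0 < k -> 2 * k * X <= k ^+ 2 * norm2 m f ^+ 2 + norm2 m g ^+ 2.
  by move=> k0; have [_] := L2_prod_le hf hg k0; rewrite !norm2_sqr.
have a0 : 0 <= norm2 m f by exact: sqrtr_ge0.
have b0 : 0 <= norm2 m g by exact: sqrtr_ge0.
move: (norm2 m f) (norm2 m g) a0 b0 H => a b a0 b0 H.
rewrite leNgt; apply/negP => abX.
have X0 : 0 < X by rewrite (le_lt_trans _ abX)// mulr_ge0.
move: a0; rewrite le_eqVlt => /predU1P[a0|a0].
  have k0 : 0 < (b ^+ 2 + 1) / (2 * X) by rewrite divr_gt0 ?mulr_gt0// ltr_wpDl// sqr_ge0.
  have := H _ k0; rewrite -a0 expr0n mulr0 add0r.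
  have -> : 2 * ((b ^+ 2 + 1) / (2 * X)) * X = b ^+ 2 + 1 by field; rewrite gt_eqF.
  by rewrite gerDl ler10.
have k0 : 0 < X / a ^+ 2 by rewrite divr_gt0// exprn_gt0.
have := H _ k0.
have -> : 2 * (X / a ^+ 2) * X = X ^+ 2 / a ^+ 2 + X ^+ 2 / a ^+ 2 by field; rewrite gt_eqF.
have -> : (X / a ^+ 2) ^+ 2 * a ^+ 2 = X ^+ 2 / a ^+ 2 by field; rewrite gt_eqF.
rewrite lerD2l ler_pdivrMr ?exprn_gt0// -exprMn mulrC.
by apply/negP; rewrite -ltNge ltrXn2r// ?nnegrE ?mulr_ge0// ltW.
Qed.

Lemma Re_inner_le f g : L2 m f -> L2 m g ->
  `|complex.Re (inner m f g)| <= norm2 m f * norm2 m g.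
Proof.
move=> hf hg; apply: le_trans (cauchy_schwarz hf hg).
apply: le_trans (Re_Cint_le (Cintegrable_inner hf hg)) _.
rewrite le_eqVlt; apply/orP; left; apply/eqP; apply: eq_Rintegral => t _.
by rewrite !Normc.normcM normc_conj normc_real ger0_norm ?weight_ge0.
Qed.

(** Real and imaginary part are bounded separately; the factor 2 is harmless in
    comparisons of orders of growth. *)
Lemma normc_inner_le f g : L2 m f -> L2 m g ->
  nc (inner m f g) <= 2 * (norm2 m f * norm2 m g).
Proof.
move=> hf hg; apply: (le_trans (normc_le _)); rewrite mulr2n mulrDl mul1r lerD//.
  exact: Re_inner_le.
apply: le_trans (cauchy_schwarz hf hg).
apply: le_trans (Im_Cint_le (Cintegrable_inner hf hg)) _.
rewrite le_eqVlt; apply/orP; left; apply/eqP; apply: eq_Rintegral => t _.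
by rewrite !Normc.normcM normc_conj normc_real ger0_norm ?weight_ge0.
Qed.

End Weighted.

(** * The projection onto the Fock-Sobolev space *)

Section Projection.
Variables (R : realType) (n m : nat).
Hypothesis n_gt0 : (0 < n)%N.
Local Notation C := R[i].
Local Notation nc := (@Normc.normc R).
Local Notation RR := (measurableTypeR R).
Local Notation Cn := 'rV[C]_n.
Local Notation dv := (@dv R n).
Local Notation toCn := (@toCn R n).
Local Notation w := (@weight R n m).
Local Notation exp0 := ((fun=> 0%N) : 'I_n -> nat).
Implicit Types (b c : 'I_n -> nat) (z : Cn) (e f g u p : Cn -> C).

Lemma entire_continuous_normc f : entire f -> forall (z0 : Cn) (r : R), 0 < r ->
  exists2 d : R, 0 < d & forall z, (forall s, nc (z 0 s - z0 0 s) < d) -> nc (f z - f z0) < r.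
Proof.
move=> hf z0 r r0; have r0' : 0 < r%:C%C by rewrite ltcR.
have [d d0 dP] := entire_continuous hf z0 r0'.
have dE : d = (complex.Re d)%:C%C by rewrite RRe_real// gtr0_real.
exists (complex.Re d); first by rewrite -ltcR -dE.
move=> z zd; rewrite -ltcR -normc_normr; apply: dP => s.
by rewrite normc_normr dE ltcR.
Qed.

Lemma nc_le_cnorm z s : nc (z 0 s) <= cnorm z.
Proof.
rewrite -[leLHS]ger0_norm ?normc_ge0// -sqrtr_sqr ler_wsqrtr// (bigD1 s)//= lerDl.
by apply: sumr_ge0 => i _; exact: sqr_ge0.
Qed.

(** For m > 0 the weight of L^2_m vanishes at the origin, so that
    square-integrability against exp(-|z|^2) is not immediate: near the origin
    [e] is bounded by continuity, and elsewhere |z|^(2m) is bounded below. *)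
Lemma fock_gauss e : fock_sobolev m e -> dv.-integrable setT
  (EFin \o (fun t => nc (e (toCn t)) ^+ 2 * gauss (toCn t))).
Proof.
move=> [ent /L2P[me Ie]].
have [d d0 dP] := entire_continuous_normc ent 0 ltr01.
pose A := nc (e 0) + 1; pose B := (omega R n m * d ^+ (2 * m))^-1.
have B0 : 0 < B by rewrite invr_gt0 mulr_gt0 ?omega_gt0 ?exprn_gt0.
have le z : nc (e z) ^+ 2 * gauss z <= A ^+ 2 * gauss z + B * (nc (e z) ^+ 2 * w z).
  have [zd|] := pselect (forall s, nc (z 0 s) < d).
    apply: (@le_trans _ _ (A ^+ 2 * gauss z)); last first.
      rewrite lerDl; apply: mulr_ge0; first exact: ltW.
      by apply: mulr_ge0; [exact: sqr_ge0|exact: weight_ge0].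
    rewrite ler_wpM2r ?expR_ge0//; apply: lerXn2r; rewrite ?nnegrE ?normc_ge0 ?addr_ge0 ?normc_ge0//.
    rewrite -[e z](subrK (e 0)) addrC (le_trans (normcDl _ _))// lerD2l ltW//.
    by apply: dP => s; rewrite mxE subr0.
  move=> /existsNP[s /negP]; rewrite -leNgt => ds.
  apply: (@le_trans _ _ (B * (nc (e z) ^+ 2 * w z))); last first.
    by rewrite lerDr mulr_ge0 ?expR_ge0 ?sqr_ge0.
  rewrite weightE mulrCA ler_wpM2l ?sqr_ge0//.
  have -> : B * (omega R n m * (cnorm z ^+ (2 * m) * gauss z)) =
    B * (omega R n m * cnorm z ^+ (2 * m)) * gauss z by ring.
  rewrite ler_peMl ?expR_ge0// /B.
  have X0 : 0 < omega R n m * d ^+ (2 * m) by rewrite mulr_gt0 ?omega_gt0 ?exprn_gt0.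
  rewrite (ler_pdivlMl _ _ X0) mulr1 ler_pM2l ?omega_gt0//.
  apply: lerXn2r; rewrite ?nnegrE ?sqrtr_ge0 ?(ltW d0)//.
  exact: le_trans ds (nc_le_cnorm z s).
have I0 : dv.-integrable setT (EFin \o (fun t => A ^+ 2 * gauss (toCn t) +
    B * (nc (e (toCn t)) ^+ 2 * w (toCn t)))).
  by apply: integrable_add; apply: integrable_scale => //; exact: integrable_gauss.
apply: le_integrable I0 => //.
  apply/measurable_EFinP; apply: measurable_funM; last exact: measurable_gauss.
  by apply: measurable_funX; exact: measurable_normc.
move=> t _; rewrite lee_fin; apply: le_trans (ler_norm _).
rewrite ger0_norm; first exact: le.
by apply: mulr_ge0; [exact: sqr_ge0|exact: expR_ge0].
Qed.

Lemma inner_mono b c e : fock_sobolev m e -> inner m (mono b c) e =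
  (omega R n m * (fallfact b c * rising n m (\sum_s b s))%:R)%:C%C *
  Cint (pairing 0 (fun s => b s - c s)%N exp0 e).
Proof.
move=> fe; have [ent [me _]] := fe; have Ie := fock_gauss fe.
rewrite rmorphM rmorph_nat -mulrA -Cint_pairing// -CintZ; last exact: Cintegrable_pairing.
apply: eq_Cint => z; rewrite /pairing weightE rmorphM; ring.
Qed.

Lemma entire_mono b : entire (mono b exp0 : Cn -> C).
Proof.
apply: entire_prod => s; apply: entireM; first by apply: entireX; exact: entire_coord.
by under eq_fun do rewrite expr0; exact: entire_const.
Qed.

Lemma fock_mono b : fock_sobolev m (mono b exp0 : Cn -> C).
Proof. by split; [exact: entire_mono|exact: L2_mono]. Qed.

Lemma fock_sum (I : Type) (r : seq I) (P : pred I) (F : I -> Cn -> C) :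
  (forall i, fock_sobolev m (F i)) -> fock_sobolev m (fun z => \sum_(i <- r | P i) F i z).
Proof.
by move=> hF; split; [apply: entire_sum => i; case: (hF i)|apply: L2_sum => i; case: (hF i)].
Qed.

Lemma fockZ k f : fock_sobolev m f -> fock_sobolev m (fun z => k * f z).
Proof.
by move=> [ef Lf]; split; [apply: entireM => //; exact: entire_const|exact: L2Z].
Qed.

Lemma fockB f g : fock_sobolev m f -> fock_sobolev m g -> fock_sobolev m (fun z => f z - g z).
Proof.
move=> [ef Lf] [eg Lg]; split; last exact: L2B.
have -> : (fun z => f z - g z) = (fun z => f z + (-1) * g z).
  by apply/funext => z; rewrite mulN1r.
by apply: (entireD ef); apply: (entireM _ eg); exact: entire_const.
Qed.

(** The rising factorials are the quotients of the moments of L^2_m by those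
    of the Gaussian weight, up to the constant [omega]. *)
Definition toeplitz_coef b c : R :=
  (fallfact b c * rising n m (\sum_s b s))%:R / (rising n m (\sum_s (b s - c s)))%:R.

Lemma inner_mono_proj b c e : fock_sobolev m e ->
  inner m (mono b c) e = (toeplitz_coef b c)%:C%C * inner m (mono (fun s => b s - c s)%N exp0) e.
Proof.
move=> fe; rewrite !inner_mono// mulrA -rmorphM.
have -> : (fun s => b s - c s - 0)%N = (fun s => b s - c s)%N by apply/funext => s; rewrite subn0.
congr (_%:C%C * _); rewrite /toeplitz_coef.
have -> : fallfact (fun s => b s - c s)%N exp0 = 1%N by rewrite /fallfact big1.
by rewrite mul1n mulrCA; field; rewrite pnatr_eq0 -lt0n rising_gt0.
Qed.

(** Both functions have the same pairing with every [e], since the pairing of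
    z^b conj(z)^c is a multiple of the one of z^(b - c). *)
Lemma is_projection_poly (I : finType) (a : I -> C) (B D : I -> 'I_n -> nat) :
  is_projection m (fun z => \sum_i a i * mono (B i) (D i) z)
    (fun z => \sum_i a i * (toeplitz_coef (B i) (D i))%:C%C * mono (fun s => B i s - D i s)%N exp0 z).
Proof.
split; first by apply: fock_sum => i; apply: fockZ; exact: fock_mono.
move=> e fe; have Le : L2 m e by case: fe.
rewrite innerB//; last 2 first.
- by apply: L2_sum => i; apply: L2Z; exact: L2_mono.
- by apply: L2_sum => i; apply: L2Z; exact: L2_mono.
rewrite !inner_sum//; last 2 first.
- by move=> i; apply: L2Z; exact: L2_mono.
- by move=> i; apply: L2Z; exact: L2_mono.
apply/eqP; rewrite subr_eq0; apply/eqP; apply: eq_bigr => i _.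
rewrite !innerZ//; [|exact: L2_mono..].
by rewrite inner_mono_proj// mulrA.
Qed.

(** Positivity is required near [z0] only off the origin, where the weight may
    vanish. *)
Lemma integral_gt0 (f : Cn -> R) (z0 : Cn) (r : R) : 0 < r ->
  (forall z, 0 <= f z) -> dv.-integrable setT (EFin \o (fun t => f (toCn t))) ->
  (forall z, (forall s, nc (z 0 s - z0 0 s) < r) -> z != 0 -> 0 < f z) ->
  0 < \int[dv]_t f (toCn t).
Proof.
move=> r0 f0 If fpos.
have If0 : 0 <= \int[dv]_t f (toCn t) by apply: Rintegral_ge0 => t _; exact: f0.
rewrite lt_neqAle If0 andbT; apply/negP => /eqP I0.
(* One-sided intervals next to each real coordinate of [z0], directed away from
   0: points of the box are close to [z0] and have no zero coordinate. *)
pose J (x : R) : set RR := if 0 <= x then `]x, (x + r / 2)[%classic else `](x - r / 2), x[%classic.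
pose A s : set (RR * RR) := J (complex.Re (z0 0 s)) `*` J (complex.Im (z0 0 s)).
have r2 : 0 < r / 2 by rewrite divr_gt0.
have mJ x : measurable (J x) by rewrite /J; case: ifP => _; exact: measurable_itv.
have J0 x : (0 < (@lebesgue_measure R) (J x))%E.
  by rewrite /J; case: ifP => _; rewrite lebesgue_measure_itv/= lte_fin ?ltrDl ?gtrBl r2
    -EFinB lte_fin subr_gt0 ?ltrDl ?gtrBl.
have mA s : measurable (A s) by exact: measurableX.
have A0 s : (0 < @plane_lebesgue R (A s))%E.
  rewrite /A; move: (z0 0 s) => z0s.
  have -> : @plane_lebesgue R (J (complex.Re z0s) `*` J (complex.Im z0s)) =
    (@lebesgue_measure R (J (complex.Re z0s)) * @lebesgue_measure R (J (complex.Im z0s)))%E.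
    exact: product_measure1E.
  by apply: mule_gt0; exact: J0.
have [mS] := @mu_pow_prod_gt0 _ _ R (@plane_lebesgue R) n A mA A0.
set S := [set t | _] => S0.
have fae : ae_eq dv setT (EFin \o (fun t => f (toCn t))) (cst 0%E).
  apply/(ae_eq_integral_abs dv measurableT); first exact: measurable_int If.
  under eq_integral do rewrite /= ger0_norm//.
  rewrite -[LHS]fineK; last exact: (integrable_fin_num _ If).
  by rewrite -[fine _]/(\int[dv]_t f (toCn t)) -I0.
have JP x y : J x y -> `|y - x| < r / 2 /\ y != 0.
  rewrite /J; case: ifPn => x0; rewrite /= in_itv /= => /andP[h1 h2].
    by split; [rewrite ltr_norml; lra|rewrite gt_eqF//; lra].
  by rewrite -ltNge in x0; split; [rewrite ltr_norml; lra|rewrite lt_eqF//; lra].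
have SP t : S t -> 0 < f (toCn t).
  move=> St; apply: fpos.
    move=> s; have [/JP[h1 _] /JP[h2 _]] := St s; rewrite mxE.
    rewrite (le_lt_trans (normc_le _))// [ltRHS]splitr.
    by case: (z0 0 s) h1 h2 => p q /= h1 h2; exact: ltrD.
  apply/eqP => /rowP /(_ (Ordinal n_gt0)); have [/JP[_ h] _] := St (Ordinal n_gt0).
  by rewrite !mxE => -[/eqP]; rewrite (negbTE h).
have : dv S = 0.
  have [N [mN N0 NS]] := fae.
  apply/eqP; rewrite eq_le measure_ge0 andbT -N0 le_measure ?inE// => t /SP ft.
  by apply: NS => /= /(_ I) [] /eqP; rewrite gt_eqF.
by move=> dS; move: S0; rewrite [ltRHS](_ : _ = dv S)// dS ltxx.
Qed.

Lemma gauss_mass_gt0 : 0 < gauss_mass R n.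
Proof.
apply: (@integral_gt0 _ 0 1) => //; [by move=> z; exact: expR_ge0|exact: integrable_gauss|].
by move=> z _ _; exact: expR_gt0.
Qed.

Lemma weight_gt0 z : z != 0 -> 0 < w z.
Proof.
move=> z0; rewrite weightE; apply: mulr_gt0; first exact: omega_gt0.
apply: mulr_gt0; last exact: expR_gt0.
rewrite exprn_gt0//; have [s zs] : exists s, z 0 s != 0.
  apply: contrapT => /forallNP H; move/eqP: z0; apply; apply/rowP => s; rewrite mxE.
  by have /negP := H s; rewrite negbK => /eqP.
apply: lt_le_trans (nc_le_cnorm z s).
by rewrite lt_neqAle normc_ge0 andbT eq_sym; apply/eqP => /Normc.eq0_normc/eqP; rewrite (negbTE zs).
Qed.

Lemma fock_null f : fock_sobolev m f -> inner m f f = 0 -> f = fun=> 0.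
Proof.
move=> [ef /L2P[mf If]] f0; apply/funext => z0; apply: contrapT => /eqP fz0.
have nf0 : 0 < nc (f z0).
  by rewrite lt_neqAle normc_ge0 andbT eq_sym; apply/eqP => /Normc.eq0_normc/eqP; rewrite (negbTE fz0).
have [d d0 dP] := entire_continuous_normc ef z0 nf0.
have : 0 < \int[dv]_t (nc (f (toCn t)) ^+ 2 * w (toCn t)).
  apply: (@integral_gt0 (fun z => nc (f z) ^+ 2 * w z) z0 d) => //.
    by move=> z; apply: mulr_ge0; [exact: sqr_ge0|exact: weight_ge0].
  move=> z /dP zd z_neq0; apply: mulr_gt0; last exact: weight_gt0.
  rewrite exprn_gt0// lt_neqAle normc_ge0 andbT eq_sym; apply/eqP => /Normc.eq0_normc fz.
  by move: zd; rewrite fz sub0r normcN ltxx.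
by rewrite -Re_inner_self f0 ltxx.
Qed.

(** [proj] selects some projection; projections of the same function differ by
    an element of the Fock-Sobolev space which is orthogonal to itself. *)
Lemma proj_eq u p : L2 m u -> is_projection m u p -> Defs.proj m u = p.
Proof.
move=> Lu hp; rewrite /Defs.proj; case: xgetP => [q _ hq|/(_ p)//].
have [fp ip] := hp; have [fq iq] := hq.
have fd := fockB fq fp; have [_ Lp] := fp; have [_ Lq] := fq; have [_ Ld] := fd.
have : inner m (fun z => q z - p z) (fun z => q z - p z) = 0.
  have := ip _ fd; have := iq _ fd; rewrite !innerB// => h1 h2.
  by move/eqP: h1; move/eqP: h2; rewrite !subr_eq0 => /eqP <- /eqP <-; rewrite subrr.
by move=> /(fock_null fd) d0; apply/funext => z; apply/eqP; rewrite -subr_eq0; rewrite (congr1 (@^~ z) d0).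
Qed.

Lemma proj_poly (I : finType) (a : I -> C) (B D : I -> 'I_n -> nat) :
  Defs.proj m (fun z => \sum_i a i * mono (B i) (D i) z) =
  (fun z => \sum_i a i * (toeplitz_coef (B i) (D i))%:C%C * mono (fun s => B i s - D i s)%N exp0 z).
Proof.
apply: proj_eq; last exact: is_projection_poly.
by apply: L2_sum => i; apply: L2Z; exact: L2_mono.
Qed.

Lemma norm2_proj_le u : L2 m u -> norm2 m (Defs.proj m u) <= norm2 m u.
Proof.
move=> Lu; rewrite /Defs.proj; case: xgetP => [p _ [fp ip]|_]; last first.
  have -> : norm2 m (fun _ : Cn => 0) = 0; last exact: sqrtr_ge0.
  apply/eqP; rewrite -sqrf_eq0 norm2_sqr; apply/eqP.
  rewrite -[RHS](mul0r (fine (dv setT))) -Rintegral_cst//; apply: eq_Rintegral => t _.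
  by rewrite Normc.normc0 expr0n mul0r.
have Lp : L2 m p by case: fp.
have E : inner m u p = inner m p p.
  by have := ip _ fp; rewrite innerB// => /eqP; rewrite subr_eq0 => /eqP.
have := Re_inner_le Lu Lp; rewrite E Re_inner_self -norm2_sqr.
rewrite ger0_norm ?sqr_ge0// expr2.
have : 0 <= norm2 m p by exact: sqrtr_ge0.
rewrite le_eqVlt => /predU1P[<- _|p0]; first exact: sqrtr_ge0.
by rewrite ler_pM2r.
Qed.

End Projection.

(** * Orders of growth *)

Section Asymptotics.
Variable R : realType.
Implicit Types (u v : nat -> R).

(** If [l] is not 0, u(t) is equivalent to l t^k; the successor avoids division
    by zero. *)
Definition growth u k (l : R) := (fun t => u t / t.+1%:R ^+ k) @ \oo --> l.

Lemma growthM u v k k' l l' : growth u k l -> growth v k' l' ->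
  growth (fun t => u t * v t) (k + k') (l * l').
Proof.
move=> hu hv; rewrite /growth.
rewrite (_ : (fun t => _) = (fun t => (u t / t.+1%:R ^+ k) * (v t / t.+1%:R ^+ k'))).
  exact: cvgM.
by apply/funext => t; rewrite exprD invfM mulrACA.
Qed.

Lemma growthD u v k l l' : growth u k l -> growth v k l' -> growth (fun t => u t + v t) k (l + l').
Proof.
move=> hu hv; rewrite /growth; under eq_fun do rewrite mulrDl; exact: cvgD.
Qed.

Lemma growth_cst (c : R) : growth (fun=> c) 0 c.
Proof. by rewrite /growth; under eq_fun do rewrite expr0 divr1; exact: cvg_cst. Qed.

Lemma growthV u k l k' v l' : (forall t, 0 < v t) -> l' != 0 ->
  growth u (k + k') l -> growth v k' l' -> growth (fun t => u t / v t) k (l / l').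
Proof.
move=> v0 l0 hu hv; rewrite /growth.
rewrite (_ : (fun t => _) = (fun t => (u t / t.+1%:R ^+ (k + k')) / (v t / t.+1%:R ^+ k'))).
  by apply: cvgM => //; exact: cvgV.
apply/funext => t; rewrite exprD; field.
by rewrite !expf_neq0 ?pnatr_eq0//= gt_eqF.
Qed.

Lemma growth_lower u k k' l : (k < k')%N -> growth u k l -> growth u k' 0.
Proof.
move=> kk hu; rewrite /growth -(subnKC kk).
rewrite (_ : (fun t => _) = (fun t => (u t / t.+1%:R ^+ k) *
   (t.+1%:R^-1 * t.+1%:R^-1 ^+ (k' - k.+1)))).
  rewrite -(mulr0 l); apply: cvgM => //.
  rewrite -(mul0r (0 ^+ (k' - k.+1))); apply: cvgM; first exact: cvg_harmonic.
  have := @cvg_harmonic R; move=> /(cvg_comp _ (fun x => x ^+ (k' - k.+1))); apply.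
  exact: exprn_continuous.
apply/funext => t; rewrite exprD exprS exprVn !invfM; ring.
Qed.

Lemma growth_near u v l (K : R) : (forall t, `|u t - v t| <= K) -> growth u 1 l -> growth v 1 l.
Proof.
move=> uvK hu.
have h0 : growth (fun t => v t - u t) 1 0.
  rewrite /growth; apply: (@squeeze_cvgr _ _ _ _ (fun t => - K / t.+1%:R) (fun t => K / t.+1%:R)).
  - apply: nearW => t; rewrite expr1 !ler_pM2r ?invr_gt0 ?ltr0n//.
    by have := uvK t; rewrite distrC ler_norml.
  - rewrite -(mulr0 (- K)); apply: cvgM; [exact: cvg_cst|exact: cvg_harmonic].
  - rewrite -(mulr0 K); apply: cvgM; [exact: cvg_cst|exact: cvg_harmonic].
rewrite -[l]addr0; have := growthD hu h0.
by rewrite /growth; under eq_fun do rewrite addrC subrK.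
Qed.

Lemma growth_prod (I : Type) (r : seq I) (u : I -> nat -> R) (k : I -> nat) (l : I -> R) :
  (forall i, growth (u i) (k i) (l i)) ->
  growth (fun t => \prod_(i <- r) u i t) (\sum_(i <- r) k i) (\prod_(i <- r) l i).
Proof.
move=> hu; elim: r => [|i r IH].
  by rewrite !big_nil; under eq_fun do rewrite big_nil; exact: growth_cst.
by rewrite !big_cons; under eq_fun do rewrite big_cons; exact: growthM.
Qed.

Lemma growth_sum (I : Type) (r : seq I) (u : I -> nat -> R) k (l : I -> R) :
  (forall i, growth (u i) k (l i)) ->
  growth (fun t => \sum_(i <- r) u i t) k (\sum_(i <- r) l i).
Proof.
move=> hu; elim: r => [|i r IH].
  rewrite !big_nil; under eq_fun do rewrite big_nil.
  by rewrite /growth; under eq_fun do rewrite mul0r; exact: cvg_cst.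
by rewrite !big_cons; under eq_fun do rewrite big_cons; exact: growthD.
Qed.

Variable n : nat.
Hypothesis n_gt0 : (0 < n)%N.
Implicit Types (x : nat -> 'I_n -> nat) (b c : 'I_n -> nat).

Definition balanced x := forall s, growth (fun t => (x t s)%:R) 1 1.

Lemma balanced_diag (k : nat) : balanced (fun t _ => (t.+1 + k)%N).
Proof.
move=> s; apply: (@growth_near (fun t => t.+1%:R) _ _ k%:R).
  by move=> t; rewrite natrD opprD addNKr normrN normr_nat.
rewrite /growth; under eq_fun do rewrite expr1 divff ?pnatr_eq0//.
exact: cvg_cst.
Qed.

Lemma balancedD x b : balanced x -> balanced (fun t s => x t s + b s)%N.
Proof.
move=> bx s; apply: (@growth_near _ _ _ (b s)%:R _ (bx s)) => t.
by rewrite natrD opprD addNKr normrN normr_nat.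
Qed.

Lemma balancedB x b : balanced x -> balanced (fun t s => x t s - b s)%N.
Proof.
move=> bx s; apply: (@growth_near _ _ _ (b s)%:R _ (bx s)) => t.
have [xb|/ltnW bx'] := leqP (x t s) (b s).
  move: (xb); rewrite /leq => /eqP ->.
  by rewrite subr0 normr_nat ler_nat.
by rewrite natrB// opprB addrCA subrr addr0 normr_nat.
Qed.

Lemma growth_fallfact x c : balanced x ->
  growth (fun t => (fallfact (x t) c)%:R) (\sum_s c s) 1.
Proof.
move=> bx; rewrite [X in growth _ _ X](_ : 1 = \prod_(s : 'I_n) 1); last by rewrite big1.
have -> : (fun t => (fallfact (x t) c)%:R : R) = (fun t => \prod_s ((x t s) ^_ (c s))%:R).
  by apply/funext => t; rewrite /fallfact natr_prod.
apply: (@growth_prod _ _ (fun s t => ((x t s) ^_ (c s))%:R)) => s.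
elim: (c s) => [|k IH].
  by under eq_fun do rewrite ffactn0; exact: growth_cst.
have -> : (fun t => (x t s ^_ k.+1)%:R : R) = (fun t => (x t s ^_ k)%:R * (x t s - k)%:R).
  by apply/funext => t; rewrite ffactnSr natrM.
rewrite -[k.+1]addn1 -[X in growth _ _ X]mulr1; apply: growthM => //.
exact: (@balancedB x (fun=> k) bx s).
Qed.

Lemma growth_rising x m : balanced x ->
  growth (fun t => (rising n m (\sum_s x t s))%:R) m (n%:R ^+ m).
Proof.
move=> bx.
have -> : (fun t => (rising n m (\sum_s x t s))%:R : R) =
    (fun t => \prod_(i < m) (\sum_s x t s + n + i)%N%:R).
  by apply/funext => t; rewrite /rising natr_prod.
have -> : n%:R ^+ m = \prod_(i < m) (n%:R : R) by rewrite prodr_const card_ord.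
rewrite -[X in growth _ X](_ : (\sum_(i < m) 1)%N = _); last by rewrite sum_nat_const card_ord muln1.
apply: (@growth_prod _ _ (fun (i : 'I_m) t => (\sum_s x t s + n + i)%N%:R)) => i.
apply: (@growth_near (fun t => \sum_s (x t s)%:R) _ _ (n + i)%:R).
  by move=> t; rewrite -addnA natrD natr_sum opprD addNKr normrN normr_nat.
have -> : n%:R = \sum_(s < n) (1 : R) by rewrite sumr_const card_ord.
by apply: growth_sum => s; exact: bx.
Qed.

(** The falling factorial has order |c|, and the two rising factorials, taken
    at arguments with a bounded difference, have the same order. *)
Lemma growth_toeplitz_coef m x c : balanced x ->
  growth (fun t => toeplitz_coef R m (x t) c) (\sum_s c s) 1.
Proof.
move=> bx; have nm : n%:R ^+ m != 0 :> R by rewrite expf_neq0// pnatr_eq0 -lt0n.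
rewrite -[X in growth _ _ X](divff nm); rewrite /toeplitz_coef.
apply: (growthV (k' := m) (v := fun t => (rising n m (\sum_s (x t s - c s)%N)%N)%:R) _ nm).
- by move=> t; rewrite ltr0n rising_gt0.
- by rewrite -[X in growth _ _ X]mul1r; under eq_fun do rewrite natrM;
    apply: growthM; [exact: growth_fallfact|exact: growth_rising].
- exact: (growth_rising (balancedB c bx)).
Qed.

End Asymptotics.

(** * Matrix entries and the dominant term *)

Section MatrixEntries.
Variables (R : realType) (n m : nat).
Hypothesis n_gt0 : (0 < n)%N.
Local Notation C := R[i].
Local Notation nc := (@Normc.normc R).
Local Notation Cn := 'rV[C]_n.
Local Notation exp0 := ((fun=> 0%N) : 'I_n -> nat).
Implicit Types (b c : 'I_n -> nat) (z : Cn).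

Lemma monoM b c b' c' z :
  mono b c z * mono b' c' z = mono (fun s => b s + b' s)%N (fun s => c s + c' s)%N z.
Proof.
rewrite /mono -big_split /=; apply: eq_bigr => s _; rewrite !exprD; ring.
Qed.

Lemma mono_conj b c z : (mono b c z)^*%C = mono c b z.
Proof.
by rewrite /mono conjc_prod; apply: eq_bigr => s _; rewrite conjcM !conjcX conjcK mulrC.
Qed.

Definition mono_norm b : R :=
  omega R n m * gauss_mass R n * (rising n m (\sum_s b s) * \prod_s (b s)`!)%:R.

Lemma mono_norm_gt0 b : 0 < mono_norm b.
Proof.
rewrite /mono_norm; apply: mulr_gt0.
  by apply: mulr_gt0; [exact: omega_gt0|exact: gauss_mass_gt0].
rewrite ltr0n muln_gt0 rising_gt0//=.
by apply: prodn_gt0 => s; exact: fact_gt0.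
Qed.

Lemma inner_mono_mono b c : inner m (mono b exp0 : Cn -> C) (mono c exp0) =
  if [forall s, b s == c s] then (mono_norm c)%:C%C else 0.
Proof.
rewrite inner_mono; last exact: fock_mono.
have -> : Cint (pairing 0 (fun s => b s - 0)%N exp0 (mono c exp0 : Cn -> C)) =
    Cint (pairing 0 b c (fun _ : Cn => 1)).
  apply: eq_Cint => z; rewrite /pairing conjc1 mulr1 mono_conj -mulrA monoM.
  by congr (_ * mono _ _ _); apply/funext => s; rewrite ?subn0 ?addn0.
rewrite Cint_mono_ortho; case: ifPn => [/forallP bc|_]; last by rewrite mulr0.
have -> : b = c by apply/funext => s; rewrite (eqP (bc s)).
have -> : fallfact c exp0 = 1%N by rewrite /fallfact big1.
rewrite mul1n /mono_norm -(rmorph_nat (real_complex R)) -!rmorphM natrM.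
by congr (_%:C%C); ring.
Qed.

Lemma norm2_mono b : norm2 m (mono b exp0 : Cn -> C) ^+ 2 = mono_norm b.
Proof.
rewrite norm2_sqr -Re_inner_self inner_mono_mono ifT//.
by apply/forallP => s.
Qed.

Variables (I J : finType) (a : I -> C) (b : J -> C) (p q : I -> 'I_n -> nat)
  (p' q' : J -> 'I_n -> nat).

Let f z : C := \sum_i a i * mono (p i) (q i) z.
Let g z : C := \sum_j b j * mono (p' j) (q' j) z.

Let mid (x : 'I_n -> nat) i j s : nat := (x s + p' j s - q' j s + p i s)%N.

Let sigma (x : 'I_n -> nat) i j : R :=
  toeplitz_coef R m (fun s => x s + p' j s)%N (q' j) * toeplitz_coef R m (mid x i j) (q i).

Lemma toeplitz_product_mono x : toeplitz m f (toeplitz m g (mono x exp0)) =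
  (fun z => \sum_(ij : I * J) (a ij.1 * b ij.2 * (sigma x ij.1 ij.2)%:C%C) *
     mono (fun s => mid x ij.1 ij.2 s - q ij.1 s)%N exp0 z).
Proof.
have -> : toeplitz m g (mono x exp0) = (fun z => \sum_j b j *
   (toeplitz_coef R m (fun s => x s + p' j s)%N (q' j))%:C%C *
   mono (fun s => x s + p' j s - q' j s)%N exp0 z).
  rewrite /toeplitz -proj_poly//; congr (Defs.proj _ _); apply/funext => z.
  rewrite /g mulr_suml; apply: eq_bigr => j _; rewrite -mulrA mulrC [mono _ _ _ * _]mulrC monoM mulrC.
  by congr (_ * mono _ _ _); apply/funext => s; rewrite add0n.
transitivity (Defs.proj m (fun z => \sum_(ij : I * J) (a ij.1 * b ij.2 *
   (toeplitz_coef R m (fun s => x s + p' ij.2 s)%N (q' ij.2))%:C%C) *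
   mono (mid x ij.1 ij.2) (q ij.1) z)).
  rewrite /toeplitz; congr (Defs.proj _ _); apply/funext => z.
  rewrite /f big_distrlr pair_big /=; apply: eq_bigr => -[i j] _ /=.
  have -> : mono (mid x i j) (q i) z = mono (p i) (q i) z *
      mono (fun s => x s + p' j s - q' j s)%N exp0 z.
    rewrite monoM; congr (mono _ _ _); apply/funext => s; first by rewrite addnC.
    by rewrite addn0.
  by ring.
rewrite proj_poly//; apply/funext => z; apply: eq_bigr => -[i j] _ /=.
rewrite /sigma; move: (toeplitz_coef _ _ _ _) (toeplitz_coef _ _ _ _) => c1 c2.
by rewrite (rmorphM (real_complex R)) !mulrA.
Qed.

Hypothesis bounded : toeplitz_product_bounded m f g.

Lemma hol_poly_mono x : hol_poly (mono x exp0 : Cn -> C).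
Proof.
exists (mpoly.mpolyX C (mpoly.Multinom [tuple x s | s < n])) => z.
rewrite mpoly.mevalX /mono; apply: eq_bigr => s _.
by rewrite expr0 mulr1 mpoly.mnmE.
Qed.

(** Testing the product on z^x and pairing the result with z^y isolates the
    terms that map z^x to a multiple of z^y.  Squaring the inequality avoids
    the square roots of the norms. *)
Lemma entry_bound : exists2 M : R, 0 <= M & forall x y : 'I_n -> nat,
  nc (\sum_(ij : I * J | [forall s, (mid x ij.1 ij.2 s - q ij.1 s)%N == y s])
     a ij.1 * b ij.2 * (sigma x ij.1 ij.2)%:C%C) ^+ 2 * mono_norm y <= M * mono_norm x.
Proof.
have [M MP] := bounded; exists (4 * M ^+ 2); first by rewrite mulr_ge0 ?sqr_ge0.
move=> x y; set S := \sum_(_ | _) _.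
set T := toeplitz m f (toeplitz m g (mono x exp0)).
have LT : L2 m T.
  by rewrite /T toeplitz_product_mono; apply: L2_sum => ij; apply: L2Z; exact: L2_mono.
have TE : inner m T (mono y exp0) = S * (mono_norm y)%:C%C.
  rewrite /T toeplitz_product_mono inner_sum; last 2 first.
  - by move=> ij; apply: L2Z; exact: L2_mono.
  - exact: L2_mono.
  rewrite /S [in RHS]big_mkcond mulr_suml /=; apply: eq_bigr => ij _.
  rewrite innerZ; [|exact: L2_mono..].
  by rewrite inner_mono_mono; case: ifP => _; rewrite ?mulr0 ?mul0r.
have y0 := mono_norm_gt0 y.
have h1 : nc S * mono_norm y <= 2 * (norm2 m T * norm2 m (mono y exp0 : Cn -> C)).
  have := normc_inner_le LT (@L2_mono R n m y exp0).
  by rewrite TE Normc.normcM normc_real gtr0_norm.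
have h2 : norm2 m T <= M * norm2 m (mono x exp0 : Cn -> C) by exact: (MP _ (hol_poly_mono x)).
have T0 : 0 <= norm2 m T by exact: sqrtr_ge0.
have h3 : norm2 m T ^+ 2 <= M ^+ 2 * mono_norm x.
  by rewrite -norm2_mono -exprMn lerXn2r// nnegrE// (le_trans T0).
have h4 : (nc S * mono_norm y) ^+ 2 <= 4 * (norm2 m T ^+ 2 * mono_norm y).
  rewrite -[mono_norm y in leRHS]norm2_mono -exprMn (_ : 4 = 2 ^+ 2); last by ring.
  rewrite -exprMn lerXn2r// nnegrE; first by rewrite mulr_ge0 ?normc_ge0 ?ltW.
  by rewrite !mulr_ge0// sqrtr_ge0.
rewrite -(ler_pM2r y0) -[leLHS]mulrA -expr2 -exprMn (le_trans h4)//.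
have := ler_wpM2l (ler0n R 4) (ler_wpM2r (ltW y0) h3).
by rewrite [X in _ <= X -> _](_ : _ = 4 * M ^+ 2 * mono_norm x * mono_norm y); last by ring.
Qed.

Variables (i0 : I) (j0 : J).
Let B s : nat := (p' j0 s + p i0 s)%N.
Let G s : nat := (q' j0 s + q i0 s)%N.
(* The pairs of terms that contribute to the same matrix entries as
   [(i0, j0)], written without subtraction. *)
Let compat i j := [forall s, (p' j s + p i s + G s == B s + (q' j s + q i s))%N].

Hypothesis a0 : a i0 != 0.
Hypothesis b0 : b j0 != 0.
Hypothesis top : forall i j, a i != 0 -> b j != 0 -> compat i j ->
  (i, j) = (i0, j0) \/ (\sum_s (q' j s + q i s) < \sum_s G s)%N.

(** The entries from x = (t + H, ..., t + H) to y = x + B - G are compared for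
    large t.  By [top] the sum in [entry_bound] has the order |G| of its term
    [(i0, j0)], and the quotient of the squared norms of z^y and z^x has order
    |B| - |G|, which bounds 2|G| + |B| - |G| by 0. *)
Lemma top_term_constant : (\sum_s B s + \sum_s G s = 0)%N.
Proof.
apply/eqP; rewrite -leqn0 leqNgt; apply/negP => pos.
(* A shift that makes every truncated subtraction below an exact one. *)
pose H := (\sum_i \sum_s q i s + \sum_j \sum_s q' j s)%N.
have qH i j s : (q' j s + q i s <= H)%N.
  rewrite addnC /H leq_add//.
    by rewrite (bigD1 i)//= (bigD1 s)//= -addnA leq_addr.
  by rewrite (bigD1 j)//= (bigD1 s)//= -addnA leq_addr.
pose x (t : nat) (s : 'I_n) : nat := (t.+1 + H)%N.
pose y t s := (x t s + B s - G s)%N.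
have bx : balanced R x by exact: balanced_diag.
have compatE t i j : [forall s, (mid (x t) i j s - q i s)%N == y t s] = compat i j.
  apply: eq_forallb => s; rewrite /mid /y /x; have := qH i j s; have := qH i0 j0 s.
  rewrite -/(G s); move: (B s) (G s) (p' j s) (q' j s) (p i s) (q i s) => *.
  by apply/eqP/eqP; lia.
have [M M0 MP] := entry_bound.
pose cf i j := a i * b j.
pose S t := \sum_(ij : I * J | compat ij.1 ij.2) cf ij.1 ij.2 * (sigma (x t) ij.1 ij.2)%:C%C.
have compare t : nc (S t) ^+ 2 * ((rising n m (\sum_s y t s))%:R *
     (fallfact (fun s => x t s + B s)%N B)%:R) <=
   M * ((rising n m (\sum_s x t s))%:R * (fallfact (fun s => x t s + B s)%N G)%:R).
  have := MP (x t) (y t); rewrite (eq_bigl _ _ (fun ij => compatE t ij.1 ij.2)) -/(S t).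
  have fx : (fallfact (fun s => x t s + B s) B * \prod_s (x t s)`! = \prod_s (x t s + B s)`!)%N.
    rewrite /fallfact -big_split; apply: eq_bigr => s _ /=.
    by have := ffact_fact (leq_addl (x t s) (B s)); rewrite addnK.
  have fy : (fallfact (fun s => x t s + B s) G * \prod_s (y t s)`! = \prod_s (x t s + B s)`!)%N.
    rewrite /fallfact -big_split; apply: eq_bigr => s _ /=; apply: ffact_fact.
    by rewrite (leq_trans (qH i0 j0 s))// -addnA (leq_trans _ (leq_addl _ _)) ?leq_addr.
  rewrite /mono_norm !natrM.
  have P0 : 0 < (\prod_s (x t s + B s)`!)%N%:R :> R.
    by rewrite ltr0n; apply: prodn_gt0 => s; exact: fact_gt0.
  have k0 : 0 < omega R n m * gauss_mass R n.
    by apply: mulr_gt0; [exact: omega_gt0|exact: gauss_mass_gt0].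
  move: fx fy => /(congr1 (fun k => k%:R : R)) + /(congr1 (fun k => k%:R : R)).
  have X0 : 0 < (\prod_s (x t s)`!)%N%:R :> R by rewrite ltr0n; apply: prodn_gt0 => s; exact: fact_gt0.
  have Y0 : 0 < (\prod_s (y t s)`!)%N%:R :> R by rewrite ltr0n; apply: prodn_gt0 => s; exact: fact_gt0.
  rewrite !natrM; move: (omega R n m * gauss_mass R n) k0 P0 X0 Y0 (nc (S t) ^+ 2).
  move: ((\prod_s (x t s + B s)`!)%N%:R) ((\prod_s (x t s)`!)%N%:R) ((\prod_s (y t s)`!)%N%:R).
  move: ((fallfact _ _)%:R) ((fallfact _ _)%:R) ((rising _ _ _)%:R) ((rising _ _ _)%:R).
  move=> fG fB rx ry F X Y K K0 F0 X0 Y0 N hX hY h.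
  have fB0 : 0 < fB by rewrite -(pmulr_lgt0 _ X0) hX.
  have fG0 : 0 < fG by rewrite -(pmulr_lgt0 _ Y0) hY.
  have := ler_wpM2r (ltW (mulr_gt0 fB0 fG0)) h.
  have -> : N * (K * (ry * Y)) * (fB * fG) = N * (ry * fB) * (K * F) by rewrite -hY; ring.
  have -> : M * (K * (rx * X)) * (fB * fG) = M * (rx * fG) * (K * F) by rewrite -hX; ring.
  by rewrite ler_pM2r// mulr_gt0.
pose Q := (\sum_s G s)%N.
have sigma_growth i j : growth (fun t => sigma (x t) i j) (\sum_s (q' j s + q i s)) 1.
  rewrite big_split /= -(mulr1 1); apply: growthM.
    exact: (growth_toeplitz_coef n_gt0 m (q' j) (balancedD (p' j) bx)).
  exact: (growth_toeplitz_coef n_gt0 m (q i) (balancedD (p i) (balancedB (q' j) (balancedD (p' j) bx)))).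
(* The sum is complex; its real and imaginary parts are treated alike. *)
have part (r : C -> R) (rE : r = @complex.Re R \/ r = @complex.Im R) :
    growth (fun t => r (S t)) Q (r (cf i0 j0)).
  have rD : {morph r : u v / u + v} by case: rE => -> [? ?] [? ?].
  have r0 : r 0 = 0 by case: rE => ->.
  have rZ u (v : R) : r (u * v%:C%C) = r u * v by case: rE => ->; case: u => ? ? /=; ring.
  have -> : (fun t => r (S t)) = (fun t => \sum_(ij : I * J)
      (if compat ij.1 ij.2 then r (cf ij.1 ij.2) * sigma (x t) ij.1 ij.2 else 0)).
    apply/funext => t; rewrite /S (big_morph r rD r0) big_mkcond /=.
    by apply: eq_bigr => ij _; rewrite rZ.
  have -> : r (cf i0 j0) = \sum_(ij : I * J)
      (if (ij.1 == i0) && (ij.2 == j0) then r (cf ij.1 ij.2) else 0).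
    by rewrite -big_mkcond (big_pred1 (i0, j0))// => -[i j]; rewrite /= xpair_eqE.
  apply: growth_sum => -[i j] /=.
  have growth0 : growth (fun=> 0 : R) Q 0.
    by rewrite /growth; under eq_fun do rewrite mul0r; exact: cvg_cst.
  case: (boolP (compat i j)) => [ij|nij]; last first.
    rewrite (_ : (i == i0) && (j == j0) = false)//; apply: contraNF nij => /andP[/eqP-> /eqP->].
    by apply/forallP => s; apply/eqP; rewrite /B /G; lia.
  have [ai|an] := eqVneq (a i) 0.
    by rewrite /cf ai mul0r r0; under eq_fun do rewrite mul0r; case: ifP.
  have [bj|bn] := eqVneq (b j) 0.
    by rewrite /cf bj mulr0 r0; under eq_fun do rewrite mul0r; case: ifP.
  have [[-> ->]|lt] := top an bn ij.
    rewrite !eqxx /= -[Q]add0n -[X in growth _ _ X]mulr1; apply: growthM; first exact: growth_cst.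
    have := sigma_growth i0 j0; congr (growth _ _ _).
  have -> : (i == i0) && (j == j0) = false.
    by apply/andP => -[/eqP ii /eqP jj]; move: lt; rewrite ii jj ltnn.
  apply: (growth_lower lt); rewrite -[X in growth _ X]add0n; apply: growthM (sigma_growth i j).
  exact: growth_cst.
have nS : growth (fun t => nc (S t) ^+ 2) (Q + Q) (nc (cf i0 j0) ^+ 2).
  have -> : (fun t => nc (S t) ^+ 2) = (fun t => complex.Re (S t) * complex.Re (S t) +
     complex.Im (S t) * complex.Im (S t)) by apply/funext => t; rewrite sqr_normcE !expr2.
  rewrite sqr_normcE !expr2; apply: growthD; apply: growthM; apply: part; by [left|right].
have ry : growth (fun t => (rising n m (\sum_s y t s))%:R) m (n%:R ^+ m : R).
  exact: (growth_rising (balancedB G (balancedD B bx))).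
have rx : growth (fun t => (rising n m (\sum_s x t s))%:R) m (n%:R ^+ m : R).
  exact: (growth_rising bx).
have fB := @growth_fallfact R n _ B (balancedD B bx).
have fG := @growth_fallfact R n _ G (balancedD B bx).
have L := growthM nS (growthM ry fB).
have U := growthM (@growth_cst R M) (growthM rx fG).
have lt : (0 + (m + \sum_s G s) < Q + Q + (m + \sum_s B s))%N by move: pos; rewrite /Q; lia.
have U' := growth_lower lt U.
have : nc (cf i0 j0) ^+ 2 * (n%:R ^+ m * 1) <= 0.
  apply: (ler_cvg_to L U'); apply: nearW => t.
  by rewrite ler_pM2r ?invr_gt0 ?exprn_gt0 ?ltr0n//; exact: compare.
apply/negP; rewrite -ltNge mulr1; apply: mulr_gt0; last by rewrite exprn_gt0 ?ltr0n.
rewrite exprn_gt0// lt_neqAle normc_ge0 andbT eq_sym; apply/eqP => /Normc.eq0_normc/eqP.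
by rewrite mulf_eq0 (negbTE a0) (negbTE b0).
Qed.

End MatrixEntries.

(** * Product polynomials and the theorem *)

Section ProductPolynomials.
Variables (R : realType) (n : nat).
Local Notation C := R[i].
Local Notation Cn := 'rV[C]_n.

Definition prod_poly K (a : 'I_n -> 'I_K * 'I_K -> C) (z : Cn) : C :=
  \prod_s \sum_p a s p * (z 0 s ^+ p.1 * ((z 0 s)^*)%C ^+ p.2).

(** A common bound [K] on all the exponents makes the index set of the terms
    the same for both symbols and all variables. *)
Lemma class_P_prod_poly (f : Cn -> C) : class_P f -> exists K0, forall K, (K0 <= K)%N ->
  exists a : 'I_n -> 'I_K * 'I_K -> C, forall z, f z = prod_poly a z.
Proof.
move=> [k [l [a fE]]]; exists (\sum_s ((k s).+1 + (l s).+1))%N => K K0K.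
exists (fun s (p : 'I_K * 'I_K) => if (p.1 < (k s).+1)%N && (p.2 < (l s).+1)%N then a p.1 p.2 s else 0) => z.
rewrite fE; apply: eq_bigr => s _.
have kK : ((k s).+1 <= K)%N.
  by apply: leq_trans K0K; rewrite (bigD1 s)//= -addnA leq_addr.
have lK : ((l s).+1 <= K)%N.
  by apply: leq_trans K0K; rewrite (bigD1 s)//= addnAC leq_addl.
rewrite (big_ord_widen K (fun b => \sum_(c < (l s).+1) a b c s * z 0 s ^+ b * ((z 0 s)^*)%C ^+ c) kK).
under eq_bigr do rewrite (big_ord_widen K (fun c => a _ c s * z 0 s ^+ _ * ((z 0 s)^*)%C ^+ c) lK).
rewrite pair_big_dep /= big_mkcond /=; apply: eq_bigr => -[b c] _ /=.
by case: ifP => _; rewrite ?mul0r// mulrA.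
Qed.

Lemma prod_poly_expand K (a : 'I_n -> 'I_K * 'I_K -> C) z :
  prod_poly a z = \sum_(phi : {ffun 'I_n -> 'I_K * 'I_K})
    (\prod_s a s (phi s)) * mono (fun s => (phi s).1 : nat) (fun s => (phi s).2 : nat) z.
Proof.
rewrite /prod_poly bigA_distr_bigA; apply: eq_bigr => phi _.
by rewrite big_split.
Qed.

Lemma prod_poly_support K (a : 'I_n -> 'I_K * 'I_K -> C) z : prod_poly a z != 0 ->
  forall s, exists p, a s p != 0.
Proof.
move=> nz s; apply: contrapT => /forallNP H; move/prodf_neq0: nz => /(_ s isT).
apply/negP; rewrite negbK big1// => p _.
by have /negP := H p; rewrite negbK => /eqP ->; rewrite mul0r.
Qed.

(** Ordering by this integer means ordering by b - c first, in the direction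
    given by the sign of [w], and then by c, when [w] is at least [K] in
    absolute value. *)
Definition corner_key K (w : int) (p : 'I_K * 'I_K) : int :=
  w * ((p.1 : nat)%:Z - (p.2 : nat)%:Z) + (p.2 : nat)%:Z.

Definition dominant K (w : int) (a : 'I_n -> 'I_K * 'I_K -> C)
    (phi : {ffun 'I_n -> 'I_K * 'I_K}) :=
  forall s, a s (phi s) != 0 /\ forall p, a s p != 0 -> corner_key w p <= corner_key w (phi s).

Lemma exists_dominant K w (a : 'I_n -> 'I_K * 'I_K -> C) :
  (forall s, exists p, a s p != 0) -> exists phi, dominant w a phi.
Proof.
move=> supp.
have H s : exists p, a s p != 0 /\ forall p', a s p' != 0 -> corner_key w p' <= corner_key w p.
  have [p0 p0P] := supp s.
  case: (@Order.TotalTheory.arg_maxP _ _ _ p0 (fun p => a s p != 0) (corner_key w) p0P) => p pP pmax.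
  by exists p; split => // p' /pmax.
have [phi phiP] := choice H.
by exists [ffun s => phi s] => s; rewrite ffunE.
Qed.

Lemma corner_key_inj K (w : int) (p p' : 'I_K * 'I_K) : `|w|%N = K -> corner_key w p = corner_key w p' -> p = p'.
Proof.
case: p => -[b hb] [c hc]; case: p' => -[b' hb'] [c' hc'].
rewrite /corner_key /= => wK E.
have bb : b = b' /\ c = c'.
  have [d | d] : (b%:Z - c%:Z = b'%:Z - c'%:Z) \/ (b%:Z - c%:Z <> b'%:Z - c'%:Z) by lia.
    by rewrite d in E; split; lia.
  exfalso; have : w * ((b%:Z - c%:Z) - (b'%:Z - c'%:Z)) = c'%:Z - c%:Z by rewrite mulrBr; lia.
  by move: ((b%:Z - c%:Z) - (b'%:Z - c'%:Z)) (erefl ((b%:Z - c%:Z) - (b'%:Z - c'%:Z))) => D DE; nia.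
by case: bb => bb cc; subst b' c'; congr pair; apply: val_inj.
Qed.

(** Compatible pairs of terms have the same total of b - c, so that the
    multiples of [w] cancel from the sum of the two maximality conditions. *)
Lemma corner_key_sum (w : int) (b1 c1 b2 c2 b1' c1' b2' c2' : nat) :
  (b2 + b1 + (c2' + c1') = b2' + b1' + (c2 + c1))%N ->
  w * (b1%:Z - c1%:Z) + c1%:Z <= w * (b1'%:Z - c1'%:Z) + c1'%:Z ->
  w * (b2%:Z - c2%:Z) + c2%:Z <= w * (b2'%:Z - c2'%:Z) + c2'%:Z ->
  (c2 + c1 <= c2' + c1')%N /\
  ((c2 + c1 = c2' + c1')%N ->
    w * (b1%:Z - c1%:Z) + c1%:Z = w * (b1'%:Z - c1'%:Z) + c1'%:Z /\
    w * (b2%:Z - c2%:Z) + c2%:Z = w * (b2'%:Z - c2'%:Z) + c2'%:Z).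
Proof.
move=> compat.
have : w * (b1%:Z - c1%:Z) + w * (b2%:Z - c2%:Z) =
    w * (b1'%:Z - c1'%:Z) + w * (b2'%:Z - c2'%:Z).
  by rewrite -!mulrDr; congr (_ * _); lia.
move: (w * (b1%:Z - c1%:Z)) (w * (b2%:Z - c2%:Z)) (w * (b1'%:Z - c1'%:Z)) (w * (b2'%:Z - c2'%:Z)).
by move=> x1 x2 x1' x2' E h1 h2; split; lia.
Qed.

Variable m : nat.
Hypothesis n_gt0 : (0 < n)%N.

(** A compatible pair of terms whose conjugate exponents have the same total
    as those of the dominant pair agrees with it in every variable, because
    the keys agree and determine the terms; this is the uniqueness that
    [top_term_constant] asks for. *)
Lemma dominant_trivial K (w : int) (a b : 'I_n -> 'I_K * 'I_K -> C) phi psi :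
  `|w|%N = K -> toeplitz_product_bounded m (prod_poly a) (prod_poly b) ->
  dominant w a phi -> dominant w b psi ->
  forall s, corner_key w (phi s) = 0 /\ corner_key w (psi s) = 0.
Proof.
move=> wK bd da db.
rewrite (funext (prod_poly_expand a)) (funext (prod_poly_expand b)) in bd.
have a0 : \prod_s a s (phi s) != 0 by apply/prodf_neq0 => s _; case: (da s).
have b0 : \prod_s b s (psi s) != 0 by apply/prodf_neq0 => s _; case: (db s).
have T : (\sum_s ((psi s).1 + (phi s).1) + \sum_s ((psi s).2 + (phi s).2) = 0)%N.
  apply: (top_term_constant n_gt0 bd a0 b0) => u v u0 v0 /forallP compat.
  have local s : ((v s).2 + (u s).2 <= (psi s).2 + (phi s).2)%N /\
      (((v s).2 + (u s).2 = (psi s).2 + (phi s).2)%N -> u s = phi s /\ v s = psi s).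
    have us : a s (u s) != 0 by move/prodf_neq0: u0 => /(_ s isT).
    have vs : b s (v s) != 0 by move/prodf_neq0: v0 => /(_ s isT).
    have [_ /(_ _ us) ku] := da s; have [_ /(_ _ vs) kv] := db s.
    have [le eq2] := corner_key_sum (eqP (compat s)) ku kv; split=> // /eq2[h1 h2].
    by split; [exact: (corner_key_inj wK h1)|exact: (corner_key_inj wK h2)].
  have [/forallP eq2|] := boolP [forall s, (v s).2 + (u s).2 == (psi s).2 + (phi s).2]%N.
    left; congr pair; apply/ffunP => s; have [_ /(_ (eqP (eq2 s)))[]] := local s => //.
  rewrite negb_forall => /existsP[s neq]; right.
  rewrite (bigD1 s)//= [X in (_ < X)%N](bigD1 s)//= -addSn leq_add//.
    by rewrite ltn_neqAle neq; case: (local s).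
  by apply: leq_sum => s' _; case: (local s').
move=> s; move: T; rewrite (bigD1 s)//= [X in (_ + X)%N](bigD1 s)//= => T.
have [h1 h2 h3 h4] : [/\ (phi s).1 = 0%N :> nat, (phi s).2 = 0%N :> nat,
  (psi s).1 = 0%N :> nat & (psi s).2 = 0%N :> nat] by split; lia.
by rewrite /corner_key h1 h2 h3 h4 subrr mulr0 addr0.
Qed.

(** Adding the conditions K (b - c) + c <= 0 and - K (b - c) + c <= 0 gives
    c = 0, and then b = 0. *)
Lemma dominant_trivial_constant K (a : 'I_n -> 'I_K * 'I_K -> C) phi phi' :
  dominant K%:Z a phi -> dominant (- K%:Z) a phi' ->
  (forall s, corner_key K%:Z (phi s) = 0 /\ corner_key (- K%:Z) (phi' s) = 0) ->
  exists c, forall z, prod_poly a z = c.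
Proof.
move=> d d' k0.
exists (\prod_s \sum_p a s p) => z; apply: eq_bigr => s _; apply: eq_bigr => p _.
have [->|ap] := eqVneq (a s p) 0; first by rewrite mul0r.
have [h h'] := k0 s; have [_ /(_ _ ap)] := d s; have [_ /(_ _ ap)] := d' s.
have trivial (x y : nat) : (y < K)%N -> K%:Z * (x%:Z - y%:Z) + y%:Z <= 0 ->
    - K%:Z * (x%:Z - y%:Z) + y%:Z <= 0 -> x = 0%N /\ y = 0%N.
  move=> yK; rewrite mulNr => e1 e2.
  have y0 : y = 0%N by move: (K%:Z * (x%:Z - y%:Z)) e1 e2 => D; lia.
  by subst y; split=> //; nia.
rewrite h h' /corner_key => h2 h1; have [-> ->] := trivial _ _ (ltn_ord p.2) h1 h2.
by rewrite !expr0 !mulr1.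
Qed.

Lemma bounded_prod_poly_constant K (a b : 'I_n -> 'I_K * 'I_K -> C) :
  (exists z, prod_poly a z <> 0) -> (exists z, prod_poly b z <> 0) ->
  toeplitz_product_bounded m (prod_poly a) (prod_poly b) ->
  (exists c, forall z, prod_poly a z = c) /\ (exists c, forall z, prod_poly b z = c).
Proof.
move=> [za /eqP a0] [zb /eqP b0] bd.
have sa := prod_poly_support a0; have sb := prod_poly_support b0.
have [phi hphi] := exists_dominant K%:Z sa; have [phi' hphi'] := exists_dominant (- K%:Z) sa.
have [psi hpsi] := exists_dominant K%:Z sb; have [psi' hpsi'] := exists_dominant (- K%:Z) sb.
have t := dominant_trivial (absz_nat K) bd hphi hpsi.
have wN : `|- K%:Z|%N = K by rewrite abszN.
have t' := dominant_trivial wN bd hphi' hpsi'.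
split.
  apply: (dominant_trivial_constant hphi hphi') => s.
  by have [? _] := t s; have [? _] := t' s.
apply: (dominant_trivial_constant hpsi hpsi') => s.
by have [_ ?] := t s; have [_ ?] := t' s.
Qed.

Lemma L2_hol_poly (h : Cn -> C) : hol_poly h -> L2 m h.
Proof.
move=> [P hP].
have -> : h = (fun z => \sum_(k <- mpoly.msupp P) mpoly.mcoeff k P *
    mono (mpoly.fun_of_multinom k) (fun=> 0%N) z).
  apply/funext => z; rewrite hP mpoly.mevalE; apply: eq_bigr => k _; congr (_ * _).
  by apply: eq_bigr => s _; rewrite expr0 mulr1.
by apply: L2_sum => k; apply: L2Z; exact: L2_mono.
Qed.

Lemma L2_toeplitz (f h : Cn -> C) : L2 m (toeplitz m f h).
Proof.
rewrite /toeplitz /Defs.proj; case: xgetP => [p _ [[]]//|_].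
exact: L2_zero.
Qed.

Lemma norm2Z k (h : Cn -> C) : L2 m h ->
  norm2 m (fun z => k * h z) = Normc.normc k * norm2 m h.
Proof.
move=> Lh; have n0 u : 0 <= norm2 m (u : Cn -> C) by exact: sqrtr_ge0.
apply/eqP; rewrite -(@eqrXn2 _ 2)//; last by rewrite mulr_ge0 ?normc_ge0.
have [_ Ih] := (L2P m h).1 Lh.
rewrite exprMn !norm2_sqr -(RintegralZl _ _ Ih)//; apply/eqP; apply: eq_Rintegral => t _.
by rewrite Normc.normcM exprMn [RHS]mulrA.
Qed.

(** Each of the two projections is a contraction of L^2_m, whether or not it
    exists as a function: [proj] is 0 otherwise. *)
Lemma bounded_of_constant (c d : C) :
  toeplitz_product_bounded m (fun _ : Cn => c) (fun _ : Cn => d).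
Proof.
exists (Normc.normc c * Normc.normc d) => h /L2_hol_poly Lh.
have step k u : L2 m u -> norm2 m (toeplitz m (fun _ : Cn => k) u) <= Normc.normc k * norm2 m u.
  by move=> Lu; rewrite -norm2Z//; apply: norm2_proj_le; exact: L2Z.
apply: (le_trans (step c _ (L2_toeplitz _ _))).
by rewrite -mulrA ler_wpM2l ?normc_ge0//; exact: step.
Qed.

End ProductPolynomials.

Theorem theorem1p1 (R : realType) (n m : nat) (f g : 'rV[R[i]]_n -> R[i])
    (hn : (1 <= n)%N) (hf : class_P f) (hg : class_P g)
    (hf0 : exists z, f z <> 0) (hg0 : exists z, g z <> 0) :
  toeplitz_product_bounded m f g <->
  (exists c, forall z, f z = c) /\ (exists c, forall z, g z = c).
Proof.
split=> [bd|[[c fc] [d gd]]]; last first.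
  by rewrite (funext fc) (funext gd); exact: bounded_of_constant.
have [Kf fP] := class_P_prod_poly hf; have [Kg gP] := class_P_prod_poly hg.
have [a fE] := fP _ (leq_maxl Kf Kg); have [b gE] := gP _ (leq_maxr Kf Kg).
rewrite (funext fE) in bd hf0 *; rewrite (funext gE) in bd hg0 *.
exact: (bounded_prod_poly_constant hn hf0 hg0 bd).
Qed.
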